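(* Suppose that $0<p_-\le p(\cdot)\le p_+<\infty$ and let $1\le a<\infty$ be a constant. Let $p$ be log-Hölder continuous on $\overline{\mathbb{D}}$ with bounded conjugate. Let $\mu$ be a positive finite Borel measure on $\mathbb{D}$. Then a necessary and sufficient condition that there exist a constant $C$ such that $\|f\|_{L^{ap(\cdot)}(\mu)}\le C\|f\|_{H,p(\cdot)}$ for every $f\in H^{p(\cdot)}$ is that there exist a constant $C'$ such that $\mu(S_{h,\theta_0})<C'h^a$ for every Carleson square $S_{h,\theta_0}$.
   Context: $\mathbb{D}$ is the open unit disc; $p_-=\operatorname{ess\,inf}p$, $p_+=\operatorname{ess\,sup}p$. An exponent $p$ on $\overline{\mathbb{D}}$ is log-Hölder continuous if there is a constant $C_0$ with $|p(z)-p(w)|\le C_0/\log\frac1{|z-w|}$ for all $z,w\in\overline{\mathbb{D}}$ with $|z-w|<1$; it is log-Hölder continuous with bounded conjugate if in addition the harmonic function in $\mathbb{D}$ with the same boundary values on the unit circle as $p$ has bounded harmonic conjugate. $M_{p(\cdot)}(r,f)=\inf\{\lambda>0:\frac1{2\pi}\int_0^{2\pi}|f(re^{i\theta})/\lambda|^{p(re^{i\theta})}d\theta<1\}$. $H^{p(\cdot)}$ is the set of analytic $f$ on $\mathbb{D}$ with $\sup_{0\le r<1}M_{p(\cdot)}(r,f)<\infty$, and for log-Hölder continuous $p$, $\|f\|_{H,p(\cdot)}=\lim_{r\to1}M_{p(\cdot)}(r,f)$ (the limit exists). $\|f\|_{L^{ap(\cdot)}(\mu)}=\inf\{\lambda>0:\int_{\mathbb{D}}|f(z)/\lambda|^{ap(z)}d\mu(z)<1\}$.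 A Carleson square is a set $S_{h,\theta_0}=\{z:1-h\le|z|<1,\ \theta_0-h/2<\arg z<\theta_0+h/2\}$ with $0<h\le 1$ and $\theta_0\in\mathbb{R}$ (arguments taken modulo $2\pi$). *)

(* Defs.v *)
From HB Require Import structures.
From mathcomp Require Import all_boot all_order all_algebra.
From mathcomp Require Import all_classical all_reals all_analysis.
From mathcomp Require Import measurable_realfun ess_sup_inf complex.

Set Implicit Arguments.
Unset Strict Implicit.
Unset Printing Implicit Defensive.
Import Order.TTheory GRing.Theory Num.Theory.
Import numFieldNormedType.Exports.

Local Open Scope classical_set_scope.
Local Open Scope complex_scope.
Local Open Scope ring_scope.

(* R[i] is seen as a normed module over itself, so that [derivable f z 1]
   for f : R[i] -> R[i] is complex differentiability of f at z. *)
HB.instance Definition _ (R : realType) := NormedModule.copy R[i] (R[i]^o).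

(* The norm `|z| of z : R[i] lives in R[i]; this is its R-valued version. *)
Definition cabs (R : realType) (z : R[i]) : R := complex.Re `|z|.

Definition polar (R : realType) (r t : R) : R[i] :=
  (r * cos t) +i* (r * sin t).

Definition disc (R : realType) : set R[i] := [set z | cabs z < 1].

Definition closed_disc (R : realType) : set R[i] := [set z | cabs z <= 1].

Definition unit_circle (R : realType) : set R[i] := [set z | cabs z = 1].

Definition borelC (R : realType) := g_sigma_algebraType (@open R[i]).

Section essential_bounds.
Variable R : realType.

Local Notation plane := (measurableTypeR R * measurableTypeR R)%type.

Definition closed_disc2 : set plane :=
  [set x | closed_disc (x.1 +i* x.2)].

Lemma measurable_closed_disc2 : measurable closed_disc2.
Proof.
have -> : closed_disc2 =
    (fun x : plane => (x.1 : R) ^+ 2 + (x.2 : R) ^+ 2) @^-1` `]-oo, 1%R].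
  apply/seteqP; split => x;
  rewrite /closed_disc2 /closed_disc /cabs /mkset normc_def /= in_itv /= => h.
    by rewrite -ler_sqrt // sqrtr1.
  by rewrite -sqrtr1 ler_sqrt.
have mf : measurable_fun setT (fun x : plane => (x.1 : R) ^+ 2 + (x.2 : R) ^+ 2).
  by apply: measurable_funD;
    apply: measurable_funX; [exact: measurable_fst|exact: measurable_snd].
by rewrite -[X in measurable X]setTI; exact: mf.
Qed.

Definition area_closed_disc : {measure set plane -> \bar R} :=
  mrestr (@lebesgue_measure R \x @lebesgue_measure R)%E measurable_closed_disc2.

Definition p_minus (p : R[i] -> R) : \bar R :=
  ess_inf area_closed_disc (fun x => (p (x.1 +i* x.2))%:E).

Definition p_plus (p : R[i] -> R) : \bar R :=
  ess_sup area_closed_disc (fun x => (p (x.1 +i* x.2))%:E).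

End essential_bounds.

Definition holomorphic_on_disc (R : realType) (f : R[i] -> R[i]) : Prop :=
  forall z, disc z -> derivable f z 1.

Section harmonic.
Variable R : realType.
Implicit Types u v : R[i] -> R.

Definition re_line u (z : R[i]) : R -> R := fun s => u (s +i* complex.Im z).
Definition im_line u (z : R[i]) : R -> R := fun s => u (complex.Re z +i* s).

Definition partial_re u (z : R[i]) : R := derive1 (re_line u z) (complex.Re z).
Definition partial_im u (z : R[i]) : R := derive1 (im_line u z) (complex.Im z).

Definition C1_on_disc u : Prop := forall z, disc z ->
  [/\ derivable (re_line u z) (complex.Re z) 1,
      derivable (im_line u z) (complex.Im z) 1,
      {for z, continuous (partial_re u)} &
      {for z, continuous (partial_im u)}].

Definition harmonic_on_disc u : Prop :=
  [/\ C1_on_disc u, C1_on_disc (partial_re u), C1_on_disc (partial_im u) &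
      forall z, disc z ->
        partial_re (partial_re u) z + partial_im (partial_im u) z = 0].

Definition harmonic_conjugate u v : Prop :=
  holomorphic_on_disc (fun z => u z +i* v z).

Definition has_boundary_values u (p : R[i] -> R) : Prop :=
  forall zeta, unit_circle zeta ->
    u z @[z --> within (@disc R) (nbhs zeta)] --> p zeta.

Definition log_holder (p : R[i] -> R) : Prop :=
  exists C0 : R, forall z w, closed_disc z -> closed_disc w ->
    0 < cabs (z - w) < 1 ->
    `|p z - p w| <= C0 / ln (cabs (z - w))^-1.

(* For continuous p the harmonic function u with boundary values p exists and
   is unique, and its conjugates differ by constants. *)
Definition log_holder_bounded_conjugate (p : R[i] -> R) : Prop :=
  log_holder p /\
  exists u, [/\ harmonic_on_disc u, has_boundary_values u p &
    exists v, harmonic_conjugate u v /\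
      exists M : R, forall z, disc z -> `|v z| <= M].

End harmonic.

Section norms.
Variable R : realType.
Implicit Types (p : R[i] -> R) (f : R[i] -> R[i]).
Local Open Scope ereal_scope.

(* The infimum is taken in \bar R, so that it is +oo when no lambda fits. *)
Definition circle_norm p (r : R) f : \bar R :=
  ereal_inf [set l%:E | l in [set l : R | (0 < l)%R /\
    ((2 * pi)^-1)%:E *
      \int[lebesgue_measure]_(t in `[0%R, (2 * pi)%R])
        ((cabs (f (polar r t)) / l) `^ p (polar r t))%:E < 1]].

Definition hardy p f : Prop :=
  holomorphic_on_disc f /\
  ereal_sup [set circle_norm p r f | r in [set r : R | (0 <= r < 1)%R]] < +oo.

Definition hardy_norm p f : \bar R :=
  lim (circle_norm p r f @[r --> (1%R : R)^'-]).

Definition lebesgue_norm (mu : set (borelC R) -> \bar R) p f : \bar R :=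
  ereal_inf [set l%:E | l in [set l : R | (0 < l)%R /\
    \int[mu]_(z in (@disc R : set (borelC R)))
      ((cabs (f z) / l) `^ p z)%:E < 1]].

End norms.

(* t ranges over the arguments of z; the origin, which has every real number
   as an argument in this sense, belongs to the squares with h = 1. *)
Definition carleson_square (R : realType) (h theta0 : R) : set R[i] :=
  [set z | 1 - h <= cabs z < 1 /\
    exists t : R, theta0 - h / 2 < t < theta0 + h / 2 /\ z = polar (cabs z) t].

(* Main.v *)
Require Import Defs.
From HB Require Import structures.
From mathcomp Require Import all_boot all_order all_algebra.
From mathcomp Require Import all_classical all_reals all_analysis.
From mathcomp Require Import complex.
From mathcomp Require Import ring lra measurable_realfun.
Set Implicit Arguments.
Unset Strict Implicit.
Unset Printing Implicit Defensive.
Import Order.TTheory GRing.Theory Num.Theory.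
Import numFieldNormedType.Exports.
Local Open Scope classical_set_scope.
Local Open Scope complex_scope.
Local Open Scope ring_scope.

(** Both directions compare |f| ^ p with Poisson integrals.  Log-Hoelder continuity says that
    powers h ^ (p z - p w) are bounded when |z - w| is of order at most the square root of h;
    this is what allows a variable exponent to be frozen at the scales that matter.

    Necessity.  For a square of size h, let w be the middle of its inner side, |w| = 1 - h, and
    f z = h ^ (n - 1 / p w) / (1 - conj w z) ^ n with n p >= 2.  Where |f| > 1, the point z is
    within a multiple of the square root of h from w, so that |f| ^ (p z) is comparable to
    |f| ^ (p w), which is at most h / |1 - conj w z| ^ 2.  The latter is dominated by a Poisson
    kernel, whose means are 1, hence the norms of f are bounded independently of h
    (test_circle_le), whereas |f| ^ (a p) is at least a multiple of h ^ (- a) on the square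
    (test_power_ge).

    Sufficiency.  Let s <= 1 be a small exponent.  |f| ^ s is dominated by the Poisson integral
    of its values on a circle (cabs_powR_le_PI); this rests on the mean value property, proved
    here from Goursat's bisection argument in polar coordinates, and on the maximum principle.
    Write W f = |f| ^ (p / 2) = (|f| ^ s) ^ q with a variable exponent q >= 1.  Jensen's
    inequality for the variable exponent q holds up to a constant (PI_powR_crude), whence
    W f <= C (P (W f) + 1), where P averages over a circle of larger radius on which the modular
    is bounded (W_le_PI).  It remains to see that the Poisson integral maps L ^ 2 of the circle
    to L ^ (2 a) of a Carleson measure (poisson_embedding).  Where the Poisson integral of k
    exceeds lam, the function k, truncated at a multiple of lam, has mass at least a multiple of
    lam s on an arc of radius s.  A Vitali selection among these arcs bounds the measure of the
    level set by the power a of the mean of the truncation over lam (poisson_level_cover), and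
    the bounds sum up over dyadic levels to a multiple of the power a of the mean of k ^ 2.

    The Hardy norm is a limit of circle norms, so the argument also needs that this limit exists
    (circle_norm_cvg).  For a constant exponent the circle norms increase with the radius.
    Here they almost do.  For points near the circle the exponent is nearly constant on the
    arc that matters and Jensen's inequality holds up to a small error (PI_powR_sharp), as long
    as the Poisson integral stays bounded.  The large values are harmless because the functions
    W f on the circles are uniformly square integrable (W_uniformly_integrable): near-minimal
    elements, in L ^ 2, of the convex sets of functions v with W f <= C (P v + 1) are close to
    one another by the parallelogram identity, so that a single bounded one dominates W f on all
    circles up to a small error. *)

(** * Modulus, polar form and complex differentiability *)

Section complex_modulus.
Variable R : realType.
Implicit Types (z w : R[i]) (t r : R).

Lemma normc_cabs z : `|z| = (cabs z)%:C.
Proof. by rewrite /cabs normc_def. Qed.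

Lemma cabsE z : cabs z = Num.sqrt (complex.Re z ^+ 2 + complex.Im z ^+ 2).
Proof. by rewrite /cabs normc_def. Qed.

Lemma cabs_ge0 z : 0 <= cabs z.
Proof. by rewrite cabsE sqrtr_ge0. Qed.

Lemma sqr_cabs z : cabs z ^+ 2 = complex.Re z ^+ 2 + complex.Im z ^+ 2.
Proof. by rewrite cabsE sqr_sqrtr // addr_ge0 // sqr_ge0. Qed.

Lemma cabsM z w : cabs (z * w) = cabs z * cabs w.
Proof. by apply: complexI; rewrite rmorphM /= -!normc_cabs normrM. Qed.

Lemma ler_cabsD z w : cabs (z + w) <= cabs z + cabs w.
Proof. by rewrite -lecR rmorphD /= -!normc_cabs ler_normD. Qed.

Lemma cabsN z : cabs (- z) = cabs z.
Proof. by rewrite /cabs normrN. Qed.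

Lemma cabs_distrC z w : cabs (z - w) = cabs (w - z).
Proof. by rewrite -cabsN opprB. Qed.

Lemma cabs0 : cabs (0 : R[i]) = 0.
Proof. by rewrite /cabs normr0. Qed.

Lemma cabs1 : cabs (1 : R[i]) = 1.
Proof. by rewrite /cabs normr1. Qed.

Lemma cabs_eq0 z : (cabs z == 0) = (z == 0).
Proof. by rewrite -[RHS]normr_eq0 normc_cabs eq_complex /= eqxx andbT. Qed.

Lemma cabs_gt0 z : (0 < cabs z) = (z != 0).
Proof. by rewrite lt_neqAle eq_sym cabs_eq0 cabs_ge0 andbT. Qed.

Lemma cabsV z : cabs z^-1 = (cabs z)^-1.
Proof. by apply: complexI; rewrite -normc_cabs normfV normc_cabs fmorphV. Qed.

Lemma cabsX z n : cabs (z ^+ n) = cabs z ^+ n.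
Proof. by apply: complexI; rewrite -normc_cabs normrX normc_cabs rmorphXn. Qed.

Lemma cabs_real (x : R) : cabs x%:C = `|x|.
Proof. by rewrite cabsE /= expr0n /= addr0 sqrtr_sqr. Qed.

Lemma ler_Re_cabs z : `|complex.Re z| <= cabs z.
Proof.
by rewrite -(ler_pXn2r (ltn0Sn 1)) ?nnegrE ?cabs_ge0 // sqr_cabs
  real_normK ?num_real // lerDl sqr_ge0.
Qed.

Lemma ler_Im_cabs z : `|complex.Im z| <= cabs z.
Proof.
by rewrite -(ler_pXn2r (ltn0Sn 1)) ?nnegrE ?cabs_ge0 // sqr_cabs
  real_normK ?num_real // lerDr sqr_ge0.
Qed.

Lemma ler_cabs_ReIm z : cabs z <= `|complex.Re z| + `|complex.Im z|.
Proof.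
rewrite -(ler_pXn2r (ltn0Sn 1)) ?nnegrE ?cabs_ge0 ?addr_ge0 // sqr_cabs.
rewrite sqrrD !real_normK ?num_real // -addrA lerD2l lerDr.
by rewrite mulrn_wge0 // mulr_ge0.
Qed.

Lemma ler_cabsB z w : cabs z - cabs w <= cabs (z - w).
Proof. by rewrite lerBlDr (le_trans _ (ler_cabsD _ _)) // subrK. Qed.

Lemma ler_cabs_sub z w : cabs (z - w) <= cabs z + cabs w.
Proof. by rewrite -(cabsN w) ler_cabsD. Qed.

Lemma ler_cabs_dist z w : `|cabs z - cabs w| <= cabs (z - w).
Proof. by rewrite ler_norml lerNl opprB ler_cabsB cabs_distrC ler_cabsB. Qed.

Lemma ler_cabs_triangle v z w : cabs (z - w) <= cabs (z - v) + cabs (v - w).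
Proof. by rewrite (le_trans _ (ler_cabsD _ _)) // addrA subrK. Qed.

Lemma ReB z w : complex.Re (z - w) = complex.Re z - complex.Re w.
Proof. by case: z; case: w. Qed.

Lemma ImB z w : complex.Im (z - w) = complex.Im z - complex.Im w.
Proof. by case: z; case: w. Qed.

Lemma polarE r t : polar r t = r%:C * polar 1 t.
Proof. by apply/eqP; rewrite eq_complex /=; apply/andP; split; apply/eqP; ring. Qed.

Lemma cabs_polar1 t : cabs (polar 1 t) = 1.
Proof. by rewrite cabsE /= !mul1r cos2Dsin2 sqrtr1. Qed.

Lemma cabs_polar r t : cabs (polar r t) = `|r|.
Proof. by rewrite polarE cabsM cabs_polar1 mulr1 cabs_real. Qed.

Lemma polar1D s t : polar 1 (s + t) = polar 1 s * polar 1 t.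
Proof.
by apply/eqP; rewrite eq_complex /= cosD sinD; apply/andP; split; apply/eqP; ring.
Qed.

Lemma polarM r r' s t : polar r s * polar r' t = polar (r * r') (s + t).
Proof.
by rewrite (polarE r) (polarE r') (polarE (r * r')) polar1D rmorphM /= mulrACA.
Qed.

Lemma polar_2pi r : polar r (2 * pi) = polar r 0.
Proof.
by rewrite /polar mulr_natl cos2pi sin2pi cos0 sin0.
Qed.

Lemma polar0 r : polar r 0 = r%:C.
Proof. by rewrite /polar cos0 sin0 mulr1 mulr0. Qed.

(** The angle is plus or minus the arc cosine of Re z / |z|.  Its cosine is recorded because
    membership in a square will be decided by cosines. *)
Lemma polar_arg z : exists t, [/\ z = polar (cabs z) t, `|t| <= pi &
   cos t * cabs z = complex.Re z].
Proof.
have [->|z0] := eqVneq z 0.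
  exists 0; split; rewrite ?cabs0 ?polar0 ?normr0 ?pi_ge0 //=.
  by rewrite mulr0.
have c0 : 0 < cabs z by rewrite cabs_gt0.
set x := complex.Re z / cabs z.
have x1 : -1 <= x <= 1.
  by rewrite -ler_norml normrM normfV (ger0_norm (cabs_ge0 z)) ler_pdivrMr //
    mul1r ler_Re_cabs.
have xE : x * cabs z = complex.Re z by rewrite /x divfK // gt_eqF.
have sE : complex.Im z ^+ 2 = (cabs z * sin (acos x)) ^+ 2.
  rewrite exprMn sin2cos2 acosK ?itv_boundlr //= ?in_itv //=.
  rewrite mulrBr mulr1 -exprMn (mulrC _ x) xE sqr_cabs; ring.
have/orP[/eqP s|/eqP s] : (complex.Im z == cabs z * sin (acos x))
    || (complex.Im z == - (cabs z * sin (acos x))).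
  by rewrite -eqf_sqr sE.
- exists (acos x); split.
  + apply/eqP; rewrite eq_complex /= acosK ?in_itv //= (mulrC _ x) xE -s.
    by rewrite !eqxx.
  + by rewrite ger0_norm ?acos_ge0 // acos_lepi.
  + by rewrite acosK ?in_itv.
- exists (- acos x); split.
  + apply/eqP; rewrite eq_complex /= cosN sinN mulrN acosK ?in_itv //=.
    by rewrite (mulrC _ x) xE -s !eqxx.
  + by rewrite normrN ger0_norm ?acos_ge0 // acos_lepi.
  + by rewrite cosN acosK ?in_itv.
Qed.

End complex_modulus.

Section complex_differentiability.
Variable R : realType.
Implicit Types (F G : R[i] -> R[i]) (z w : R[i]).

(** An error bound in the real modulus: the norm of R[i] takes its values in R[i], which
    makes limits awkward in estimates. *)
Definition has_cderiv F z L := forall e : R, 0 < e -> exists2 d, 0 < d &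
  forall h, cabs h < d -> cabs (F (z + h) - F z - L * h) <= e * cabs h.

Definition cdiff F z := exists L, has_cderiv F z L.

Lemma derivable_cdiff F z : derivable F z 1 -> cdiff F z.
Proof.
move=> /cvg_ex[/= L HL]; exists L => e e0.
have /cvgrPdist_lt /(_ e%:C) := HL; rewrite ltcR => /(_ e0).
rewrite /dnbhs near_withinE nearE.
move/nbhs_ballP => [[d d'] /= dgt H].
have dr : d' = 0 by move: dgt; rewrite ltcE /= => /andP[/eqP].
rewrite dr in dgt H *; rewrite ltcR in dgt.
exists d => // h hd.
have [->|h0] := eqVneq h 0.
  by rewrite addr0 subrr mulr0 subr0 cabs0 mulr0.
have := H h; rewrite /ball /= sub0r normrN normc_cabs ltcR => /(_ hd h0).
rewrite normc_cabs ltcR => /ltW.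
have -> : h *: (1 : R[i]) + z = z + h by rewrite addrC /GRing.scale /= mulr1.
have -> : F (z + h) - F z - L * h = - (L - h^-1 *: (F (z + h) - F z)) * h.
  by rewrite /GRing.scale /=; field.
by move=> Hle; rewrite cabsM cabsN ler_wpM2r // cabs_ge0.
Qed.

Lemma cdiff_derivable F z : cdiff F z -> derivable F z 1.
Proof.
move=> [L HL]; apply/cvg_ex; exists L; apply/cvgrPdist_le => -[e e'] egt.
have er : e' = 0 by move: egt; rewrite ltcE /= => /andP[/eqP].
rewrite er in egt *; rewrite ltcR in egt.
have [d d0 H] := HL e egt.
rewrite /dnbhs near_withinE nearE; apply/nbhs_ballP; exists d%:C => /=.
  by rewrite ltcR.
move=> h; rewrite /ball /= sub0r normrN normc_cabs ltcR => hd h0.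
have -> : h *: (1 : R[i]) + z = z + h by rewrite addrC /GRing.scale /= mulr1.
have -> : L - h^-1 *: (F (z + h) - F z) = - ((F (z + h) - F z - L * h) / h).
  by rewrite /GRing.scale /=; field.
rewrite normc_cabs lecR cabsN cabsM cabsV ler_pdivrMr ?cabs_gt0 //.
exact: H.
Qed.

End complex_differentiability.

(** * Goursat's lemma for rectangles *)

Section segment_integral.
Variable R : realType.
Implicit Types (f g : R -> R) (a b c : R).

Definition seg_integrable a b f := (@lebesgue_measure R).-integrable `[a, b] (EFin \o f).
Definition seg_integral a b f : R := (\int[@lebesgue_measure R]_(x in `[a, b]) f x)%R.

Lemma seg_integrable_continuous a b f : {in `[a, b], continuous f} -> seg_integrable a b f.
Proof.
move=> cf; apply: continuous_compact_integrable; first exact: segment_compact.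
apply: continuous_in_subspaceT => x; rewrite inE; exact: cf.
Qed.

Lemma seg_integrable_cst a b c : seg_integrable a b (fun=> c).
Proof. by apply: seg_integrable_continuous => x _; exact: cst_continuous. Qed.

Lemma seg_integrableS a b a' b' f : a <= a' -> b' <= b -> seg_integrable a b f -> seg_integrable a' b' f.
Proof.
move=> aa bb; apply: integrableS => //=.
by move=> x /=; rewrite !in_itv /= => /andP[? ?]; apply/andP; split; lra.
Qed.

Lemma seg_integrableB a b f g : seg_integrable a b f -> seg_integrable a b g -> seg_integrable a b (fun x => f x - g x).
Proof. by move=> If Ig; apply: (integrableB _ If Ig); exact: measurable_itv. Qed.

Lemma seg_integral_D a b f g : seg_integrable a b f -> seg_integrable a b g ->
  seg_integral a b (fun x => f x + g x) = seg_integral a b f + seg_integral a b g.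
Proof. by move=> *; rewrite /seg_integral RintegralD. Qed.

Lemma seg_integral_B a b f g : seg_integrable a b f -> seg_integrable a b g ->
  seg_integral a b (fun x => f x - g x) = seg_integral a b f - seg_integral a b g.
Proof. by move=> *; rewrite /seg_integral RintegralB. Qed.

Lemma seg_integral_Z a b k f : seg_integrable a b f -> seg_integral a b (fun x => k * f x) = k * seg_integral a b f.
Proof. by move=> *; rewrite /seg_integral RintegralZl. Qed.

Lemma seg_integral_cst a b k : a <= b -> seg_integral a b (fun=> k) = k * (b - a).
Proof.
move=> ab; rewrite /seg_integral Rintegral_cst //= lebesgue_measure_itv /= lte_fin.
by have [//|ba] := ltP a b; rewrite (@le_anti _ _ a b) ?ab // subrr.
Qed.

Lemma seg_integral_le a b f g : seg_integrable a b f -> seg_integrable a b g ->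
  (forall x, a <= x <= b -> f x <= g x) -> seg_integral a b f <= seg_integral a b g.
Proof.
by move=> If Ig fg; apply: le_Rintegral => // x /=; rewrite in_itv /=; exact: fg.
Qed.

Lemma seg_integral_ge0 a b f : (forall x, a <= x <= b -> 0 <= f x) -> 0 <= seg_integral a b f.
Proof. by move=> f0; apply: Rintegral_ge0 => x /=; rewrite in_itv /=; exact: f0. Qed.

Lemma seg_integral_eq a b f g : (forall x, a <= x <= b -> f x = g x) -> seg_integral a b f = seg_integral a b g.
Proof.
by move=> fg; apply: eq_Rintegral => x; rewrite inE /= in_itv /=; exact: fg.
Qed.

Lemma seg_integral_near_cst a b f k e : a <= b -> seg_integrable a b f ->
  (forall x, a <= x <= b -> `|f x - k| <= e) -> `|seg_integral a b f - k * (b - a)| <= e * (b - a).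
Proof.
move=> ab If fe; rewrite -(seg_integral_cst k ab) -seg_integral_B //; last exact: seg_integrable_cst.
rewrite ler_norml; apply/andP; split.
  rewrite -mulNr -(seg_integral_cst _ ab); apply: seg_integral_le; [exact: seg_integrable_cst| |].
    by apply: seg_integrableB => //; exact: seg_integrable_cst.
  by move=> x /fe; rewrite ler_norml => /andP[].
rewrite -(seg_integral_cst _ ab); apply: seg_integral_le; [|exact: seg_integrable_cst|].
  by apply: seg_integrableB => //; exact: seg_integrable_cst.
by move=> x /fe; rewrite ler_norml => /andP[].
Qed.

Lemma seg_integral_split a c b f : a <= c <= b -> seg_integrable a b f -> seg_integral a b f = seg_integral a c f + seg_integral c b f.
Proof.
move=> /andP[ac cb] If; rewrite /seg_integral.
have := @Rintegral_itvB R f (BLeft a) (BRight b) c If.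
rewrite !bnd_simp => /(_ ac cb) /eqP; rewrite subr_eq => /eqP ->.
rewrite addrC Rintegral_itv_obnd_cbnd //.
apply: integrableS If => //= x /=; rewrite !in_itv /= => /andP[? ->].
by rewrite andbT; lra.
Qed.

End segment_integral.

Section goursat.
Variable R : realType.

(** The left endpoints increase and the right endpoints decrease. *)
Lemma nested_halving (x : nat -> R) l : 0 <= l ->
  (forall n, x n.+1 = x n \/ x n.+1 = x n + l / 2 ^+ n.+1) ->
  exists y, forall n, x n <= y <= x n + l / 2 ^+ n.
Proof.
move=> l0 H.
have p n : 0 <= l / 2 ^+ n by rewrite divr_ge0 // exprn_ge0.
have h n : l / 2 ^+ n = l / 2 ^+ n.+1 + l / 2 ^+ n.+1.
  by rewrite exprS; field; rewrite expf_neq0.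
have up n m : x n <= x (n + m)%N.
  elim: m => [|m IH]; first by rewrite addn0.
  by rewrite addnS (le_trans IH) //; have := p (n + m).+1; case: (H (n + m)%N) => ->; lra.
have dn n m : x (n + m)%N + l / 2 ^+ (n + m) <= x n + l / 2 ^+ n.
  elim: m => [|m IH]; first by rewrite addn0.
  rewrite addnS (le_trans _ IH) //.
  by have := p (n + m).+1; have := h (n + m)%N; case: (H (n + m)%N) => ->; lra.
have cr n m : x m <= x n + l / 2 ^+ n.
  have [mn|/ltnW nm] := leqP m n.
    by have := up m (n - m)%N; rewrite subnKC // => /le_trans; apply; rewrite lerDl.
  have := dn n (m - n)%N; rewrite subnKC // => /(le_trans _); apply.
  by rewrite lerDl.
have ub n : ubound (range x) (x n + l / 2 ^+ n) by move=> _ [m _ <-].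
have hs : has_sup (range x).
  by split; [exists (x 0%N); exists 0%N|exists (x 0%N + l / 2 ^+ 0)].
exists (sup (range x)) => n; apply/andP; split.
  by apply: ub_le_sup; [exact: hs.2|exists n].
by apply: ge_sup; [exact: hs.1|exact: ub].
Qed.

(** The circulation of the form A dx + B dt around the rectangle [x, y] * [s, t], with
    opposite sides paired in one integral. *)
Definition circulation (A B : R -> R -> R) (x y s t : R) :=
  seg_integral x y (fun u => A u s - A u t) + seg_integral s t (fun v => B y v - B x v).

Lemma circulation_quarters (A B : R -> R -> R) (x m y s n t : R) :
    x <= m <= y -> s <= n <= t ->
    seg_integrable x y (A^~ s) -> seg_integrable x y (A^~ n) -> seg_integrable x y (A^~ t) ->
    seg_integrable s t (B x) -> seg_integrable s t (B m) -> seg_integrable s t (B y) ->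
  circulation A B x y s t = (circulation A B x m s n + circulation A B m y s n) +
                     (circulation A B x m n t + circulation A B m y n t).
Proof.
move=> xmy snt As An At Bx Bm By; rewrite /circulation.
have/andP[xm my] := xmy; have/andP[sn nt] := snt.
have sL f : seg_integrable x y f -> seg_integrable x m f by apply: seg_integrableS.
have sR f : seg_integrable x y f -> seg_integrable m y f by apply: seg_integrableS.
have tL f : seg_integrable s t f -> seg_integrable s n f by apply: seg_integrableS.
have tR f : seg_integrable s t f -> seg_integrable n t f by apply: seg_integrableS.
rewrite !seg_integral_B //; try by [exact: sL|exact: sR|exact: tL|exact: tR].
rewrite (seg_integral_split xmy As) (seg_integral_split xmy At) (seg_integral_split snt By) (seg_integral_split snt Bx).
ring.
Qed.

(** The main terms of the two integrals cancel because the same k governs the variation of A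
    in t and of B in x. *)
Lemma circulation_small (A B : R -> R -> R) (x s L W k e : R) : 0 < L -> 0 < W ->
    seg_integrable x (x + L) (fun u => A u s - A u (s + W)) ->
    seg_integrable s (s + W) (fun v => B (x + L) v - B x v) ->
    (forall u, x <= u <= x + L ->
       `|A u s - A u (s + W) - k * (s - (s + W))| <= e * (L + W)) ->
    (forall v, s <= v <= s + W ->
       `|B (x + L) v - B x v - k * (x + L - x)| <= e * (L + W)) ->
  `|circulation A B x (x + L) s (s + W)| <= e * (L + W) ^+ 2.
Proof.
move=> L0 W0 iA iB hA hB; rewrite /circulation.
have xL : x <= x + L by rewrite lerDl ltW.
have sW : s <= s + W by rewrite lerDl ltW.
have I1 := seg_integral_near_cst xL iA hA.
have I2 := seg_integral_near_cst sW iB hB.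
set P := seg_integral x _ _ in I1 *; set Q := seg_integral s _ _ in I2 *.
have -> : P + Q = (P - k * (s - (s + W)) * (x + L - x)) +
                  (Q - k * (x + L - x) * (s + W - s)) by ring.
apply: le_trans (ler_normD _ _) _.
apply: le_trans (lerD I1 I2) _.
by rewrite le_eqVlt; apply/orP; left; apply/eqP; ring.
Qed.

Lemma pigeonhole4 (r1 r2 r3 r4 z : R) : 4 * z < `|r1 + r2 + (r3 + r4)| ->
  [\/ z < `|r1|, z < `|r2|, z < `|r3| | z < `|r4| ].
Proof.
move=> hz.
have [|h1] := ltP z `|r1|; first by constructor 1.
have [|h2] := ltP z `|r2|; first by constructor 2.
have [|h3] := ltP z `|r3|; first by constructor 3.
have [|h4] := ltP z `|r4|; first by constructor 4.
have := ler_normD (r1 + r2) (r3 + r4); have := ler_normD r1 r2.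
by have := ler_normD r3 r4; lra.
Qed.

Lemma in_range (x l y u : R) : x <= y <= x + l -> x <= u <= x + l ->
  `|u - y| <= l.
Proof. by move=> /andP[? ?] /andP[? ?]; rewrite ler_norml; apply/andP; split; lra. Qed.

(** Bisection: if the circulation exceeded e times the area, so would that of one of the
    four quarters, and so on.  At the common point of the nested rectangles this contradicts
    the hypothesis, which says that the form is infinitesimally closed at each point. *)
Lemma goursat_rectangle (A B : R -> R -> R) (a b c d : R) : a < b -> c < d ->
  (forall t : R, c <= t <= d -> {in `[a, b], continuous (A^~ t)}) ->
  (forall x : R, a <= x <= b -> {in `[c, d], continuous (B x)}) ->
  (forall x0 t0 : R, a <= x0 <= b -> c <= t0 <= d ->
     exists k : R, forall e : R, 0 < e ->
     exists2 del : R, 0 < del & forall D x1 x2 t1 t2 : R, D < del ->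
       a <= x1 <= b -> a <= x2 <= b -> c <= t1 <= d -> c <= t2 <= d ->
       `|x1 - x0| <= D -> `|x2 - x0| <= D -> `|t1 - t0| <= D -> `|t2 - t0| <= D ->
       `|A x1 t1 - A x1 t2 - k * (t1 - t2)| <= e * D /\
       `|B x2 t1 - B x1 t1 - k * (x2 - x1)| <= e * D) ->
  circulation A B a b c d = 0.
Proof.
move=> ab cd cA cB H.
suff sm e : 0 < e -> `|circulation A B a b c d| <= e * ((b - a) * (d - c)).
  apply/eqP; rewrite -normr_eq0 eq_le normr_ge0 andbT.
  have area : 0 < (b - a) * (d - c) by rewrite mulr_gt0 // subr_gt0.
  apply/ler_addgt0Pl => e e0; rewrite addr0.
  have := sm (e / ((b - a) * (d - c))); rewrite divfK ?gt_eqF //.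
  by apply; rewrite divr_gt0.
move=> e0; rewrite leNgt; apply/negP => bad0.
have iA x y s : a <= x -> y <= b -> c <= s <= d -> seg_integrable x y (A^~ s).
  by move=> *; apply: (@seg_integrableS _ a b) => //; apply: seg_integrable_continuous; exact: cA.
have iB x s t : a <= x <= b -> c <= s -> t <= d -> seg_integrable s t (B x).
  by move=> *; apply: (@seg_integrableS _ c d) => //; apply: seg_integrable_continuous; exact: cB.
have [l lE] : exists l, l = b - a by exists (b - a).
have [w wE] : exists w, w = d - c by exists (d - c).
have l0 : 0 < l by rewrite lE subr_gt0.
have w0 : 0 < w by rewrite wE subr_gt0.
have [L LE] : exists L, forall n, L n = l / 2 ^+ n by exists (fun n => l / 2 ^+ n).
have [W WE] : exists W, forall n, W n = w / 2 ^+ n by exists (fun n => w / 2 ^+ n).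
have p2 n : (2 : R) ^+ n != 0 by rewrite expf_neq0.
have L0 n : 0 < L n by rewrite LE divr_gt0 // exprn_gt0.
have W0 n : 0 < W n by rewrite WE divr_gt0 // exprn_gt0.
have LS n : L n = L n.+1 + L n.+1 by rewrite !LE exprS; field.
have WS n : W n = W n.+1 + W n.+1 by rewrite !WE exprS; field.
pose bad n (q : R * R) := [/\ a <= q.1, q.1 + L n <= b, c <= q.2, q.2 + W n <= d &
  e * (L n * W n) < `|circulation A B q.1 (q.1 + L n) q.2 (q.2 + W n)| ].
have step (nq : nat * (R * R)) : exists q', bad nq.1 nq.2 ->
    [/\ bad nq.1.+1 q', q'.1 = nq.2.1 \/ q'.1 = nq.2.1 + L nq.1.+1 &
        q'.2 = nq.2.2 \/ q'.2 = nq.2.2 + W nq.1.+1].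
  case: nq => n [x t] /=.
  have [[/= ax xb ct td B0]|nb] := pselect (bad n (x, t)); last by exists (0, 0).
  have L1 := L0 n.+1; have W1 := W0 n.+1.
  have B1 : 4 * (e * (L n.+1 * W n.+1)) < `|circulation A B x (x + L n) t (t + W n)|.
    by apply: le_lt_trans B0; rewrite (LS n) (WS n) le_eqVlt; apply/orP; left;
      apply/eqP; ring.
  rewrite (LS n) (WS n) !addrA in xb td B1.
  move: xb td B1; have [m mE] : exists m, m = x + L n.+1 by exists (x + L n.+1).
  have [k kE] : exists k, k = t + W n.+1 by exists (t + W n.+1).
  rewrite -mE -kE => xb td B1.
  have xm : x <= m by rewrite mE lerDl ltW.
  have mb : m <= m + L n.+1 by rewrite lerDl ltW.
  have tk : t <= k by rewrite kE lerDl ltW.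
  have kd : k <= k + W n.+1 by rewrite lerDl ltW.
  have am := le_trans ax xm; have ck := le_trans ct tk.
  have mb' := le_trans mb xb; have kd' := le_trans kd td.
  have xb' := le_trans xm mb'; have td' := le_trans tk kd'.
  have aL := le_trans am mb; have cW := le_trans ck kd.
  rewrite (@circulation_quarters A B x m _ t k) in B1; first last.
  - by apply: iB => //; apply/andP; split.
  - by apply: iB => //; apply/andP; split.
  - by apply: iB => //; apply/andP; split.
  - by apply: iA => //; apply/andP; split.
  - by apply: iA => //; apply/andP; split.
  - by apply: iA => //; apply/andP; split.
  - by apply/andP; split.
  - by apply/andP; split.
  case: (pigeonhole4 B1) => Hb.
  - exists (x, t) => _; split; [|by left|by left].
    by split => //=; rewrite -?mE -?kE.
  - exists (m, t) => _; split; [|by right|by left].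
    by split => //=; rewrite -?mE -?kE.
  - exists (x, k) => _; split; [|by left|by right].
    by split => //=; rewrite -?mE -?kE.
  - exists (m, k) => _; split; [|by right|by right].
    by split => //=; rewrite -?mE -?kE.
have [f Hf] := choice step.
pose q := fix q n := if n is n'.+1 then f (n', q n') else (a, c).
have badq n : bad n (q n).
  elim: n => [|n IH] /=.
    rewrite /bad LE WE expr0 !divr1 lE wE /=.
    by rewrite [a + _]addrC [c + _]addrC !subrK; split.
  by have [] := Hf (n, q n) IH.
have [x0 Hx0] : exists y, forall n, (q n).1 <= y <= (q n).1 + l / 2 ^+ n.
  apply: nested_halving (ltW l0) _ => n.
  by have [_ + _] := Hf (n, q n) (badq n); rewrite /= LE.
have [t0 Ht0] : exists y, forall n, (q n).2 <= y <= (q n).2 + w / 2 ^+ n.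
  apply: nested_halving (ltW w0) _ => n.
  by have [_ _ +] := Hf (n, q n) (badq n); rewrite /= WE.
have ix0 : a <= x0 <= b.
  by have := Hx0 0%N; rewrite /= expr0 divr1 lE [a + _]addrC subrK.
have it0 : c <= t0 <= d.
  by have := Ht0 0%N; rewrite /= expr0 divr1 wE [c + _]addrC subrK.
have [k Hk] := H x0 t0 ix0 it0.
have lw0 : 0 < l + w by rewrite addr_gt0.
(* chosen so that e1 * (L n + W n) ^ 2 is half of e * (L n * W n) *)
have [e1 e1E] : exists e1, e1 = e * (l * w) / (2 * (l + w) ^+ 2).
  by exists (e * (l * w) / (2 * (l + w) ^+ 2)).
have e10 : 0 < e1.
  by rewrite e1E divr_gt0 // ?mulr_gt0 // exprn_gt0.
have [del del0 Hd] := Hk e1 e10.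
have [n Hn] : exists n, L n + W n < del.
  have : (l + w) / 2 ^+ n @[n --> \oo] --> (0 : R).
    rewrite -(mulr0 (l + w)); apply: cvgM; first exact: cvg_cst.
    under eq_fun do rewrite -exprVn.
    by apply: cvg_expr; rewrite ger0_norm ?invr_ge0 // invf_lt1 // ltr1n.
  move=> /cvgrPdist_lt /(_ _ del0) [N _ /(_ N (leqnn N))] /=.
  rewrite sub0r normrN => HN; exists N.
  by rewrite LE WE -mulrDl (le_lt_trans (ler_norm _)).
have [ax xb ct td] := badq n.
have x0n := Hx0 n; have t0n := Ht0 n; rewrite -LE in x0n; rewrite -WE in t0n.
rewrite ltNge => /negP; apply.
have Lp := ltW (L0 n); have Wp := ltW (W0 n).
have hx u : (q n).1 <= u <= (q n).1 + L n -> `|u - x0| <= L n + W n.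
  by move=> hu; rewrite (le_trans (in_range x0n hu)) // lerDl.
have ht u : (q n).2 <= u <= (q n).2 + W n -> `|u - t0| <= L n + W n.
  by move=> hu; rewrite (le_trans (in_range t0n hu)) // lerDr.
have xa u : (q n).1 <= u <= (q n).1 + L n -> a <= u <= b.
  by move=> /andP[u1 u2]; rewrite (le_trans ax u1) (le_trans u2 xb).
have tc u : (q n).2 <= u <= (q n).2 + W n -> c <= u <= d.
  by move=> /andP[u1 u2]; rewrite (le_trans ct u1) (le_trans u2 td).
have x1 : (q n).1 <= (q n).1 <= (q n).1 + L n by rewrite lexx lerDl.
have x2 : (q n).1 <= (q n).1 + L n <= (q n).1 + L n by rewrite lexx lerDl Lp.
have t1 : (q n).2 <= (q n).2 <= (q n).2 + W n by rewrite lexx lerDl.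
have t2 : (q n).2 <= (q n).2 + W n <= (q n).2 + W n by rewrite lexx lerDl Wp.
apply: le_trans (@circulation_small A B _ _ _ _ k e1 (L0 n) (W0 n) _ _ _ _) _.
- by apply: seg_integrableB; apply: iA => //; exact: tc.
- by apply: seg_integrableB; apply: iB => //; exact: xa.
- move=> u hu.
  have [] := Hd _ u u _ ((q n).2 + W n) Hn (xa _ hu) (xa _ hu) (tc _ t1) (tc _ t2).
  + exact: hx.
  + exact: hx.
  + exact: ht.
  + exact: ht.
  by [].
- move=> v hv.
  have [] := Hd _ _ ((q n).1 + L n) v v Hn (xa _ x1) (xa _ x2) (tc _ hv) (tc _ hv).
  + exact: hx.
  + exact: hx.
  + exact: ht.
  + exact: ht.
  by [].
have -> : e1 * (L n + W n) ^+ 2 = e * (L n * W n) / 2.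
  by rewrite e1E LE WE; field; rewrite p2 gt_eqF.
by rewrite ler_pdivrMr // ler_peMr // ?ler1n // ltW // !mulr_gt0.
Qed.

End goursat.

(** * Estimates for polar coordinates *)

Section trigonometric_bounds.
Variable R : realType.
Implicit Types (x t r : R).

Lemma ler_mvt (f f' : R -> R) (g : R) x : 0 <= x -> (forall y : R, is_derive y (1 : R) f (f' y)) ->
  (forall y, 0 <= y <= x -> `|f' y| <= g) -> `|f x - f 0| <= g * x.
Proof.
move=> x0 df fg.
have [y] := @MVT_segment R f f' 0 x x0 (fun y _ => df y)
  (derivable_within_continuous (fun y _ => @ex_derive _ _ _ _ _ _ _ (df y))).
rewrite in_itv /= => hy ->; rewrite subr0 normrM (ger0_norm x0).
by rewrite ler_wpM2r // fg.
Qed.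

Lemma ler_sin x : `|sin x| <= `|x|.
Proof.
wlog x0 : x / 0 <= x => [H|].
  have [/H //|/ltW x0] := leP 0 x.
  by rewrite -normrN -sinN -(normrN x); apply: H; rewrite oppr_ge0.
rewrite (ger0_norm x0) -[sin x]subr0 -sin0 -[leRHS]mul1r.
by apply: (@ler_mvt _ cos) => // y _; exact: cos_max.
Qed.

Lemma ler_1Bcos x : `|cos x - 1| <= x ^+ 2.
Proof.
wlog x0 : x / 0 <= x => [H|].
  have [/H //|/ltW x0] := leP 0 x.
  by rewrite -sqrrN -cosN; apply: H; rewrite oppr_ge0.
rewrite -cos0 expr2; apply: (@ler_mvt _ (fun y => - sin y)) => // y /andP[y0 yx].
by rewrite normrN (le_trans (ler_sin y)) // ger0_norm.
Qed.

Lemma ler_sinB x : `|sin x - x| <= `|x| ^+ 3.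
Proof.
wlog x0 : x / 0 <= x => [H|].
  have [/H //|/ltW x0] := leP 0 x.
  have -> : sin x - x = - (sin (- x) - (- x)) by rewrite sinN; ring.
  by rewrite normrN -(normrN x); apply: H; rewrite oppr_ge0.
have -> : sin x - x = (sin x - x) - (sin 0 - 0) by rewrite sin0 !subr0.
rewrite (ger0_norm x0) exprSr.
apply: (@ler_mvt (fun y => sin y - y) (fun y => cos y - 1)) => // y /andP[y0 yx].
by rewrite (le_trans (ler_1Bcos y)) // lerXn2r.
Qed.

(** The linear part is the displacement (dr, r0 dt), rotated by the angle t0. *)
Lemma polar_expansion r0 t0 r t D : 0 <= D <= 1 -> `|r - r0| <= D -> `|t - t0| <= D ->
  cabs (polar r t - polar r0 t0 -
        polar 1 t0 * ((r - r0) +i* (r0 * (t - t0)))) <= (3 + 2 * `|r0|) * D ^+ 2.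
Proof.
move=> /andP[D0 D1].
have [h ->] : exists h, r = r0 + h by exists (r - r0); rewrite addrC subrK.
have [k ->] : exists k, t = t0 + k by exists (t - t0); rewrite addrC subrK.
rewrite [r0 + h - _]addrC addKr [t0 + k - _]addrC addKr => hD kD.
have E : polar (r0 + h) (t0 + k) - polar r0 t0 - polar 1 t0 * (h +i* (r0 * k)) =
    polar 1 t0 * ((r0 + h)%:C * ((cos k - 1) +i* (sin k - k)) + (0 +i* (h * k))).
  apply/eqP; rewrite eq_complex /= cosD sinD; apply/andP; split; apply/eqP; ring.
rewrite E cabsM cabs_polar1 mul1r.
have ck : cabs ((cos k - 1) +i* (sin k - k)) <= 2 * D ^+ 2.
  apply: le_trans (ler_cabs_ReIm _) _ => /=.
  have k2 : `|k| ^+ 2 <= D ^+ 2 by rewrite lerXn2r // nnegrE.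
  have := ler_1Bcos k; rewrite -real_normK ?num_real //.
  have := ler_sinB k.
  have : `|k| ^+ 3 <= `|k| ^+ 2.
    by rewrite exprS ler_piMl ?exprn_ge0 // (le_trans kD D1).
  lra.
have hk : cabs (0 +i* (h * k)) <= D ^+ 2.
  apply: le_trans (ler_cabs_ReIm _) _ => /=.
  by rewrite normr0 add0r normrM expr2 ler_pM.
apply: le_trans (ler_cabsD _ _) _; rewrite cabsM cabs_real.
have rh : `|r0 + h| <= `|r0| + 1.
  by rewrite (le_trans (ler_normD _ _)) // lerD2l (le_trans hD D1).
have : `|r0 + h| * cabs ((cos k - 1) +i* (sin k - k)) <= (`|r0| + 1) * (2 * D ^+ 2).
  by rewrite ler_pM // cabs_ge0.
move=> H1; apply: le_trans (lerD H1 hk) _.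
by rewrite le_eqVlt; apply/orP; left; apply/eqP; ring.
Qed.

Lemma polar_lipschitz r0 t0 r t D : 0 <= D <= 1 -> `|r - r0| <= D -> `|t - t0| <= D ->
  cabs (polar r t - polar r0 t0) <= (4 + 3 * `|r0|) * D.
Proof.
move=> /andP[D0 D1] rD tD.
have DD : 0 <= D <= 1 by rewrite D0 D1.
have := polar_expansion DD rD tD.
set A := polar r t - _; set B := polar 1 t0 * _ => AB.
have HB : cabs B <= (1 + `|r0|) * D.
  rewrite /B cabsM cabs_polar1 mul1r (le_trans (ler_cabs_ReIm _)) //=.
  by rewrite normrM mulrDl mul1r lerD // ler_wpM2l.
have HD : D ^+ 2 <= D by rewrite expr2 ler_piMl.
have : (3 + 2 * `|r0|) * D ^+ 2 <= (3 + 2 * `|r0|) * D.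
  by rewrite ler_wpM2l // addr_ge0 // mulr_ge0.
have := ler_cabsD (A - B) B; rewrite subrK.
lra.
Qed.

End trigonometric_bounds.

Section complex_continuity.
Variable R : realType.
Implicit Types (u : R[i] -> R) (z : R[i]).

(** Positive elements of R[i] are real, so that balls of R[i] are balls for the real
    modulus. *)
Lemma gt0_complexP (e : R[i]) : 0 < e -> exists2 d : R, 0 < d & e = d%:C.
Proof.
by case: e => d d'; rewrite ltcE /= => /andP[/eqP -> d0]; exists d.
Qed.

Lemma ccontinuousP u z : {for z, continuous u} <->
  (forall e, 0 < e -> exists2 d, 0 < d & forall w, cabs (w - z) < d -> `|u w - u z| < e).
Proof.
split=> [/cvgrPdist_lt H e e0|H].
  have := H e e0; rewrite nearE => /nbhs_ballP[d' /= /gt0_complexP[d d0 ->] B].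
  exists d => // w wd; rewrite distrC; apply: B.
  by rewrite /ball /= -normrN opprB normc_cabs ltcR.
apply/(@cvgrPdist_lt _ _ _ (nbhs z)) => e e0; have [d d0 Hd] := H e e0.
rewrite nearE; apply/nbhs_ballP; exists d%:C => /=; first by rewrite ltcR.
move=> w; rewrite /ball /= -normrN opprB normc_cabs ltcR => wd.
by rewrite /= distrC; exact: Hd.
Qed.

Lemma open_cball z d : open [set w | cabs (w - z) < d].
Proof.
rewrite openE => w /= wz; apply/nbhs_ballP; exists (d - cabs (w - z))%:C => /=.
  by rewrite ltcR subr_gt0.
move=> v; rewrite /ball /= -normrN opprB normc_cabs ltcR => vw.
by have := ler_cabs_triangle w v z; rewrite /=; lra.
Qed.

Lemma polar_continuous r : continuous (polar r : R -> R[i]).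
Proof.
move=> t; apply/(@cvgrPdist_lt _ _ _ (nbhs t)) => _ /gt0_complexP[e egt ->].
have K0 : 0 < 4 + 3 * `|r| by rewrite ltr_pwDl // mulr_ge0.
near=> s; rewrite normc_cabs ltcR cabs_distrC.
have st : `|s - t| <= Num.min 1 (e / (2 * (4 + 3 * `|r|))).
  near: s; under eq_near do rewrite distrC.
  apply: (@cvgr_dist_le _ _ _ (nbhs t) _ id t); first exact: cvg_id.
  by rewrite lt_min ltr01 /= divr_gt0 // mulr_gt0.
have m0 : 0 <= Num.min 1 (e / (2 * (4 + 3 * `|r|))) <= 1.
  by rewrite ge_min lexx /= andbT (le_trans _ st).
have rr : `|r - r| <= Num.min 1 (e / (2 * (4 + 3 * `|r|))).
  by rewrite subrr normr0; case/andP: m0.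
apply: le_lt_trans (polar_lipschitz m0 rr st) _.
have h : Num.min 1 (e / (2 * (4 + 3 * `|r|))) <= e / (2 * (4 + 3 * `|r|)).
  by rewrite ge_min lexx orbT.
have : (4 + 3 * `|r|) * Num.min 1 (e / (2 * (4 + 3 * `|r|))) <= e / 2.
  apply: le_trans (ler_wpM2l (ltW K0) h) _.
  by rewrite le_eqVlt; apply/orP; left; apply/eqP; field; rewrite gt_eqF.
by move=> /le_lt_trans; apply; rewrite ltr_pdivrMr // mulr_natr mulr2n ltrDl.
Unshelve. all: by end_near. Qed.

Lemma continuous_on_circle u z0 r : (forall t, {for z0 + polar r t, continuous u}) ->
  continuous (fun t => u (z0 + polar r t)).
Proof.
move=> cu t; apply: (@continuous_comp _ _ _ (fun t => z0 + polar r t) u).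
  apply: (@cvgD _ R[i]); [exact: cvg_cst|exact: polar_continuous].
exact: cu.
Qed.

End complex_continuity.

(** * The mean value property of holomorphic functions *)

Section mean_value.
Variable R : realType.
Implicit Types (F : R[i] -> R[i]) (z : R[i]).

Lemma cdiff_cst c z : cdiff (fun=> c : R[i]) z.
Proof. by apply: derivable_cdiff; exact: derivable_cst. Qed.

Lemma cdiff_id z : cdiff id z.
Proof. by apply: derivable_cdiff; exact: derivable_id. Qed.

Lemma cdiffD F G z : cdiff F z -> cdiff G z -> cdiff (fun x => F x + G x) z.
Proof.
move=> /cdiff_derivable f /cdiff_derivable g; apply: derivable_cdiff.
exact: (derivableD f g).
Qed.

Lemma cdiffB F G z : cdiff F z -> cdiff G z -> cdiff (fun x => F x - G x) z.
Proof.
move=> /cdiff_derivable f /cdiff_derivable g; apply: derivable_cdiff.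
exact: (derivableB f g).
Qed.

Lemma cdiffM F G z : cdiff F z -> cdiff G z -> cdiff (fun x => F x * G x) z.
Proof.
move=> /cdiff_derivable f /cdiff_derivable g; apply: derivable_cdiff.
exact: (derivableM f g).
Qed.

Lemma cdiffV F z : F z != 0 -> cdiff F z -> cdiff (fun x => (F x)^-1) z.
Proof.
move=> F0 /cdiff_derivable f; apply: derivable_cdiff.
exact: (derivableV F0 f).
Qed.

Lemma cdiff_comp F G z : cdiff G z -> cdiff F (G z) -> cdiff (F \o G) z.
Proof.
move=> [M HM] [L HL]; exists (L * M) => e e0.
have K0 : 0 < cabs M + 1 by rewrite ltr_wpDl // cabs_ge0.
have e1 : 0 < e / (2 * (cabs M + 1)) by rewrite divr_gt0 // mulr_gt0.
have [d d0 Hd] := HL _ e1.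
have L0 : 0 < cabs L + 1 by rewrite ltr_wpDl // cabs_ge0.
have e2 : 0 < Num.min 1 (e / (2 * (cabs L + 1))).
  by rewrite lt_min ltr01 divr_gt0 // mulr_gt0.
have [d' d'0 Hd'] := HM _ e2.
exists (Num.min d' (d / (cabs M + 1))).
  by rewrite lt_min d'0 divr_gt0.
move=> h; rewrite lt_min => /andP[hd' hd] /=.
have H1 := Hd' h hd'.
have h0 := cabs_ge0 h.
have Gh : cabs (G (z + h) - G z) <= (cabs M + 1) * cabs h.
  rewrite -[X in cabs X](subrK (M * h)) (le_trans (ler_cabsD _ _)) //.
  rewrite cabsM mulrDl mul1r addrC lerD2l (le_trans H1) // ler_piMl //.
  by rewrite ge_min lexx.
have Gd : cabs (G (z + h) - G z) < d.
  by rewrite (le_lt_trans Gh) // mulrC -ltr_pdivlMr.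
have := Hd _ Gd; rewrite [G z + _]addrC subrK => H2.
have -> : F (G (z + h)) - F (G z) - L * M * h =
  (F (G (z + h)) - F (G z) - L * (G (z + h) - G z)) + L * (G (z + h) - G z - M * h).
  by ring.
apply: le_trans (ler_cabsD _ _) _; rewrite cabsM.
have H3 : e / (2 * (cabs M + 1)) * cabs (G (z + h) - G z) <= e / 2 * cabs h.
  apply: le_trans (ler_wpM2l (ltW e1) Gh) _.
  by rewrite le_eqVlt; apply/orP; left; apply/eqP; field; rewrite gt_eqF.
have H4 : cabs L * cabs (G (z + h) - G z - M * h) <= e / 2 * cabs h.
  apply: (@le_trans _ _ ((cabs L + 1) * (e / (2 * (cabs L + 1)) * cabs h))).
    apply: ler_pM; rewrite ?cabs_ge0 ?lerDl // (le_trans H1) //.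
    by rewrite ler_wpM2r // ge_min lexx orbT.
  by rewrite le_eqVlt; apply/orP; left; apply/eqP; field; rewrite gt_eqF.
lra.
Qed.

Lemma cdiff_lipschitz F z : cdiff F z -> exists2 K, 0 < K & exists2 d, 0 < d &
  forall w, cabs (w - z) < d -> cabs (F w - F z) <= K * cabs (w - z).
Proof.
move=> [L HL]; have [d d0 Hd] := HL 1 ltr01.
exists (1 + cabs L); first by rewrite ltr_pwDl // cabs_ge0.
exists d => // w wd; have := Hd _ wd; rewrite [z + _]addrC subrK mul1r => H.
rewrite -[X in cabs X](subrK (L * (w - z))) (le_trans (ler_cabsD _ _)) //.
by rewrite mulrDl mul1r cabsM lerD2r.
Qed.

Lemma cdiff_ccontinuous F z (u : R[i] -> R) : cdiff F z ->
  (forall v w, `|u v - u w| <= cabs (v - w)) -> {for z, continuous (u \o F)}.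
Proof.
move=> /cdiff_lipschitz[K K0 [d d0 Hd]] Lu; apply/ccontinuousP => e e0.
exists (Num.min d (e / K)); first by rewrite lt_min d0 divr_gt0.
move=> w; rewrite lt_min => /andP[wd we] /=.
apply: le_lt_trans (Lu _ _) _; apply: le_lt_trans (Hd _ wd) _.
by rewrite mulrC -ltr_pdivlMr.
Qed.

Lemma cdiff_continuous_Re F z : cdiff F z -> {for z, continuous (fun w => complex.Re (F w))}.
Proof.
move=> dF; apply: (cdiff_ccontinuous dF) => v w; rewrite -ReB; exact: ler_Re_cabs.
Qed.

Lemma cdiff_continuous_Im F z : cdiff F z -> {for z, continuous (fun w => complex.Im (F w))}.
Proof.
move=> dF; apply: (cdiff_ccontinuous dF) => v w; rewrite -ImB; exact: ler_Im_cabs.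
Qed.

Lemma cdiff_continuous_cabs F z : cdiff F z -> {for z, continuous (fun w => cabs (F w))}.
Proof. by move=> dF; apply: (cdiff_ccontinuous dF) => v w; exact: ler_cabs_dist. Qed.

Lemma cdiff_polar F z0 (r0 t0 : R) L e :
  has_cderiv F (z0 + polar r0 t0) L -> 0 < e ->
  exists2 del, 0 < del & forall D r t : R, D < del -> `|r - r0| <= D -> `|t - t0| <= D ->
    cabs (F (z0 + polar r t) - F (z0 + polar r0 t0) -
      (L * polar 1 t0) * ((r - r0) +i* (r0 * (t - t0)))) <= e * D.
Proof.
move=> HL e0.
have [K KE] : exists K, K = 4 + 3 * `|r0| by exists (4 + 3 * `|r0|).
have K0 : 0 < K by rewrite KE ltr_pwDl // mulr_ge0.
have e1 : 0 < e / (2 * K) by rewrite divr_gt0 // mulr_gt0.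
have [d d0 Hd] := HL _ e1.
have [M ME] : exists M, M = (cabs L + 1) * K by exists ((cabs L + 1) * K).
have M0 : 0 < M by rewrite ME mulr_gt0 // ltr_wpDl // cabs_ge0.
exists (Num.min (Num.min 1 (d / K)) (e / (2 * M))).
  by rewrite !lt_min ltr01 !divr_gt0 // mulr_gt0.
move=> D r t; rewrite !lt_min => /andP[/andP[D1 Dd] De] rD tD.
have D0 : 0 <= D by apply: le_trans rD.
have DD : 0 <= D <= 1 by rewrite D0 ltW.
have h1 := polar_lipschitz DD rD tD; have h2 := polar_expansion DD rD tD.
move: h1 h2; rewrite -KE; set h := polar r t - _ => h1 h2.
have hd : cabs h < d by rewrite (le_lt_trans h1) // mulrC -ltr_pdivlMr.
have := Hd _ hd; have -> : z0 + polar r0 t0 + h = z0 + polar r t by rewrite /h; ring.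
move=> H1.
set q := (r - r0) +i* _.
have -> : F (z0 + polar r t) - F (z0 + polar r0 t0) - L * polar 1 t0 * q =
  (F (z0 + polar r t) - F (z0 + polar r0 t0) - L * h) + L * (h - polar 1 t0 * q) by ring.
apply: le_trans (ler_cabsD _ _) _; rewrite cabsM.
have H3 : e / (2 * K) * cabs h <= e / 2 * D.
  apply: le_trans (ler_wpM2l (ltW e1) h1) _.
  by rewrite le_eqVlt; apply/orP; left; apply/eqP; field; rewrite gt_eqF.
have H4 : cabs L * cabs (h - polar 1 t0 * q) <= e / 2 * D.
  apply: (@le_trans _ _ (M * D * D)).
    rewrite ME -2!mulrA -expr2; apply: ler_pM; rewrite ?cabs_ge0 ?lerDl //.
    apply: le_trans h2 _; rewrite ler_wpM2r ?exprn_ge0 // KE lerD // ?ler_nat //.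
    by rewrite ler_wpM2r // ler_nat.
  rewrite ler_wpM2r //; move: De; rewrite ltr_pdivlMr ?mulr_gt0 // => De; clear - De; lra.
lra.
Qed.

Lemma ler_Re_of_cabs z a e : cabs (z - a) <= e -> `|complex.Re z - complex.Re a| <= e.
Proof. by move=> h; rewrite -ReB (le_trans (ler_Re_cabs _)). Qed.

Lemma ler_Im_of_cabs z a e : cabs (z - a) <= e -> `|complex.Im z - complex.Im a| <= e.
Proof. by move=> h; rewrite -ImB (le_trans (ler_Im_cabs _)). Qed.

(** The Cauchy-Riemann equations in polar coordinates say that the form (Im F / r) dr + (Re
    F) dt is closed: both mixed derivatives equal the radial derivative of Re F, which is k. *)
Lemma cdiff_closed_form F z0 (r0 t0 : R) : cdiff F (z0 + polar r0 t0) -> 0 < r0 ->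
  exists k, forall e, 0 < e ->
     exists2 del, 0 < del & forall D x1 x2 t1 t2 : R, D < del ->
       `|x1 - r0| <= D -> `|x2 - r0| <= D -> `|t1 - t0| <= D -> `|t2 - t0| <= D ->
       `|complex.Im (F (z0 + polar x1 t1)) / x1 - complex.Im (F (z0 + polar x1 t2)) / x1
         - k * (t1 - t2)| <= e * D /\
       `|complex.Re (F (z0 + polar x2 t1)) - complex.Re (F (z0 + polar x1 t1))
         - k * (x2 - x1)| <= e * D.
Proof.
move=> [L HL] r00.
have [a [b LE]] : exists a b, L * polar 1 t0 = a +i* b.
  by exists (complex.Re (L * polar 1 t0)), (complex.Im (L * polar 1 t0)); case: (L * _).
exists a => e e0.
have m0 : 0 < Num.min 1 r0 by rewrite lt_min ltr01.
have e1 : 0 < e * Num.min 1 r0 / 8 by rewrite divr_gt0 // mulr_gt0.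
have [d d0 Hd] := cdiff_polar HL e1.
have a0 : 0 < `|a| + 1 by rewrite ltr_wpDl.
exists (Num.min d (Num.min (r0 / 2) (e * r0 / (8 * (`|a| + 1))))).
  by rewrite !lt_min d0 !divr_gt0 // mulr_gt0.
move=> D x1 x2 t1 t2; rewrite !lt_min => /andP[Dd /andP[Dr De]] hx1 hx2 ht1 ht2.
have D0 : 0 <= D by apply: le_trans hx1.
have x1r : r0 / 2 <= x1 by move: hx1; rewrite ler_norml => /andP[]; clear - Dr; lra.
have x10 : 0 < x1 by clear - x1r r00; lra.
have H11 := Hd D x1 t1 Dd hx1 ht1.
have H12 := Hd D x1 t2 Dd hx1 ht2.
have H21 := Hd D x2 t1 Dd hx2 ht1.
rewrite LE in H11 H12 H21.
have m1 : Num.min 1 r0 <= 1 by rewrite ge_min lexx.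
have mr : Num.min 1 r0 <= r0 by rewrite ge_min lexx orbT.
have e1e : e * Num.min 1 r0 / 8 * D <= e * D / 8.
  by rewrite [leRHS]mulrAC ler_wpM2r // ler_pM2r // ler_piMr // ltW.
have e1r : e * Num.min 1 r0 / 8 * D <= e * r0 / 8 * D.
  by rewrite ler_wpM2r // ler_pM2r // ler_pM2l.
split; last first.
  have /= := ler_Re_of_cabs H11; have /= := ler_Re_of_cabs H21.
  rewrite !ReB; move: H11 H12 H21 => _ _ _.
  set u1 := complex.Re (F (z0 + polar x2 t1)); set u2 := complex.Re (F (z0 + polar x1 t1)).
  set u0 := complex.Re _.
  clear - e1e; rewrite !ler_norml => /andP[? ?] /andP[? ?]; apply/andP; split; lra.
have /= := ler_Im_of_cabs H11; have /= := ler_Im_of_cabs H12.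
rewrite !ImB; move: H11 H12 H21 => _ _ _.
set v1 := complex.Im (F (z0 + polar x1 t1)); set v2 := complex.Im (F (z0 + polar x1 t2)).
set v0 := complex.Im _ => A1 A2.
have -> : v1 / x1 - v2 / x1 - a * (t1 - t2) =
  (v1 - v2 - a * (t1 - t2) * r0) / x1 + a * (t1 - t2) * (r0 - x1) / x1.
  by field; rewrite gt_eqF.
rewrite -mulrDl normrM normfV (gtr0_norm x10) ler_pdivrMr //.
have B1 : `|v1 - v2 - a * (t1 - t2) * r0| <= 2 * (e * r0 / 8 * D).
  move: A1 A2; clear - e1r; rewrite !ler_norml => /andP[? ?] /andP[? ?]; apply/andP; split; lra.
have B2 : `|a * (t1 - t2) * (r0 - x1)| <= e * r0 / 4 * D.
  rewrite !normrM.
  have tt : `|t1 - t2| <= 2 * D.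
    by move: ht1 ht2; clear; rewrite !ler_norml => /andP[? ?] /andP[? ?]; apply/andP; split; lra.
  have xx : `|r0 - x1| <= D by rewrite distrC.
  have : `|a| * `|t1 - t2| * `|r0 - x1| <= (`|a| + 1) * (2 * D) * D.
    by apply: ler_pM => //; rewrite ?mulr_ge0 //; apply: ler_pM => //; rewrite lerDl.
  move=> /le_trans; apply.
  have -> : e * r0 / 4 * D = (`|a| + 1) * (2 * (e * r0 / (8 * (`|a| + 1)))) * D.
    by field; rewrite gt_eqF.
  by rewrite ler_wpM2r // ler_pM2l // ler_pM2l // ltW.
apply: le_trans (ler_normD _ _) _; apply: le_trans (lerD B1 B2) _.
have : e * r0 * D <= 2 * (e * x1 * D).
  by rewrite mulrA ler_wpM2r // mulrCA ler_pM2l //; clear - x1r; lra.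
clear; lra.
Qed.

Definition cmean (f : R -> R) := (2 * pi)^-1 * seg_integral 0 (2 * pi) f.

Lemma twopi_gt0 : 0 < 2 * pi :> R.
Proof. by rewrite mulr_gt0 // pi_gt0. Qed.

(** The circulation of (Im F / r) dr + (Re F) dt around [r1, r2] * [0, 2 pi] vanishes, and
    the two radial sides cancel by periodicity. *)
Lemma circle_mean_constant F z0 (R0 r1 r2 : R) :
  (forall z, cabs (z - z0) < R0 -> cdiff F z) -> 0 < r1 < r2 -> r2 < R0 ->
  seg_integral 0 (2 * pi) (fun t => complex.Re (F (z0 + polar r1 t))) =
  seg_integral 0 (2 * pi) (fun t => complex.Re (F (z0 + polar r2 t))).
Proof.
move=> dF /andP[r10 r12] r2R.
have dd r t : 0 <= r <= r2 -> cdiff F (z0 + polar r t).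
  move=> /andP[r0 rr2]; apply: dF.
  by rewrite [z0 + _]addrC addrK cabs_polar ger0_norm // (le_lt_trans rr2).
have cR r : 0 <= r <= r2 -> continuous (fun t => complex.Re (F (z0 + polar r t))).
  move=> rr; apply: (@continuous_on_circle R (fun w => complex.Re (F w)) z0 r) => t.
  exact: (@cdiff_continuous_Re F _ (dd r t rr)).
have G := @goursat_rectangle R (fun r t => complex.Im (F (z0 + polar r t)) / r)
  (fun r t => complex.Re (F (z0 + polar r t))) r1 r2 0 (2 * pi) r12 twopi_gt0.
have : circulation (fun r t => complex.Im (F (z0 + polar r t)) / r)
  (fun r t => complex.Re (F (z0 + polar r t))) r1 r2 0 (2 * pi) = 0.
  apply: G.
  - move=> t _ r; rewrite in_itv /= => /andP[ra rb].
    have r0 : 0 < r by apply: lt_le_trans ra.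
    apply: cvgM; last by apply: cvgV; [rewrite gt_eqF|exact: cvg_id].
    apply: (@continuous_comp _ _ _ (fun r => z0 + polar r t) (fun w => complex.Im (F w))).
      apply: (@cvgD _ R[i]); [exact: cvg_cst|].
      apply/(@cvgrPdist_lt _ _ _ (nbhs r)) => _ /gt0_complexP[e e0 ->].
      near=> s; rewrite normc_cabs ltcR polarE (polarE s) -mulrBl -rmorphB /= cabsM.
      rewrite cabs_polar1 mulr1 cabs_real.
      near: s; apply: (@cvgr_dist_lt _ _ _ (nbhs r) _ id r); [exact: cvg_id|by []].
    by apply: cdiff_continuous_Im; apply: dd; rewrite ltW.
  - move=> r /andP[ra rb] t _; apply: cR; rewrite rb (le_trans _ ra) //.
    exact: ltW.
  - move=> r t /andP[ra rb] _.
    have r0 : 0 < r by apply: lt_le_trans ra.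
    have [|k Hk] := @cdiff_closed_form F z0 r t _ r0.
      by apply: dd; rewrite ltW.
    exists k => e e0; have [d d0 Hd] := Hk e e0.
    by exists d => // D x1 x2 t1 t2 Dd _ _ _ _; exact: Hd.
have -> : forall A B, circulation A B r1 r2 0 (2 * pi) =
  seg_integral r1 r2 (fun u => A u 0 - A u (2 * pi)) +
  seg_integral 0 (2 * pi) (fun v => B r2 v - B r1 v) by [].
under [X in X + _]seg_integral_eq => r _ do rewrite polar_2pi subrr.
rewrite seg_integral_cst ?ltW // mul0r add0r seg_integral_B.
- by move/eqP; rewrite subr_eq0 => /eqP.
- by apply: seg_integrable_continuous => t _; apply: cR; rewrite lexx ltW // (lt_trans r10).
- by apply: seg_integrable_continuous => t _; apply: cR; rewrite !ltW.
Unshelve. all: by end_near. Qed.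

(** The mean does not depend on the radius and tends to the value at the centre for small
    radii. *)
Theorem mean_value F z0 (R0 r : R) :
  (forall z, cabs (z - z0) < R0 -> cdiff F z) -> 0 < r < R0 ->
  cmean (fun t => complex.Re (F (z0 + polar r t))) = complex.Re (F z0).
Proof.
move=> dF /andP[r0 rR].
set I := seg_integral 0 (2 * pi) (fun t => complex.Re (F (z0 + polar r t))).
have tp := twopi_gt0.
suff IE : I = complex.Re (F z0) * (2 * pi).
  rewrite /cmean -/I IE; by rewrite mulrCA mulVf ?mulr1 // gt_eqF.
apply/eqP; rewrite -subr_eq0 -normr_eq0 eq_le normr_ge0 andbT.
apply/ler_addgt0Pl => e e0; rewrite addr0.
have dz : cdiff F z0 by apply: dF; rewrite subrr cabs0 (lt_trans r0).
have /ccontinuousP := cdiff_continuous_Re dz.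
move=> /(_ (e / (2 * pi))); rewrite divr_gt0 // => /(_ isT)[d d0 Hd].
pose s := Num.min (r / 2) (d / 2).
have s0 : 0 < s by rewrite lt_min !divr_gt0.
have sr : s < r.
  by rewrite gt_min; apply/orP; left; rewrite ltr_pdivrMr // ltr_pMr // ltr1n.
have sd : s < d.
  by rewrite gt_min; apply/orP; right; rewrite ltr_pdivrMr // ltr_pMr // ltr1n.
rewrite /I -(@circle_mean_constant F z0 R0 s r) ?s0 //.
have := @seg_integral_near_cst R 0 (2 * pi) (fun t => complex.Re (F (z0 + polar s t)))
  (complex.Re (F z0)) (e / (2 * pi)) (ltW tp).
rewrite !subr0 divfK ?gt_eqF //; apply.
  apply: seg_integrable_continuous => t _.
  apply: (@continuous_on_circle R (fun w => complex.Re (F w)) z0 s) => {}t.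
  apply: cdiff_continuous_Re; apply: dF.
  by rewrite [z0 + _]addrC addrK cabs_polar gtr0_norm // (lt_trans sr).
move=> t _; apply: ltW; apply: Hd.
by rewrite [z0 + _]addrC addrK cabs_polar gtr0_norm.
Qed.

End mean_value.

(** * Means of bounded measurable functions on the circle *)

Section bounded_measurable.
Variable R : realType.
Implicit Types (f g w : R -> R) (t : R).
Local Notation I := `[0, (2 * pi)%R]%classic.

(** Bounded measurable functions on [0, 2 pi]: a class closed under all operations used on
    means, on which every mean is a genuine integral. *)
Definition bm f := measurable_fun (I : set (measurableTypeR R)) f /\
  exists M : R, forall t, 0 <= t <= 2 * pi -> `|f t| <= M.

Lemma circle_measure_lty : (@lebesgue_measure R I < +oo)%E.
Proof. by rewrite lebesgue_measure_itv /=; case: ifP => _; rewrite -?EFinB ltry. Qed.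

Lemma bm_integrable f : bm f -> seg_integrable 0 (2 * pi) f.
Proof.
move=> [mf [M HM]]; apply: measurable_bounded_integrable => //.
  exact: circle_measure_lty.
exists M; split; first exact: num_real.
move=> x Mx y; rewrite /= in_itv /= => hy.
by rewrite (le_trans (HM y hy)) // ltW.
Qed.

Lemma bm_cst c : bm (fun=> c).
Proof. by split; [exact: measurable_cst|exists `|c|]. Qed.

Lemma bmD f g : bm f -> bm g -> bm (fun t => f t + g t).
Proof.
move=> [mf [M HM]] [mg [N HN]]; split; first exact: measurable_funD.
exists (M + N) => t ht; apply: le_trans (ler_normD _ _) _.
by rewrite lerD ?HM ?HN.
Qed.

Lemma bmM f g : bm f -> bm g -> bm (fun t => f t * g t).
Proof.
move=> [mf [M HM]] [mg [N HN]]; split; first exact: measurable_funM.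
by exists (M * N) => t ht; rewrite normrM ler_pM ?HM ?HN.
Qed.

Lemma bmZ c f : bm f -> bm (fun t => c * f t).
Proof. by apply: bmM; exact: bm_cst. Qed.

Lemma bmN f : bm f -> bm (fun t => - f t).
Proof. by move=> bf; under eq_fun do rewrite -mulN1r; exact: bmZ. Qed.

Lemma bmB f g : bm f -> bm g -> bm (fun t => f t - g t).
Proof. by move=> bf bg; apply: bmD => //; exact: bmN. Qed.

Lemma bmX f n : bm f -> bm (fun t => f t ^+ n).
Proof.
move=> bf; elim: n => [|n IH]; first by under eq_fun do rewrite expr0; exact: bm_cst.
by under eq_fun do rewrite exprS; exact: bmM.
Qed.

Lemma bm_norm f : bm f -> bm (fun t => `|f t|).
Proof.
move=> [mf [M HM]]; split; first exact: measurableT_comp.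
by exists M => t /HM; rewrite normr_id.
Qed.

Lemma bm_continuous f : continuous f -> bm f.
Proof.
move=> cf; split.
  by apply: measurable_funS (continuous_measurable_fun cf) => //; exact: measurableT.
have [M [_ HM]] : bounded_set (f @` (I : set R)).
  apply: compact_bounded; apply: continuous_compact; last exact: segment_compact.
  exact: continuous_subspaceT.
exists (M + 1) => t ht; apply: (HM (M + 1)); first by rewrite ltrDl.
by exists t => //=; rewrite in_itv.
Qed.

Lemma bm_indic (A : set (measurableTypeR R)) : measurable A -> bm (\1_A).
Proof.
move=> mA; split; first exact: measurable_indic.
by exists 1 => t _; rewrite indicE ger0_norm //; case: (_ \in _).
Qed.

Lemma bm_powR f g : (forall t, 0 <= t <= 2 * pi -> 0 <= f t) ->
  measurable_fun (I : set (measurableTypeR R)) (fun t => f t `^ g t) ->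
  bm f -> (exists M : R, forall t, 0 <= t <= 2 * pi -> 0 <= g t <= M) ->
  bm (fun t => f t `^ g t).
Proof.
move=> f0 mf [_ [N HN]] [M HM]; split => //.
exists ((1 + N) `^ M) => t ht; rewrite ger0_norm ?powR_ge0 //.
have fN : f t <= N by rewrite (le_trans (ler_norm _)) // HN.
have N0 : 0 <= N by rewrite (le_trans (f0 _ ht)).
have /andP[g0 gM] := HM t ht.
apply: (@le_trans _ _ ((1 + N) `^ g t)).
  by apply: ge0_ler_powR; rewrite ?nnegrE ?addr_ge0 ?f0 // (le_trans fN) // lerDr.
by apply: ler_powR; rewrite // lerDl.
Qed.

Lemma pi20 : 0 <= 2 * pi :> R.
Proof. exact: ltW (twopi_gt0 R). Qed.

Lemma cmeanD f g : bm f -> bm g -> cmean (fun t => f t + g t) = cmean f + cmean g.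
Proof. by move=> bf bg; rewrite /cmean (seg_integral_D (bm_integrable bf) (bm_integrable bg)) mulrDr. Qed.

Lemma cmeanB f g : bm f -> bm g -> cmean (fun t => f t - g t) = cmean f - cmean g.
Proof. by move=> bf bg; rewrite /cmean (seg_integral_B (bm_integrable bf) (bm_integrable bg)) mulrBr. Qed.

Lemma cmeanZ c f : bm f -> cmean (fun t => c * f t) = c * cmean f.
Proof. by move=> bf; rewrite /cmean (seg_integral_Z _ (bm_integrable bf)) mulrCA. Qed.

Lemma cmean_cst c : cmean (fun=> c) = c :> R.
Proof.
rewrite /cmean seg_integral_cst ?pi20 // subr0 mulrCA mulVf ?mulr1 //.
by rewrite gt_eqF // twopi_gt0.
Qed.

Lemma le_cmean f g : bm f -> bm g -> (forall t, 0 <= t <= 2 * pi -> f t <= g t) ->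
  cmean f <= cmean g.
Proof.
move=> bf bg fg; rewrite /cmean ler_pM2l ?invr_gt0 ?twopi_gt0 //.
by apply: seg_integral_le => //; exact: bm_integrable.
Qed.

Lemma cmean_ge0 f : (forall t, 0 <= t <= 2 * pi -> 0 <= f t) -> 0 <= cmean f.
Proof.
by move=> f0; rewrite /cmean mulr_ge0 ?invr_ge0 ?pi20 //; exact: seg_integral_ge0.
Qed.

Lemma eq_cmean f g : (forall t, 0 <= t <= 2 * pi -> f t = g t) -> cmean f = cmean g.
Proof. by move=> fg; rewrite /cmean (seg_integral_eq fg). Qed.

Lemma ler_norm_cmean f : bm f -> `|cmean f| <= cmean (fun t => `|f t|).
Proof.
move=> bf; rewrite ler_norml -mulN1r -cmeanZ; last exact: bm_norm.
have bn := bm_norm bf.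
apply/andP; split; apply: le_cmean => //; last by move=> t _; exact: ler_norm.
  exact: bmZ.
by move=> t _; rewrite mulN1r lerNl -normrN ler_norm.
Qed.

(** Jensen's inequality for the square, from the variance being nonnegative *)
Lemma sqr_cmean_le w f : bm w -> bm f -> (forall t, 0 <= t <= 2 * pi -> 0 <= w t) ->
  cmean w = 1 -> cmean (fun t => w t * f t) ^+ 2 <= cmean (fun t => w t * f t ^+ 2).
Proof.
move=> bw bf w0 w1; set c := cmean (fun t => w t * f t).
have bwf := bmM bw bf; have bwf2 := bmM bw (bmX 2 bf).
have : 0 <= cmean (fun t => w t * f t ^+ 2 - (2 * c) * (w t * f t) + c ^+ 2 * w t).
  apply: cmean_ge0 => t ht.
  have -> : w t * f t ^+ 2 - 2 * c * (w t * f t) + c ^+ 2 * w t =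
    w t * (f t - c) ^+ 2 by ring.
  by rewrite mulr_ge0 ?sqr_ge0 ?w0.
rewrite cmeanD; [|exact/bmB/bmZ|exact: bmZ].
rewrite cmeanB; [|by []|exact: bmZ].
rewrite !cmeanZ // w1 -/c; lra.
Qed.

(** Everything is cut off outside [0, 2 pi], so that the theorem of Tonelli on the plane
    applies to the nonnegative product. *)
Lemma cmean_Tonelli (K : R -> R -> R) f :
  measurable_fun setT (fun x : measurableTypeR R * measurableTypeR R => K x.1 x.2) ->
  (forall s t, 0 <= K s t) ->
  (exists M, forall s t, 0 <= s <= 2 * pi -> 0 <= t <= 2 * pi -> K s t <= M) ->
  bm f -> (forall t, 0 <= t <= 2 * pi -> 0 <= f t) ->
  bm (fun s => cmean (fun t => K s t * f t)) /\
  cmean (fun s => cmean (fun t => K s t * f t)) =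
  cmean (fun t => cmean (K ^~ t) * f t).
Proof.
move=> mK K0 [M HM] bf f0.
have mK1 s : measurable_fun setT (K s : measurableTypeR R -> R).
  exact: (measurableT_comp mK (pair1_measurable s)).
have mK2 t : measurable_fun setT (K ^~ t : measurableTypeR R -> R).
  exact: (measurableT_comp mK (pair2_measurable t)).
have bK1 s : 0 <= s <= 2 * pi -> bm (K s).
  move=> hs; split; first by apply: measurable_funS (mK1 s) => //; exact: measurableT.
  by exists M => t ht; rewrite ger0_norm // HM.
have bK2 t : 0 <= t <= 2 * pi -> bm (K ^~ t).
  move=> ht; split; first by apply: measurable_funS (mK2 t) => //; exact: measurableT.
  by exists M => s hs; rewrite ger0_norm // HM.
have [N HN] := bf.2.
have mfI : measurable_fun setT (f \_ I : measurableTypeR R -> R).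
  by have /(measurable_restrictT _ (measurable_itv _)) := bf.1.
pose F (x : measurableTypeR R * measurableTypeR R) :=
  (K x.1 x.2 * (f \_ I) x.2 * (\1_I : measurableTypeR R -> R) x.1)%:E.
have mF : measurable_fun setT F.
  apply/measurable_EFinP; apply: measurable_funM.
    apply: measurable_funM => //.
    exact: (measurableT_comp mfI measurable_snd).
  by apply: (measurableT_comp _ measurable_fst); exact: measurable_indic.
have fI0 t : 0 <= (f \_ I) t.
  by rewrite patchE; case: ifPn => //; rewrite inE /= in_itv /=; exact: f0.
have F0 x : (0 <= F x)%E by rewrite lee_fin !mulr_ge0.
have RIE g : seg_integrable 0 (2 * pi) g -> (seg_integral 0 (2 * pi) g)%:E =
    (\int[@lebesgue_measure R]_(x in I) (g x)%:E)%E.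
  move=> ig_g; rewrite /seg_integral /Rintegral fineK //.
  exact: (integrable_fin_num _ ig_g).
have E1 s : (\int[@lebesgue_measure R]_t F (s, t))%E =
    ((fun s => seg_integral 0 (2 * pi) (fun t => K s t * f t)) \_ I s)%:E.
  rewrite patchE /F /=; case: ifPn => sI.
    rewrite RIE; last by apply: bm_integrable; apply: bmM => //; apply: bK1; move: sI; rewrite inE /= in_itv.
    rewrite [RHS]integral_mkcond; apply: eq_integral => t _.
    by rewrite indicE sI mulr1 patchE /= patchE; case: ifP => //; rewrite mulr0.
  by rewrite integral0_eq // => t _; rewrite indicE (negbTE sI) mulr0.
have E2 t : (\int[@lebesgue_measure R]_s F (s, t))%E =
    ((fun t => seg_integral 0 (2 * pi) (K ^~ t) * f t) \_ I t)%:E.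
  rewrite patchE /F /=; case: ifPn => tI.
    have tI' : 0 <= t <= 2 * pi by move: tI; rewrite inE /= in_itv.
    rewrite [seg_integral _ _ _ * _]mulrC -seg_integral_Z; last by apply: bm_integrable; exact: bK2.
    rewrite RIE; last by apply: bm_integrable; apply: bmZ; exact: bK2.
    rewrite [RHS]integral_mkcond; apply: eq_integral => s _.
    rewrite [(f \_ I) t]patchE tI indicE patchE /=; case: ifP => _; first by rewrite mulr1 mulrC.
    by rewrite mulr0.
  by rewrite integral0_eq // => s _; rewrite patchE (negbTE tI) mulr0 mul0r.
have bI : bm (fun s => seg_integral 0 (2 * pi) (fun t => K s t * f t)).
  split.
    apply: (measurable_restrictT _ _).2 => //.
    apply/measurable_EFinP; rewrite (_ : _ \o _ = fun s => (\int[@lebesgue_measure R]_t F (s, t))%E).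
      exact: (measurable_fun_fubini_tonelli_F F).
    by apply/funext => s; rewrite E1.
  exists (M * N * (2 * pi - 0)) => s hs.
  rewrite ger0_norm; last by apply: seg_integral_ge0 => t ht; rewrite mulr_ge0 // f0.
  rewrite -(seg_integral_cst _ pi20); apply: seg_integral_le; [|exact: seg_integrable_cst|].
    by apply: bm_integrable; apply: bmM => //; exact: bK1.
  move=> t ht; apply: ler_pM => //; [exact: f0|exact: HM|].
  by rewrite (le_trans (ler_norm _)) // HN.
split; first exact: bmZ.
rewrite {1}/cmean (seg_integral_Z _ (bm_integrable bI)) /cmean; congr (_ * _).
under [RHS]seg_integral_eq => t _ do rewrite -mulrA.
have bJ : bm (fun t => seg_integral 0 (2 * pi) (K ^~ t) * f t).
  split.
    apply: (measurable_restrictT _ _).2 => //.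
    apply/measurable_EFinP; rewrite (_ : _ \o _ = fun t => (\int[@lebesgue_measure R]_s F (s, t))%E).
      exact: (measurable_fun_fubini_tonelli_G F).
    by apply/funext => s; rewrite E2.
  exists (M * (2 * pi - 0) * N) => t ht; rewrite normrM ler_pM ?HN //.
  rewrite ger0_norm; last by apply: seg_integral_ge0.
  rewrite -(seg_integral_cst _ pi20); apply: seg_integral_le; [|exact: seg_integrable_cst|].
    by apply: bm_integrable; exact: bK2.
  by move=> s hs; exact: HM.
rewrite (seg_integral_Z _ (bm_integrable bJ)); congr (_ * _).
apply: EFin_inj; rewrite (RIE _ (bm_integrable bI)) (RIE _ (bm_integrable bJ)).
have H := @fubini_tonelli _ _ _ _ R (@lebesgue_measure R) (@lebesgue_measure R) F mF F0.
transitivity (\int[@lebesgue_measure R]_x \int[@lebesgue_measure R]_y F (x, y))%E.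
  rewrite [LHS]integral_mkcond; apply: eq_integral => x _.
  by rewrite E1 !patchE; case: ifP.
rewrite H [RHS]integral_mkcond; apply: eq_integral => x _.
by rewrite E2 !patchE; case: ifP.
Qed.

End bounded_measurable.

(** * Powers of the modulus are subharmonic *)

Section powers.
Variable R : realType.
Implicit Types (x y s q b : R).

(** The tangent at 1 of a concave power. *)
Lemma powR_bernoulli y s : 0 < y -> 0 <= s <= 1 -> y `^ s <= 1 + s * (y - 1).
Proof.
move=> y0 /andP[s0 s1].
have [->|s0'] := eqVneq s 0; first by rewrite powRr0 mul0r addr0.
have [->|s1'] := eqVneq s 1; first by rewrite powRr1 ?(ltW y0) // mul1r; lra.
have sp : 0 < s by rewrite lt_neqAle eq_sym s0'.
have sq : 0 < 1 - s by rewrite subr_gt0 lt_neqAle s1'.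
have := @conjugate_powR R (y `^ s) 1 s^-1 (1 - s)^-1 (powR_ge0 _ _) ler01.
rewrite !invr_gt0 !invrK [s + _]addrC subrK => /(_ sp sq erefl).
rewrite mulr1 -powRrM divff // powRr1 ?(ltW y0) // powR1; lra.
Qed.

(** Young's inequality, as the tangent bound for the convex map h |-> h ^ q. *)
Lemma powR_young x y q : 0 <= x -> 0 < y -> 1 <= q ->
  x <= q^-1 * (x `^ q * y `^ (1 - q)) + (1 - q^-1) * y.
Proof.
move=> x0 y0 q1.
have q0 : 0 < q by apply: lt_le_trans q1.
have qV : 0 <= q^-1 <= 1 by rewrite invr_ge0 ltW //= invf_le1.
have [->|xn0] := eqVneq x 0.
  rewrite powR0 ?gt_eqF // mul0r mulr0 add0r; apply: mulr_ge0; last exact: ltW.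
  by rewrite subr_ge0; case/andP: qV.
have xp : 0 < x by rewrite lt_neqAle eq_sym xn0.
have u0 : 0 < (x / y) `^ q by rewrite powR_gt0 // divr_gt0.
have := powR_bernoulli u0 qV.
rewrite -powRrM divff ?gt_eqF // powRr1 ?divr_ge0 // ?(ltW y0) //.
rewrite ler_pdivrMr // => /le_trans; apply.
have yq : (y^-1) `^ q = y `^ (- q).
  by rewrite -powR_inv1 ?(ltW y0) // -powRrM mulN1r.
rewrite powRM ?invr_ge0 ?(ltW y0) // yq.
rewrite powRD ?(gt_eqF y0) ?implybT // powRr1 ?(ltW y0) //.
by rewrite le_eqVlt; apply/orP; left; apply/eqP; ring.
Qed.

(** The coefficient b exceeds half of the modulus of the second derivative at 0.  The sign
    of the derivative of the difference follows from Bernoulli bounds on either side of 0. *)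
Lemma powR_quadratic_minorant s b : 0 < s < 1 -> s * (1 - s) / 2 < b ->
  exists2 d, 0 < d < 1 & forall x, `|x| <= d -> 1 + s * x - b * x ^+ 2 <= (1 + x) `^ s.
Proof.
move=> /andP[s0 s1] sb.
have c0 : 0 < s * (1 - s) by rewrite mulr_gt0 // subr_gt0.
have b0 : 0 < b by apply: lt_trans sb; rewrite divr_gt0.
have bs : s * (1 - s) / (2 * b) < 1 by rewrite ltr_pdivrMr ?mulr_gt0 // mul1r; lra.
exists (Num.min 2^-1 (1 - s * (1 - s) / (2 * b))).
  rewrite lt_min invr_gt0 ltr0n subr_gt0 bs /= gt_min; apply/orP; left.
  by rewrite invf_lt1 ?ltr1n.
move=> x; rewrite le_min => /andP[x2 xb].
pose f u : R := (1 + u) `^ s - (1 + s * u - b * u ^+ 2).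
pose f' u : R := s * (1 + u) `^ (s - 1) - (s - b * (u *+ 2)).
have df (u : R) : -1 < u -> is_derive u (1 : R) f (f' u).
  move=> u1; have u0 : 0 < 1 + u by lra.
  have D1 : is_derive u (1 : R) (fun u => (1 + u) `^ s) (s * (1 + u) `^ (s - 1)).
    have h1 := @is_derive1_powR R s (1 + u) u0.
    have h2 : is_derive u (1 : R) (cst (1 : R) + @idfun R) (0 + 1) by apply: is_deriveD.
    have := @is_derive1_comp R _ (cst (1 : R) + @idfun R) u _ _ h1 h2.
    by rewrite add0r mulr1.
  have D2 : is_derive u (1 : R) (fun u => 1 + s * u - b * u ^+ 2) (s - b * (u *+ 2)).
    apply: is_derive_eq; rewrite add0r !scaler1 /GRing.scale /=; ring.
  exact: is_deriveB.
have cf (u : R) : -1 < u -> {for u, continuous f}.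
  by move=> u1; apply: differentiable_continuous; apply/derivable1_diffP; have [] := df u u1.
have f00 : f 0 = 0 by rewrite /f mulr0 expr0n /= mulr0 subr0 addr0 powR1 subrr.
suff : 0 <= f x by rewrite subr_ge0.
have dpos u : 0 <= u -> 0 <= f' u.
  move=> u0; rewrite /f'.
  have u1 : 0 < 1 + u by lra.
  have B : (1 + u) `^ (1 - s) <= 1 + (1 - s) * u.
    have := @powR_bernoulli (1 + u) (1 - s) u1; rewrite [1 + u - 1]addrC addKr.
    by apply; apply/andP; split; lra.
  have p0 : 0 < (1 + u) `^ (1 - s) by rewrite powR_gt0.
  have m0 : 0 < 1 + (1 - s) * u by rewrite ltr_pwDl // mulr_ge0 // subr_ge0 ltW.
  have : 1 - (1 - s) * u <= (1 + u) `^ (s - 1).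
    rewrite -[s - 1]opprB powRN; apply: (@le_trans _ _ (1 + (1 - s) * u)^-1); last first.
      by rewrite lef_pV2.
    rewrite -[leRHS]mul1r ler_pdivlMr //.
    have -> : (1 - (1 - s) * u) * (1 + (1 - s) * u) = 1 - ((1 - s) * u) ^+ 2 by ring.
    by rewrite gerBl sqr_ge0.
  move=> H; have : s * (1 - (1 - s) * u) <= s * (1 + u) `^ (s - 1) by rewrite ler_pM2l.
  have : s * (1 - s) * u <= 2 * b * u by rewrite ler_wpM2r //; lra.
  lra.
have dneg u : -`|x| <= u <= 0 -> f' u <= 0.
  move=> /andP[xu u0]; rewrite /f'.
  have u1 : 0 < 1 + u by lra.
  have uV : 0 < (1 + u)^-1 by rewrite invr_gt0.
  have B : (1 + u) `^ (s - 1) <= 1 + (1 - s) * ((1 + u)^-1 - 1).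
    rewrite (_ : s - 1 = - 1 * (1 - s)); last by ring.
    rewrite powRrM powR_inv1 ?(ltW u1) //.
    by apply: powR_bernoulli => //; apply/andP; split; lra.
  have : s * (1 + u) `^ (s - 1) <= s * (1 + (1 - s) * ((1 + u)^-1 - 1)) by rewrite ler_pM2l.
  have : s * (1 - s) * (1 + u)^-1 <= 2 * b.
    have h : s * (1 - s) <= (1 - `|x|) * (2 * b).
      by rewrite -ler_pdivrMr ?mulr_gt0 //; lra.
    rewrite ler_pdivrMr // (le_trans h) // mulrC ler_wpM2l ?mulr_ge0 ?(ltW b0) //; lra.
  move=> H1; have : (2 * b) * u <= s * (1 - s) * (1 + u)^-1 * u by rewrite ler_wnM2r.
  have -> : s * (1 - s) * (1 + u)^-1 * u = s * (1 - s) * (1 - (1 + u)^-1).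
    by field; rewrite gt_eqF.
  lra.
have mvt (a c : R) : -1 < a -> a <= c ->
    exists2 e, a <= e <= c & f c - f a = f' e * (c - a).
  move=> a1 ac.
  have [e ei fe] : exists2 e, e \in `[a, c]%R & f c - f a = f' e * (c - a).
    apply: MVT_segment => //.
      by move=> u; rewrite in_itv /= => /andP[au _]; apply: df; apply: lt_trans au.
    apply: continuous_in_subspaceT => u; rewrite inE /= in_itv /= => /andP[au _].
    by apply: cf; apply: lt_le_trans au.
  by exists e => //; move: ei; rewrite in_itv.
have [x0|x0] := leP 0 x.
  have [//|c /andP[c0' _]] := mvt 0 x (ltrN10 _).
  by rewrite f00 !subr0 => ->; rewrite mulr_ge0 // dpos.
have xn : `|x| = - x by rewrite ltr0_norm.
have [||c /andP[c0' c1]] := mvt x 0; [lra|exact: ltW|].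
rewrite f00 !sub0r => E.
have := dneg c; rewrite xn opprK c0' c1 => /(_ isT) fc.
have : 0 <= f' c * x by rewrite mulr_le0 // ltW.
by move: E; rewrite mulrN => /oppr_inj ->.
Qed.

(** |w| ^ (2 s) lies above the real part of the quadratic polynomial
    1 + 2 s (w - 1) + s (s - 1) (w - 1) ^ 2 near w = 1.  The second order
    coefficient is not the Taylor coefficient of w ^ (2 s): it is chosen so that
    the second order part of the difference is positive definite. *)
Lemma powR_modulus_minorant s : 0 < s < 1 -> exists2 d, 0 < d &
  forall x y, x ^+ 2 + y ^+ 2 <= d ^+ 2 ->
    1 + 2 * s * x + s * (s - 1) * (x ^+ 2 - y ^+ 2) <= ((1 + x) ^+ 2 + y ^+ 2) `^ s.
Proof.
move=> s01; have /andP[s0 s1] := s01.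
(* between s (1 - s) / 2 and s (1 - s) / 2 + s ^ 2 / 4; this value leaves s ^ 2 / 2 * r, with r below, for the terms of third order *)
pose b := s * (1 - s) / 2 + s ^+ 2 / 8.
have sb : s * (1 - s) / 2 < b by rewrite ltrDl divr_gt0 // exprn_gt0.
have [d0 /andP[d00 d01] Hd] := powR_quadratic_minorant s01 sb.
have ss1 : s ^+ 2 < 1 by rewrite expr_lt1 // ltW.
have b1 : b < 1.
  have : s * (1 - s) <= 1 by rewrite mulr_ile1 ?subr_ge0 ?ltW // gtrBl.
  by rewrite /b; lra.
have b0 : 0 < b by apply: lt_trans sb; rewrite divr_gt0 // mulr_gt0 // subr_gt0.
have [d dE] : exists d, d = Num.min (d0 / 3) (s ^+ 2 / 10).
  by exists (Num.min (d0 / 3) (s ^+ 2 / 10)).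
have dp : 0 < d by rewrite dE lt_min !divr_gt0 // exprn_gt0.
have dl1 : d <= d0 / 3 by rewrite dE ge_min lexx.
have dl2 : d <= s ^+ 2 / 10 by rewrite dE ge_min lexx orbT.
exists d => // x y; set r := x ^+ 2 + y ^+ 2 => rd.
have r0 : 0 <= r by rewrite addr_ge0 // sqr_ge0.
have dl3 : d <= 1 by lra.
have dd : d ^+ 2 <= d by rewrite expr2 ler_piMl // ltW.
have xd : `|x| <= d.
  rewrite -(ler_pXn2r (ltn0Sn 1)) ?nnegrE ?(ltW dp) // real_normK ?num_real //.
  by rewrite (le_trans _ rd) // lerDl sqr_ge0.
have XE : (1 + x) ^+ 2 + y ^+ 2 = 1 + (2 * x + r) by rewrite /r; ring.
have Xd : `|2 * x + r| <= d0.
  apply: le_trans (ler_normD _ _) _; rewrite normrM (ger0_norm r0) ger0_norm //; lra.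
rewrite XE; apply: le_trans (Hd _ Xd).
have h1 : 4 * x * r <= 4 * d * r.
  by rewrite ler_wpM2r // ler_pM2l // (le_trans (ler_norm x)).
have h2 : r ^+ 2 <= d * r by rewrite expr2 ler_wpM2r // (le_trans rd).
have h3 : b * ((2 * x + r) ^+ 2) <= b * (4 * x ^+ 2 + 5 * d * r).
  rewrite ler_pM2l //.
  have -> : (2 * x + r) ^+ 2 = 4 * x ^+ 2 + 4 * x * r + r ^+ 2 by ring.
  lra.
have h4 : b * (5 * d * r) <= s ^+ 2 / 2 * r.
  rewrite mulrA ler_wpM2r //.
  have : b * (5 * d) <= 1 * (5 * d) by rewrite ler_wpM2r ?mulr_ge0 // ltW.
  lra.
have y0 : 0 <= s ^+ 2 * y ^+ 2 by rewrite mulr_ge0 // sqr_ge0.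
have bx : b * (4 * x ^+ 2) = 2 * s * (1 - s) * x ^+ 2 + s ^+ 2 / 2 * x ^+ 2.
  by rewrite /b; field.
have rr : s ^+ 2 / 2 * r = s ^+ 2 / 2 * x ^+ 2 + s ^+ 2 / 2 * y ^+ 2 by rewrite /r; ring.
have sr : s * (2 * x + r) = 2 * s * x + s * x ^+ 2 + s * y ^+ 2 by rewrite /r; ring.
move: h3; rewrite mulrDr bx sr => h3.
have e1 : s * (s - 1) * (x ^+ 2 - y ^+ 2) =
  s ^+ 2 * x ^+ 2 - s * x ^+ 2 - s ^+ 2 * y ^+ 2 + s * y ^+ 2 by ring.
have e2 : 2 * s * (1 - s) * x ^+ 2 = 2 * (s * x ^+ 2) - 2 * (s ^+ 2 * x ^+ 2) by ring.
rewrite e1; rewrite e2 in h3; rewrite rr in h4; clear - h3 h4 y0; lra.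
Qed.

End powers.

Section local_submean.
Variable R : realType.

Lemma bm_powR_cst (f : R -> R) (s : R) : 0 <= s ->
  (forall t, 0 <= t <= 2 * pi -> 0 <= f t) -> bm f -> bm (fun t => f t `^ s).
Proof.
move=> s0 f0 bf; apply: (@bm_powR _ f (fun=> s)) => //.
  exact: (measurableT_comp (measurable_powR s) bf.1).
by exists s => t _; rewrite s0 lexx.
Qed.

(** Divide by F z0.  The power of the modulus lies above the real part of a quadratic
    polynomial in F / F z0 - 1, which is holomorphic and hence has its value at the centre
    as circle mean. *)
Lemma cabs_powR_submean (F : R[i] -> R[i]) z0 (R0 s : R) : 0 < R0 ->
  (forall z, cabs (z - z0) < R0 -> cdiff F z) -> 0 < s < 1 ->
  exists2 d, 0 < d & forall r, 0 < r < d ->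
    cabs (F z0) `^ (2 * s) <= cmean (fun t => cabs (F (z0 + polar r t)) `^ (2 * s)).
Proof.
move=> R00 dF s01; have /andP[s0 s1] := s01.
have [F0|F0] := eqVneq (F z0) 0.
  exists 1 => // r _; rewrite F0 cabs0 powR0; last by rewrite mulf_neq0 // gt_eqF.
  by apply: cmean_ge0 => t _; exact: powR_ge0.
have [d d0 Hd] := powR_modulus_minorant s01.
have dFz : cdiff F z0 by apply: dF; rewrite subrr cabs0.
pose c := F z0.
have c0 : 0 < cabs c by rewrite cabs_gt0.
pose G z := F z / c - 1.
pose Q z : R[i] := 1 + (2 * s)%:C * G z + (s * (s - 1))%:C * (G z * G z).
have dG z : cabs (z - z0) < R0 -> cdiff G z.
  move=> /dF h; apply: cdiffD; last exact: cdiff_cst.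
  by apply: cdiffM => //; exact: cdiff_cst.
have dQ z : cabs (z - z0) < R0 -> cdiff Q z.
  move=> /dG h; apply: cdiffD.
    apply: cdiffD; first exact: cdiff_cst.
    by apply: cdiffM => //; exact: cdiff_cst.
  by apply: cdiffM; [exact: cdiff_cst|exact: cdiffM].
have [K K0 [e e0 He]] := cdiff_lipschitz (dG z0 ltac:(by rewrite subrr cabs0)).
have G0 : G z0 = 0 by rewrite /G divff // subrr.
exists (Num.min R0 (Num.min e (d / K))).
  by rewrite !lt_min R00 e0 divr_gt0.
move=> r /andP[r0]; rewrite !lt_min => /andP[rR /andP[re rd]].
have inR t : cabs (z0 + polar r t - z0) = r.
  by rewrite [z0 + _]addrC addrK cabs_polar gtr0_norm.
have cF : continuous (fun t => cabs (F (z0 + polar r t))).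
  apply: (@continuous_on_circle R (fun w => cabs (F w)) z0 r) => t.
  by apply: cdiff_continuous_cabs; apply: dF; rewrite inR.
have cQ : continuous (fun t => complex.Re (Q (z0 + polar r t))).
  apply: (@continuous_on_circle R (fun w => complex.Re (Q w)) z0 r) => t.
  by apply: cdiff_continuous_Re; apply: dQ; rewrite inR.
have ss : 0 <= 2 * s by rewrite mulr_ge0 // ltW.
have MV : cmean (fun t => complex.Re (Q (z0 + polar r t))) = 1.
  rewrite (@mean_value R Q z0 R0 r dQ) ?r0 //.
  by rewrite /Q G0 !mulr0 !addr0.
have -> : cabs c `^ (2 * s) =
    cmean (fun t => cabs c `^ (2 * s) * complex.Re (Q (z0 + polar r t))).
  by rewrite cmeanZ ?MV ?mulr1 //; exact: bm_continuous.
apply: le_cmean.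
- by apply: bmZ; exact: bm_continuous.
- by apply: bm_powR_cst => //; [by move=> t _; exact: cabs_ge0|exact: bm_continuous].
move=> t _; set z := z0 + polar r t.
have -> : F z = c * (1 + G z) by rewrite /G addrC subrK mulrC divfK.
rewrite cabsM powRM ?cabs_ge0 // ler_wpM2l ?powR_ge0 //.
have Gz : cabs (G z) <= d.
  have := He z; rewrite inR G0 subr0 => /(_ re) /le_trans; apply.
  by rewrite mulrC -ler_pdivlMr // ltW.
rewrite powRrM powR_mulrn ?cabs_ge0 // sqr_cabs.
have := Hd (complex.Re (G z)) (complex.Im (G z)).
have -> : complex.Re (G z) ^+ 2 + complex.Im (G z) ^+ 2 <= d ^+ 2.
  by rewrite -sqr_cabs lerXn2r ?nnegrE ?cabs_ge0 ?(ltW d0).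
move=> /(_ isT).
rewrite /Q; case: (G z) => x y /=; rewrite add0r.
by congr (_ <= _); rewrite !mul0r !subr0 -!expr2 ?mulrA.
Qed.

End local_submean.

(** * The Poisson kernel *)

Section poisson.
Variable R : realType.
Implicit Types (z w : R[i]) (t r : R) (f : R -> R).

(** The Poisson kernel at z for the boundary point of angle t, and the Poisson integral. *)
Definition PK z t : R := (1 - cabs z ^+ 2) / cabs (polar 1 t - z) ^+ 2.
Definition PI z f := cmean (fun t => PK z t * f t).

Lemma circle_dist_ge z t : 1 - cabs z <= cabs (polar 1 t - z).
Proof. by rewrite -[X in X - _](cabs_polar1 t) ler_cabsB. Qed.

Lemma circle_dist_gt0 z t : cabs z < 1 -> 0 < cabs (polar 1 t - z).
Proof. by move=> z1; apply: lt_le_trans (circle_dist_ge z t); rewrite subr_gt0. Qed.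

Lemma PK_ge0 z t : cabs z <= 1 -> 0 <= PK z t.
Proof.
by move=> z1; rewrite divr_ge0 ?sqr_ge0 // subr_ge0 expr_le1 // cabs_ge0.
Qed.

Lemma PK_le z t : cabs z < 1 -> PK z t <= 2 * (1 - cabs z) / cabs (polar 1 t - z) ^+ 2.
Proof.
move=> z1; rewrite ler_wpM2r ?invr_ge0 ?sqr_ge0 //.
have := cabs_ge0 z; have -> : 1 - cabs z ^+ 2 = (1 + cabs z) * (1 - cabs z) by ring.
by move=> z0; rewrite ler_wpM2r ?subr_ge0 ?(ltW z1) //; lra.
Qed.

Lemma PK_le_inv z t : cabs z < 1 -> PK z t <= 2 / (1 - cabs z).
Proof.
move=> z1; apply: le_trans (PK_le t z1) _.
have d0 : 0 < 1 - cabs z by rewrite subr_gt0.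
rewrite ler_pdivrMr ?exprn_gt0 ?circle_dist_gt0 //.
have -> : 2 * (1 - cabs z) = 2 / (1 - cabs z) * (1 - cabs z) ^+ 2.
  by field; rewrite gt_eqF.
rewrite ler_wpM2l ?divr_ge0 ?(ltW d0) //.
by rewrite lerXn2r ?nnegrE ?cabs_ge0 ?(ltW d0) // circle_dist_ge.
Qed.

Lemma PKE x y t : PK (x +i* y) t =
  (1 - (x ^+ 2 + y ^+ 2)) * ((cos t - x) ^+ 2 + (sin t - y) ^+ 2)^-1.
Proof. by rewrite /PK !sqr_cabs /= !mul1r. Qed.

Lemma measurable_fun_PK d (T : measurableType d) (X Y Z : T -> R) :
  measurable_fun setT X -> measurable_fun setT Y -> measurable_fun setT Z ->
  measurable_fun setT (fun x => PK (X x +i* Y x) (Z x)).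
Proof.
move=> mX mY mZ; under eq_fun do rewrite PKE.
have mc : measurable_fun setT (fun x => cos (Z x)).
  exact: (measurableT_comp (continuous_measurable_fun (@continuous_cos R)) mZ).
have ms : measurable_fun setT (fun x => sin (Z x)).
  exact: (measurableT_comp (continuous_measurable_fun (@continuous_sin R)) mZ).
apply: measurable_funM.
  apply: measurable_funB; first exact: measurable_cst.
  by apply: measurable_funD; exact: measurable_funX.
under eq_fun do rewrite -powR_inv1 ?addr_ge0 ?sqr_ge0 //.
apply: (measurableT_comp (measurable_powR (-1))).
by apply: measurable_funD; apply: measurable_funX; exact: measurable_funB.
Qed.

Lemma bm_PK z : cabs z < 1 -> bm (PK z).
Proof.
case: z => x y z1; split.
  apply: (@measurable_funS _ _ _ _ setT) => //.
  by apply: measurable_fun_PK; [exact: measurable_cst|exact: measurable_cst|exact: measurable_id].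
exists (2 / (1 - cabs (x +i* y))) => t _; rewrite ger0_norm; first exact: PK_le_inv.
by rewrite PK_ge0 // ltW.
Qed.

Lemma cabs_conj (z : R[i]) : cabs (z^*)%C = cabs z.
Proof. by case: z => x y; rewrite !cabsE /= sqrrN. Qed.

(** The kernel is the real part of (1 + conj z * e) / (1 - conj z * e), a holomorphic
    function of e that equals 1 at 0. *)
Lemma PK_mass z : cabs z < 1 -> cmean (PK z) = 1.
Proof.
move=> z1.
have [R0 R01 zR0] : exists2 R0, 1 < R0 & cabs z * R0 < 1.
  have z0 := cabs_ge0 z.
  exists (2 / (1 + cabs z)); first by rewrite ltr_pdivlMr; lra.
  by rewrite mulrA ltr_pdivrMr; lra.
pose F (e : R[i]) := (1 + (z^*)%C * e) * (1 - (z^*)%C * e)^-1.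
have nz e : cabs (e - 0) < R0 -> 1 - (z^*)%C * e != 0.
  rewrite subr0 => eR; rewrite -cabs_gt0.
  apply: lt_le_trans (ler_cabsB _ _); rewrite cabs1 subr_gt0 cabsM cabs_conj.
  by apply: le_lt_trans zR0; rewrite ler_wpM2l ?cabs_ge0 // ltW.
have dF e : cabs (e - 0) < R0 -> cdiff F e.
  move=> /nz he; apply: cdiffM.
    by apply: cdiffD; [exact: cdiff_cst|apply: cdiffM; [exact: cdiff_cst|exact: cdiff_id]].
  apply: cdiffV => //; apply: cdiffB; first exact: cdiff_cst.
  by apply: cdiffM; [exact: cdiff_cst|exact: cdiff_id].
have := @mean_value R F 0 R0 1 dF; rewrite ltr01 R01 => /(_ isT).
have -> : complex.Re (F 0) = 1 by rewrite /F !mulr0 addr0 subr0 divr1.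
move=> <-; apply: eq_cmean => t _; rewrite add0r.
have /nz : cabs (polar 1 t - 0) < R0 by rewrite subr0 cabs_polar1.
have := circle_dist_gt0 t z1.
rewrite /F; case: z {z1 zR0 F nz dF} => x y.
rewrite PKE -(ltr_pXn2r (ltn0Sn 1)) ?nnegrE ?cabs_ge0 // expr0n /= sqr_cabs /= !mul1r => D0.
rewrite -cabs_gt0 -(ltr_pXn2r (ltn0Sn 1)) ?nnegrE ?cabs_ge0 // expr0n /= sqr_cabs /=.
rewrite !mul1r => E0.
have cs : cos t ^+ 2 = 1 - sin t ^+ 2 by rewrite cos2sin2.
have EE : (1 - (x * cos t - - y * sin t)) ^+ 2 + (0 - (x * sin t + - y * cos t)) ^+ 2 =
   (cos t - x) ^+ 2 + (sin t - y) ^+ 2.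
  by rewrite !sqrrB !sqrrD !exprMn !sqrrN cs; ring.
rewrite EE in E0 *.
have S : sin t ^+ 2 = 1 - cos t ^+ 2 by rewrite sin2cos2.
move: E0; set D := _ + (sin t - y) ^+ 2 => E0.
rewrite [RHS](_ : _ = ((1 + (x * cos t - - y * sin t)) * (1 - (x * cos t - - y * sin t))
   - (0 + (x * sin t + - y * cos t)) * - (0 - (x * sin t + - y * cos t))) * D^-1); last first.
  by ring.
congr (_ * _).
have -> : y ^+ 2 = y ^+ 2 * (cos t ^+ 2 + sin t ^+ 2) by rewrite cos2Dsin2 mulr1.
have -> : x ^+ 2 = x ^+ 2 * (cos t ^+ 2 + sin t ^+ 2) by rewrite cos2Dsin2 mulr1.
by ring.
Qed.

(** As a function of z the kernel is harmonic, being the real part of (e + z) / (e - z). *)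
Lemma PK_mean z0 r t : 0 < r -> cabs z0 + r < 1 ->
  cmean (fun s => PK (z0 + polar r s) t) = PK z0 t.
Proof.
move=> r0 zr.
pose e := polar 1 t : R[i].
pose F z := (e + z) * (e - z)^-1.
have nz z : cabs z < 1 -> e - z != 0 by move=> z1; rewrite -cabs_gt0 circle_dist_gt0.
have disc_ z : cabs (z - z0) < 1 - cabs z0 -> cabs z < 1.
  by move=> h; have := ler_cabsD (z - z0) z0; rewrite subrK; lra.
have dF z : cabs (z - z0) < 1 - cabs z0 -> cdiff F z.
  move=> /disc_ /nz he; apply: cdiffM.
    by apply: cdiffD; [exact: cdiff_cst|exact: cdiff_id].
  by apply: cdiffV => //; apply: cdiffB; [exact: cdiff_cst|exact: cdiff_id].
have PKF z : cabs z < 1 -> PK z t = complex.Re (F z).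
  move=> z1; have := circle_dist_gt0 t z1; rewrite /F /e; case: z {z1} => x y.
  rewrite PKE -(ltr_pXn2r (ltn0Sn 1)) ?nnegrE ?cabs_ge0 // expr0n /= sqr_cabs /= !mul1r => D0.
  set D := _ + (sin t - y) ^+ 2.
  rewrite [RHS](_ : _ = ((cos t + x) * (cos t - x) + (sin t + y) * (sin t - y)) * D^-1); last first.
    by ring.
  congr (_ * _).
  have <- : (cos t ^+ 2 + sin t ^+ 2) = 1 by rewrite cos2Dsin2.
  by ring.
have z01 : cabs z0 < 1 by lra.
rewrite (PKF _ z01) -(@mean_value R F z0 (1 - cabs z0) r dF); last by rewrite r0; lra.
apply: eq_cmean => s _; rewrite PKF //.
by apply: le_lt_trans (ler_cabsD _ _) _; rewrite cabs_polar gtr0_norm.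
Qed.

Lemma bm_PKM z f : cabs z < 1 -> bm f -> bm (fun t => PK z t * f t).
Proof. by move=> z1 bf; apply: bmM => //; exact: bm_PK. Qed.

Lemma PI_ge0 z f : cabs z < 1 -> (forall t, 0 <= t <= 2 * pi -> 0 <= f t) -> 0 <= PI z f.
Proof.
by move=> z1 f0; apply: cmean_ge0 => t ht; rewrite mulr_ge0 ?f0 // PK_ge0 // ltW.
Qed.

Lemma le_PI z f g : cabs z < 1 -> bm f -> bm g ->
  (forall t, 0 <= t <= 2 * pi -> f t <= g t) -> PI z f <= PI z g.
Proof.
move=> z1 bf bg fg; apply: le_cmean; [exact: bm_PKM|exact: bm_PKM|].
by move=> t ht; rewrite ler_wpM2l ?fg // PK_ge0 // ltW.
Qed.

Lemma PI_D z f g : cabs z < 1 -> bm f -> bm g ->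
  PI z (fun t => f t + g t) = PI z f + PI z g.
Proof.
move=> z1 bf bg; rewrite /PI -cmeanD; [|exact: bm_PKM|exact: bm_PKM].
by apply: eq_cmean => t _; rewrite mulrDr.
Qed.

Lemma PI_Z z c f : cabs z < 1 -> bm f -> PI z (fun t => c * f t) = c * PI z f.
Proof.
move=> z1 bf; rewrite /PI -cmeanZ; last exact: bm_PKM.
by apply: eq_cmean => t _; rewrite mulrCA.
Qed.

Lemma PI_cst z c : cabs z < 1 -> PI z (fun=> c) = c.
Proof.
move=> z1; rewrite /PI -[RHS]mulr1 -(PK_mass z1) -cmeanZ; last exact: bm_PK.
by apply: eq_cmean => t _; rewrite mulrC.
Qed.

Lemma sqr_PI_le z f : cabs z < 1 -> bm f -> PI z f ^+ 2 <= PI z (fun t => f t ^+ 2).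
Proof.
move=> z1 bf; apply: sqr_cmean_le => //; [exact: bm_PK| |exact: PK_mass].
by move=> t _; rewrite PK_ge0 // ltW.
Qed.

(** Poisson integrals are harmonic, by averaging the kernel first. *)
Lemma PI_circle_Tonelli z0 r f : 0 < r -> cabs z0 + r < 1 ->
  bm f -> (forall t, 0 <= t <= 2 * pi -> 0 <= f t) ->
  bm (fun s => PI (z0 + polar r s) f) /\
  cmean (fun s => PI (z0 + polar r s) f) = PI z0 f.
Proof.
move=> r0 zr bf f0.
have z1 s : cabs (z0 + polar r s) <= cabs z0 + r.
  by rewrite (le_trans (ler_cabsD _ _)) // cabs_polar gtr0_norm.
have z1' s : cabs (z0 + polar r s) < 1 by apply: le_lt_trans zr.
have [||||| b ->] := @cmean_Tonelli R (fun s t => PK (z0 + polar r s) t) f.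
- case: z0 {zr z1 z1'} => x y.
  apply: (@measurable_fun_PK _ _ (fun p => x + r * cos p.1) (fun p => y + r * sin p.1) snd).
  + apply: measurable_funD; first exact: measurable_cst.
    apply: measurable_funM; first exact: measurable_cst.
    exact: (measurableT_comp (continuous_measurable_fun (@continuous_cos R)) measurable_fst).
  + apply: measurable_funD; first exact: measurable_cst.
    apply: measurable_funM; first exact: measurable_cst.
    exact: (measurableT_comp (continuous_measurable_fun (@continuous_sin R)) measurable_fst).
  + exact: measurable_snd.
- by move=> s t; rewrite PK_ge0 // ltW.
- exists (2 / (1 - (cabs z0 + r))) => s t _ _.
  apply: le_trans (PK_le_inv _ (z1' s)) _.
  by rewrite ler_pM2l // lef_pV2 ?posrE ?subr_gt0 // lerD2l lerN2.
- by [].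
- by [].
split => //; apply: eq_cmean => t _; by rewrite PK_mean.
Qed.

(** Jensen's inequality for the kernel bounds the square by the Poisson integral of f ^ 2,
    whose mean over the circle of radius r is its value at 0. *)
Lemma PI_contraction r f : 0 < r < 1 -> bm f ->
  bm (fun s => PI (polar r s) f) /\
  cmean (fun s => PI (polar r s) f ^+ 2) <= cmean (fun t => f t ^+ 2).
Proof.
move=> /andP[r0 r1] bf.
have z1 s : cabs (polar r s) < 1 by rewrite cabs_polar gtr0_norm.
have r1' : cabs (0 : R[i]) + r < 1 by rewrite cabs0 add0r.
have [M HM] := bf.2.
have M0 : 0 <= M by apply: le_trans (HM 0 _); rewrite ?lexx ?pi20.
(* the shift by M reduces measurability to the nonnegative case *)
have bfM : bm (fun t => f t + M) by apply: bmD => //; exact: bm_cst.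
have [|b _] := @PI_circle_Tonelli 0 r (fun t => f t + M) r0 r1' bfM.
  by move=> t /HM; rewrite ler_norml => /andP[]; lra.
have bP : bm (fun s => PI (polar r s) f).
  rewrite (_ : (fun s => _) = fun s => PI (0 + polar r s) (fun t => f t + M) - M).
    by apply: bmB => //; exact: bm_cst.
  apply/funext => s; rewrite add0r PI_D //; last exact: bm_cst.
  by rewrite PI_cst // addrK.
split => //.
have [|b2 E] := @PI_circle_Tonelli 0 r (fun t => f t ^+ 2) r0 r1' (bmX 2 bf).
  by move=> t _; exact: sqr_ge0.
have -> : cmean (fun t => f t ^+ 2) = PI 0 (fun t => f t ^+ 2).
  apply: eq_cmean => t _.
  by rewrite /PK cabs0 subr0 cabs_polar1 expr0n /= subr0 expr1n divr1 mul1r.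
rewrite -E; apply: le_cmean => //; first exact: bmX.
by move=> s _; rewrite add0r sqr_PI_le.
Qed.

End poisson.

(** * Poisson majorants *)

Section poisson_majorant.
Variable R : realType.
Implicit Types (z w : R[i]) (t r : R) (u : R[i] -> R).

Lemma cabs_continuous : continuous (@cabs R).
Proof. by move=> z; have := cdiff_continuous_cabs (cdiff_id z). Qed.

Lemma polar_continuous2 : continuous (fun x : R * R => polar x.1 x.2).
Proof.
move=> [r t]; apply/(@cvgrPdist_lt _ _ _ (nbhs (r, t))) => _ /gt0_complexP[e egt ->].
have K0 : 0 < 4 + 3 * `|r| by rewrite ltr_pwDl // mulr_ge0.
pose D := Num.min 1 (e / (2 * (4 + 3 * `|r|))).
have D0 : 0 < D by rewrite lt_min ltr01 divr_gt0 // mulr_gt0.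
have De : (4 + 3 * `|r|) * D < e.
  have : D <= e / (2 * (4 + 3 * `|r|)) by rewrite ge_min lexx orbT.
  move=> /(ler_wpM2l (ltW K0)) /le_lt_trans; apply.
  have -> : (4 + 3 * `|r|) * (e / (2 * (4 + 3 * `|r|))) = e / 2 by field; rewrite gt_eqF.
  by rewrite ltr_pdivrMr // mulr_natr mulr2n ltrDl.
near=> x; rewrite normc_cabs ltcR cabs_distrC.
apply: le_lt_trans De; apply: polar_lipschitz.
- by rewrite ltW //= ge_min lexx.
- near: x; under eq_near do rewrite distrC.
  by apply: (@cvgr_dist_le _ _ _ (nbhs (r, t)) _ fst r) => //; exact: cvg_fst.
- near: x; under eq_near do rewrite distrC.
  by apply: (@cvgr_dist_le _ _ _ (nbhs (r, t)) _ snd t) => //; exact: cvg_snd.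
Unshelve. all: by end_near. Qed.

(** The closed disc is the image of a compact rectangle under polar coordinates. *)
Lemma closed_disc_max u : (forall z, cabs z <= 1 -> {for z, continuous u}) ->
  exists2 z, cabs z <= 1 & forall w, cabs w <= 1 -> u w <= u z.
Proof.
move=> cu.
pose A : set (R * R) := (`[0, 1] `*` `[- pi, pi])%classic.
have cA : compact A by apply: compact_setX; exact: segment_compact.
have A0 : A !=set0.
  exists (0, 0); split => /=; rewrite in_itv /= ?lexx ?ler01 //.
  by rewrite oppr_le0 pi_ge0.
have cf : {within A, continuous (fun x : R * R => u (polar x.1 x.2))}.
  apply: continuous_in_subspaceT => x; rewrite inE => -[/= + _].
  rewrite in_itv /= => /andP[x0 x1].
  apply: (@continuous_comp _ _ _ (fun x : R * R => polar x.1 x.2) u).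
    exact: polar_continuous2.
  by apply: cu; rewrite cabs_polar ger0_norm.
have [[r t] /= + Hm] := @compact_EVT_max _ R _ A A0 cA cf.
rewrite inE => -[/= + _]; rewrite in_itv /= => /andP[r0 r1].
exists (polar r t); first by rewrite cabs_polar ger0_norm.
move=> w w1; have [s [-> + _]] := polar_arg w.
rewrite ler_norml => sp.
apply: (Hm (cabs w, s)); rewrite inE; split => /=; rewrite in_itv //=.
by rewrite cabs_ge0.
Qed.

Lemma PK_lipschitz z w t : cabs z < 1 -> cabs (w - z) <= (1 - cabs z) / 2 ->
  `|PK w t - PK z t| <= 3 * cabs (w - z) / ((1 - cabs z) / 2) ^+ 4.
Proof.
move=> z1; set n := (1 - cabs z) / 2 => wz.
have n0 : 0 < n by rewrite divr_gt0 // subr_gt0.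
have zn : cabs z = 1 - 2 * n by rewrite /n; field.
have w1 : cabs w <= 1 - n.
  by have := ler_cabsD (w - z) z; rewrite subrK; lra.
have Dz1 := circle_dist_ge z t; have Dw1 := circle_dist_ge w t.
have Dz2 := ler_cabs_sub (polar 1 t) z; have Dw2 := ler_cabs_sub (polar 1 t) w.
have Dzw := ler_cabs_dist (polar 1 t - z) (polar 1 t - w).
have zw2 := ler_cabs_dist z w.
rewrite cabs_polar1 in Dz2 Dw2.
have E : polar 1 t - z - (polar 1 t - w) = w - z by ring.
rewrite E in Dzw; rewrite cabs_distrC in zw2.
rewrite /PK; move: Dz1 Dw1 Dz2 Dw2 Dzw zw2.
have w0 := cabs_ge0 w; have z0 := cabs_ge0 z; have h0 := cabs_ge0 (w - z).
move: w1 w0 z0 h0 wz zn; clear E; clearbody n.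
move: (cabs (polar 1 t - z)) (cabs (polar 1 t - w)) (cabs z) (cabs w) (cabs (w - z)).
move=> a b x y h y1 y0 x0 h0 hn xn a1 b1 a2 b2 ab xy.
have an : n <= a by lra.
have bn : n <= b by lra.
have ap : 0 < a by lra.
have bp : 0 < b by lra.
have -> : (1 - y ^+ 2) / b ^+ 2 - (1 - x ^+ 2) / a ^+ 2 =
  ((x - y) * (x + y) * a ^+ 2 + (1 - x ^+ 2) * ((a - b) * (a + b))) / (a ^+ 2 * b ^+ 2).
  by field; rewrite !gt_eqF.
rewrite normrM normfV [`|a ^+ 2 * _|]ger0_norm; last by rewrite mulr_ge0 ?sqr_ge0.
have ab4 : n ^+ 2 * (2 * n) ^+ 2 <= a ^+ 2 * b ^+ 2.
  rewrite mulrC; apply: ler_pM; rewrite ?exprn_ge0 ?mulr_ge0 ?(ltW n0) //.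
    by rewrite lerXn2r ?nnegrE ?mulr_ge0 ?(ltW n0) ?(ltW ap) //; lra.
  by rewrite lerXn2r ?nnegrE ?(ltW n0) ?(ltW bp).
have num : `|(x - y) * (x + y) * a ^+ 2 + (1 - x ^+ 2) * ((a - b) * (a + b))| <= 12 * h.
  apply: le_trans (ler_normD _ _) _.
  rewrite (normrM (_ * _) (a ^+ 2)) (normrM (x - y)) (normrM (1 - x ^+ 2)) (normrM (a - b)).
  have e1 : `|x - y| * `|x + y| * `|a ^+ 2| <= h * 2 * 4.
    apply: ler_pM; rewrite ?mulr_ge0 //.
      by apply: ler_pM => //; rewrite ger0_norm ?addr_ge0 //; lra.
    rewrite ger0_norm ?sqr_ge0 // -[4]/(2 * 2)%:R natrM -expr2.
    by rewrite lerXn2r ?nnegrE ?(ltW ap) //; lra.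
  have e2 : `|1 - x ^+ 2| * (`|a - b| * `|a + b|) <= 1 * (h * 4).
    apply: ler_pM; rewrite ?mulr_ge0 //.
      rewrite ger0_norm ?gerBl ?sqr_ge0 // subr_ge0 expr_le1 //; lra.
    by apply: ler_pM => //; rewrite ger0_norm ?addr_ge0 ?(ltW ap) ?(ltW bp) //; lra.
  lra.
apply: (@le_trans _ _ (12 * h / (n ^+ 2 * (2 * n) ^+ 2))); last first.
  by rewrite le_eqVlt; apply/orP; left; apply/eqP; field; rewrite gt_eqF.
apply: ler_pM => //; first by rewrite invr_ge0 mulr_ge0 ?sqr_ge0.
by rewrite lef_pV2 ?posrE // ?mulr_gt0 ?exprn_gt0 // mulr_gt0.
Qed.

Lemma PI_continuous z (f : R -> R) : cabs z < 1 -> bm f ->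
  {for z, continuous (fun w => PI w f)}.
Proof.
move=> z1 bf; have [M HM] := bf.2.
have M0 : 0 <= M by apply: le_trans (HM 0 _); rewrite ?lexx ?pi20.
set n := (1 - cabs z) / 2.
have n0 : 0 < n by rewrite divr_gt0 // subr_gt0.
apply/ccontinuousP => e e0.
have K0 : 0 < 3 * (M + 1) / n ^+ 4 by rewrite divr_gt0 ?exprn_gt0 // mulr_gt0 //; lra.
exists (Num.min n (e / (3 * (M + 1) / n ^+ 4))); first by rewrite lt_min n0 divr_gt0.
move=> w; rewrite lt_min => /andP[wn we].
have w1 : cabs w < 1.
  by have := ler_cabsD (w - z) z; rewrite subrK; move: wn; rewrite /n; lra.
rewrite /PI -cmeanB; [|exact: bm_PKM|exact: bm_PKM].
have bb : bm (fun t => PK w t * f t - PK z t * f t) by apply: bmB; exact: bm_PKM.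
apply: le_lt_trans (ler_norm_cmean bb) _.
apply: (@le_lt_trans _ _ (3 * (M + 1) / n ^+ 4 * cabs (w - z))); last first.
  by rewrite mulrC -ltr_pdivlMr.
rewrite -[leRHS]cmean_cst; apply: le_cmean; [exact: bm_norm|exact: bm_cst|].
move=> t ht; rewrite -mulrBl normrM.
have := PK_lipschitz t z1 (ltW wn); rewrite -/n => H.
apply: (@le_trans _ _ (3 * cabs (w - z) / n ^+ 4 * (M + 1))).
  by apply: ler_pM => //; rewrite (le_trans (HM t ht)) // lerDl.
by rewrite le_eqVlt; apply/orP; left; apply/eqP; field; rewrite gt_eqF.
Qed.

(** Near z0 the boundary values are close to u z0; elsewhere the kernel tends to 0 as z
    tends to z0. *)
Lemma PI_boundary u z0 e (M : R) : cabs z0 = 1 -> 0 < e -> {for z0, continuous u} ->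
  bm (fun t => u (polar 1 t)) -> (forall t, 0 <= t <= 2 * pi -> `|u (polar 1 t)| <= M) ->
  exists2 d, 0 < d & forall z, cabs z < 1 -> cabs (z - z0) < d ->
    `|u z - PI z (fun t => u (polar 1 t))| < e.
Proof.
move=> z01 e0 /ccontinuousP cu bu HM.
have M0 : 0 <= M by apply: le_trans (HM 0 _); rewrite ?lexx ?pi20.
have [d1 d10 Hd1] := cu (e / 8) (divr_gt0 e0 (ltr0n _ 8)).
pose M' := `|u z0| + e + M.
have M'0 : 0 < M' by rewrite /M' ltr_wpDr // ltr_wpDl.
have c0 : 0 < e * d1 ^+ 2 / (32 * M') by rewrite divr_gt0 ?mulr_gt0 ?exprn_gt0.
exists (Num.min (d1 / 2) (e * d1 ^+ 2 / (32 * M'))); first by rewrite lt_min c0 divr_gt0.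
move=> z z1; rewrite lt_min => /andP[zd zc].
have zz : 1 - cabs z <= cabs (z - z0) by rewrite -z01 cabs_distrC ler_cabsB.
have uz : `|u z - u z0| < e / 8 by apply: Hd1; clear - zd d10; lra.
rewrite -[X in X - _](PI_cst _ z1) /PI -cmeanB; last 2 first.
- by apply: bm_PKM => //; exact: bm_cst.
- exact: bm_PKM.
have bb : bm (fun t => PK z t * u z - PK z t * u (polar 1 t)).
  by apply: bmB; apply: bm_PKM => //; exact: bm_cst.
apply: le_lt_trans (ler_norm_cmean bb) _.
apply: (@le_lt_trans _ _ (e / 4 + e / 2)); last by clear - e0; lra.
have -> : e / 4 + e / 2 = cmean (fun t => e / 4 * PK z t + e / 2).
  rewrite cmeanD; [|by apply: bmZ; exact: bm_PK|exact: bm_cst].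
  by rewrite cmeanZ ?PK_mass ?cmean_cst ?mulr1 //; exact: bm_PK.
apply: le_cmean; [exact: bm_norm| |].
  by apply: bmD; [apply: bmZ; exact: bm_PK|exact: bm_cst].
move=> t ht; rewrite -mulrBr normrM.
have P0 : 0 <= PK z t by rewrite PK_ge0 // ltW.
rewrite (ger0_norm P0).
have [near_|far] := ltP (cabs (polar 1 t - z0)) d1.
  have : `|u z - u (polar 1 t)| <= e / 4.
    have := Hd1 _ near_; move: uz; clear; rewrite !ltr_norml ler_norml => /andP[? ?] /andP[? ?].
    by apply/andP; split; lra.
  move=> /(ler_wpM2l P0); rewrite mulrC; clear - e0; lra.
have Dd : d1 / 2 <= cabs (polar 1 t - z).
  have := ler_cabs_triangle z (polar 1 t) z0; clear - zd far; lra.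
have PKb : PK z t <= 2 * cabs (z - z0) / (d1 / 2) ^+ 2.
  apply: le_trans (PK_le t z1) _; apply: ler_pM.
  - by rewrite mulr_ge0 // subr_ge0 ltW.
  - by rewrite invr_ge0 sqr_ge0.
  - by rewrite ler_pM2l.
  - rewrite lef_pV2 ?posrE ?exprn_gt0 ?divr_gt0 //; last exact: circle_dist_gt0.
    by rewrite lerXn2r ?nnegrE ?cabs_ge0 // divr_ge0 // ltW.
have uu : `|u z - u (polar 1 t)| <= M'.
  apply: le_trans (ler_normB _ _) _; rewrite /M' lerD ?HM //.
  have : `|u z| <= `|u z - u z0| + `|u z0| by rewrite -[X in `|X| <= _](subrK (u z0)) ler_normD.
  clear - uz e0; lra.
have : PK z t * `|u z - u (polar 1 t)| <= 2 * cabs (z - z0) / (d1 / 2) ^+ 2 * M'.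
  by apply: ler_pM.
have : 2 * cabs (z - z0) / (d1 / 2) ^+ 2 * M' <= e / 4.
  have -> : 2 * cabs (z - z0) / (d1 / 2) ^+ 2 * M' =
     cabs (z - z0) * (8 * M' / d1 ^+ 2) by field; rewrite gt_eqF.
  have k0 : 0 < 8 * M' / d1 ^+ 2 by rewrite divr_gt0 ?mulr_gt0 ?exprn_gt0.
  apply: le_trans (ler_wpM2r (ltW k0) (ltW zc)) _.
  by rewrite le_eqVlt; apply/orP; left; apply/eqP; field; rewrite !gt_eqF.
have : 0 <= e / 4 * PK z t by rewrite mulr_ge0 // divr_ge0 // ltW.
clear - e0; lra.
Qed.

(** The excess r ^ 2 over the value at the centre makes perturbations by |z| ^ 2 strictly
    subharmonic. *)
Lemma cmean_sqr_cabs z0 r : 0 < r ->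
  cmean (fun t => cabs (z0 + polar r t) ^+ 2) = cabs z0 ^+ 2 + r ^+ 2.
Proof.
move=> r0.
pose F z := (z0^*)%C * z.
have dF z : cabs (z - z0) < r + 1 -> cdiff F z.
  by move=> _; apply: cdiffM; [exact: cdiff_cst|exact: cdiff_id].
have := @mean_value R F z0 (r + 1) r dF; rewrite r0 ltrDl ltr01 => /(_ isT).
have -> : complex.Re (F z0) = cabs z0 ^+ 2.
  by rewrite /F sqr_cabs; case: (z0) => x y /=; ring.
move=> MV.
have bF : bm (fun t => complex.Re (F (z0 + polar r t))).
  apply: bm_continuous; apply: (@continuous_on_circle R (fun w => complex.Re (F w)) z0 r) => t.
  by apply: cdiff_continuous_Re; apply: dF; rewrite [z0 + _]addrC addrK cabs_polar gtr0_norm // ltrDl.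
have -> : cabs z0 ^+ 2 + r ^+ 2 = 2 * cabs z0 ^+ 2 + (r ^+ 2 - cabs z0 ^+ 2) by ring.
rewrite -{1}MV -cmeanZ // -[X in _ + X]cmean_cst -cmeanD; [|exact: bmZ|exact: bm_cst].
apply: eq_cmean => t _; rewrite /F !sqr_cabs; case: (z0) => x y /=.
have <- : r ^+ 2 * (cos t ^+ 2 + sin t ^+ 2) = r ^+ 2 by rewrite cos2Dsin2 mulr1.
by ring.
Qed.

(** A continuous function with the local sub-mean-value property is dominated by the
    Poisson integral of its boundary values.  The difference, extended by 0, is
    continuous; adding e |z| ^ 2 makes the local inequality strict, which excludes an
    interior maximum. *)
Theorem poisson_majorant u : (forall z, cabs z <= 1 -> {for z, continuous u}) ->
  (forall z, cabs z <= 1 -> 0 <= u z) ->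
  (forall z, cabs z < 1 -> exists2 d, 0 < d & forall r, 0 < r < d ->
     u z <= cmean (fun t => u (z + polar r t))) ->
  forall z, cabs z < 1 -> u z <= PI z (fun t => u (polar 1 t)).
Proof.
move=> cu u0 su z z1.
pose phi t := u (polar 1 t).
have cphi : continuous phi.
  move=> t; apply: (@continuous_comp _ _ _ (polar 1) u); first exact: polar_continuous.
  by apply: cu; rewrite cabs_polar1.
have bphi := bm_continuous cphi.
have phi0 t : 0 <= t <= 2 * pi -> 0 <= phi t by move=> _; apply: u0; rewrite cabs_polar1.
have [M HM] := bphi.2.
pose v w := if cabs w < 1 then u w - PI w phi else 0.
have cv w : cabs w <= 1 -> {for w, continuous v}.
  rewrite le_eqVlt => /predU1P[w1|w1]; apply/ccontinuousP => e e0.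
    have [d d0 Hd] := PI_boundary w1 e0 (cu w ltac:(by rewrite w1)) bphi HM.
    exists d => // y yd; rewrite /v w1 ltxx subr0.
    by case: ifPn => y1; [exact: Hd|rewrite normr0].
  have /ccontinuousP H1 := cu w (ltW w1).
  have /ccontinuousP H2 := PI_continuous w1 bphi.
  have [d1 d10 Hd1] := H1 (e / 2) (divr_gt0 e0 (ltr0n _ 2)).
  have [d2 d20 Hd2] := H2 (e / 2) (divr_gt0 e0 (ltr0n _ 2)).
  exists (Num.min (1 - cabs w) (Num.min d1 d2)).
    by rewrite !lt_min subr_gt0 w1 d10.
  move=> y; rewrite !lt_min => /andP[y1 /andP[yd1 yd2]].
  have yy : cabs y < 1 by have := ler_cabsD (y - w) w; rewrite subrK; lra.
  rewrite /v yy w1; have := Hd1 _ yd1; have := Hd2 _ yd2.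
  by rewrite !ltr_norml => /andP[? ?] /andP[? ?]; apply/andP; split; lra.
suff H e : 0 < e -> v z <= e.
  by rewrite -subr_le0; apply/ler_addgt0Pl => e /H; rewrite /v z1 addr0.
move=> e0.
pose ve w := v w + e * cabs w ^+ 2.
have cve w : cabs w <= 1 -> {for w, continuous ve}.
  move=> w1; apply: (cvgD (cv w w1)).
  by apply: cvgM; [exact: cvg_cst|apply: cvgM; exact: cabs_continuous].
have [m m1 Hm] := closed_disc_max cve.
have ez : v z <= ve z by rewrite lerDl mulr_ge0 ?sqr_ge0 // ltW.
apply: le_trans ez _; apply: le_trans (Hm z (ltW z1)) _.
move: m1; rewrite le_eqVlt => /predU1P[m1|m1].
  by rewrite /ve /v m1 ltxx add0r expr1n mulr1.
exfalso.
have [d d0 Hd] := su m m1.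
pose r := Num.min (d / 2) ((1 - cabs m) / 2).
have r0 : 0 < r by rewrite lt_min !divr_gt0 // subr_gt0.
have rd : r < d.
  by rewrite gt_min; apply/orP; left; rewrite ltr_pdivrMr // ltr_pMr // ltr1n.
have rm : cabs m + r < 1.
  have : r <= (1 - cabs m) / 2 by rewrite ge_min lexx orbT.
  lra.
have in1 t : cabs (m + polar r t) < 1.
  by apply: le_lt_trans (ler_cabsD _ _) _; rewrite cabs_polar gtr0_norm.
have [bP EP] := PI_circle_Tonelli r0 rm bphi phi0.
have bu : bm (fun t => u (m + polar r t)).
  apply: bm_continuous; apply: continuous_on_circle => t.
  by apply: cu; rewrite ltW.
have bc : bm (fun t => cabs (m + polar r t) ^+ 2).
  apply: bmX; apply: bm_continuous; apply: continuous_on_circle => t.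
  exact: cabs_continuous.
have := Hd r; rewrite r0 rd => /(_ isT) U.
have : cmean (fun t => u (m + polar r t) - PI (m + polar r t) phi
     + e * cabs (m + polar r t) ^+ 2) <= cmean (fun=> ve m).
  apply: le_cmean; [|exact: bm_cst|].
    by apply: bmD; [exact: bmB|exact: bmZ].
  move=> t _; have := Hm _ (ltW (in1 t)); by rewrite {1}/ve /v in1.
rewrite cmean_cst cmeanD; [|exact: bmB|exact: bmZ].
rewrite (cmeanB bu bP) EP (cmeanZ _ bc) cmean_sqr_cabs // /ve /v m1.
have : 0 < e * r ^+ 2 by rewrite mulr_gt0 // exprn_gt0.
rewrite mulrDr; lra.
Qed.

Lemma powR_subadditive (x y s : R) : 0 <= x -> 0 <= y -> 0 < s <= 1 ->
  (x + y) `^ s <= x `^ s + y `^ s.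
Proof.
move=> x0 y0 /andP[s0 s1].
have [x00|xn] := eqVneq x 0; first by rewrite x00 add0r lerDr powR_ge0.
have [y00|yn] := eqVneq y 0; first by rewrite y00 addr0 lerDl powR_ge0.
have xp : 0 < x by rewrite lt_neqAle eq_sym xn.
have yp : 0 < y by rewrite lt_neqAle eq_sym yn.
have p : 0 < x + y by rewrite addr_gt0.
have h a : 0 < a -> a <= x + y -> a / (x + y) * (x + y) `^ s <= a `^ s.
  move=> a0 axy.
  have q : 0 < a / (x + y) <= 1 by rewrite divr_gt0 //= ler_pdivrMr // mul1r.
  have -> : a `^ s = (a / (x + y)) `^ s * (x + y) `^ s.
    by rewrite -powRM ?divfK ?gt_eqF // ?(ltW p) // divr_ge0 ?(ltW a0) ?(ltW p).
  by rewrite ler_wpM2r ?powR_ge0 // ger1_powR.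
have := h x xp; have := h y yp.
rewrite lerDl (ltW yp) lerDr (ltW xp) => /(_ isT) h1 /(_ isT) h2.
apply: le_trans (lerD h2 h1); rewrite -mulrDl -mulrDl divff ?mul1r //.
by rewrite gt_eqF.
Qed.

Lemma powR_continuous_ge0 u z (s : R) : 0 < s <= 1 -> (forall w, 0 <= u w) ->
  {for z, continuous u} -> {for z, continuous (fun w => u w `^ s)}.
Proof.
move=> s01 u0 /ccontinuousP cu; apply/ccontinuousP => e e0.
have /andP[s0 s1] := s01.
have [d d0 Hd] := cu (e `^ s^-1) (powR_gt0 _ e0).
exists d => // w /Hd wd.
have key x y : 0 <= x -> 0 <= y -> x `^ s - y `^ s <= `|x - y| `^ s.
  move=> x0 y0; rewrite lerBlDr.
  apply: le_trans (powR_subadditive _ _ s01) => //.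
  apply: ge0_ler_powR; rewrite ?nnegrE ?addr_ge0 // ?(ltW s0) //.
  by rewrite -lerBlDr ler_norm.
have lim : `|u w - u z| `^ s < e.
  have := gt0_ltr_powR s0 _ _ wd; rewrite !nnegrE normr_ge0 powR_ge0 => /(_ isT isT).
  by rewrite -powRrM mulVf ?gt_eqF // powRr1 // ltW.
rewrite ltr_norml; have := key _ _ (u0 w) (u0 z); have := key _ _ (u0 z) (u0 w).
by rewrite [`|u z - _|]distrC => k1 k2; apply/andP; split; lra.
Qed.

(** The local sub-mean-value property also holds at zeros of F, where it is trivial, and
    propagates by the maximum principle. *)
Theorem cabs_powR_le_PI (F : R[i] -> R[i]) (R1 s : R) : 1 < R1 ->
  (forall z, cabs z < R1 -> cdiff F z) -> 0 < s <= 1 ->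
  forall z, cabs z < 1 -> cabs (F z) `^ s <= PI z (fun t => cabs (F (polar 1 t)) `^ s).
Proof.
move=> R11 dF s01; have /andP[s0 s1] := s01.
apply: (@poisson_majorant (fun z => cabs (F z) `^ s)).
- move=> z z1; apply: (powR_continuous_ge0 s01); first by move=> w; exact: cabs_ge0.
  by apply: cdiff_continuous_cabs; apply: dF; apply: le_lt_trans R11.
- by move=> z _; exact: powR_ge0.
- move=> z z1.
  have h : 0 < s / 2 < 1 by apply/andP; split; lra.
  have [|w wz|d d0 Hd] := @cabs_powR_submean R F z (R1 - cabs z) (s / 2) _ _ h.
  + lra.
  + by apply: dF; have := ler_cabsD (w - z) z; rewrite subrK; lra.
  exists d => // r /Hd.
  by have -> : 2 * (s / 2) = s by field.
Qed.

End poisson_majorant.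

(** * Variable exponents and Poisson averages *)

Section log_hoelder.
Variable R : realType.
Implicit Types (p : R[i] -> R) (z w : R[i]) (h : R).

(** The form in which log-Hoelder continuity is used: at scale sqrt h, powers
    h ^ (p z - p w) are bounded. *)
Definition log_scale p (kap C : R) := forall z w h, closed_disc z -> closed_disc w ->
  0 < h <= 1 -> cabs (z - w) ^+ 2 <= kap * h -> `|p z - p w| * ln h^-1 <= C.

(** For small h the distance is at most h ^ (1 / 4), so that its logarithm is comparable to
    that of h; for the other values of h both factors are bounded. *)
Lemma log_holder_scale p (pM kap : R) : log_holder p ->
  (forall z, closed_disc z -> 0 <= p z <= pM) -> 1 <= kap ->
  exists2 C, 0 <= C & log_scale p kap C.
Proof.
move=> [C0 HC0] pb kap1.
have pM0 : 0 <= pM.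
  have [] := andP (pb 0 _); last by move=> /le_trans h /h.
  by rewrite /closed_disc /= cabs0 ler01.
have lk : 0 <= ln kap by rewrite ln_ge0.
exists (4 * `|C0| + pM * (2 * ln kap)); first by rewrite addr_ge0 // !mulr_ge0.
move=> z w h cz cw /andP[h0 h1] zw.
have hV : 0 <= ln h^-1 by rewrite ln_ge0 // invf_ge1.
have A0 : 0 <= 4 * `|C0| by rewrite mulr_ge0.
have B0 : 0 <= pM * (2 * ln kap) by rewrite !mulr_ge0.
have kap0 : 0 < kap by apply: lt_le_trans kap1.
have [kh|kh] := leP (kap ^+ 2 * h) 1; last first.
  apply: (@le_trans _ _ (pM * (2 * ln kap))); last by rewrite lerDr.
  apply: ler_pM => //.
    have /andP[? ?] := pb z cz; have /andP[? ?] := pb w cw.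
    by rewrite ler_norml; apply/andP; split; lra.
  rewrite mulr_natl -lnXn // ler_ln ?posrE ?invr_gt0 ?exprn_gt0 //.
  by rewrite -[leLHS]mul1r ler_pdivrMr // ltW.
have [->|zw0] := eqVneq z w.
  by rewrite subrr normr0 mul0r addr_ge0.
have [->|hn1] := eqVneq h 1; first by rewrite invr1 ln1 mulr0 addr_ge0.
have hl1 : h < 1 by rewrite lt_neqAle hn1.
have d0 : 0 < cabs (z - w) by rewrite cabs_gt0 subr_eq0.
have d4 : cabs (z - w) ^+ 4 <= h.
  rewrite (exprM _ 2 2); apply: (@le_trans _ _ ((kap * h) ^+ 2)).
    by rewrite lerXn2r ?nnegrE ?sqr_ge0 // mulr_ge0 // ltW.
  rewrite exprMn [h ^+ 2]expr2 mulrA -[leRHS]mul1r ler_wpM2r // ltW //.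
have d1 : cabs (z - w) < 1.
  by rewrite -(expr_lt1 (n := 4)) ?cabs_ge0 // (le_lt_trans d4).
have := HC0 z w cz cw; rewrite d0 d1 => /(_ isT) H.
have ld : 0 < ln (cabs (z - w))^-1 by rewrite ln_gt0 // invf_gt1.
have hd : ln h^-1 <= 4 * ln (cabs (z - w))^-1.
  rewrite mulr_natl -lnXn ?invr_gt0 // ler_ln ?posrE ?invr_gt0 ?exprn_gt0 ?invr_gt0 //.
  by rewrite exprVn lef_pV2 // posrE ?exprn_gt0.
apply: (@le_trans _ _ (4 * `|C0|)); last by rewrite lerDl.
apply: le_trans (ler_wpM2l _ hd) _ => //.
rewrite mulrCA ler_pM2l // -ler_pdivlMr //.
by rewrite (le_trans H) // ler_pM2r ?invr_gt0 // ler_norm.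
Qed.

End log_hoelder.

Section averaging.
Variable R : realType.
Implicit Types (z : R[i]) (h k qt : R -> R).

Lemma powR1x (x : R) : 1 `^ x = 1 :> R.
Proof. by rewrite powR1. Qed.

Lemma powR_le_1D (x q : R) : 0 <= x -> 1 <= q -> x <= 1 + x `^ q.
Proof.
move=> x0 q1; have [x1|x1] := leP x 1; first by rewrite (le_trans x1) // lerDl powR_ge0.
by rewrite (le_trans (le1r_powR (ltW x1) q1)) // lerDr.
Qed.

(** Either x <= y, or x / y is below its own power. *)
Lemma powR_le_absorb (x y q : R) : 0 <= x -> 0 < y -> 1 <= q -> x <= y + x `^ q * y `^ (1 - q).
Proof.
move=> x0 y0 q1; have [xy|xy] := leP x y.
  by rewrite (le_trans xy) // lerDl mulr_ge0 ?powR_ge0.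
have xp : 0 < x by apply: lt_trans xy.
have e : (x / y) `^ q = x `^ q * y `^ (- q).
  by rewrite powRM ?invr_ge0 ?(ltW y0) // -powR_inv1 ?(ltW y0) // -powRrM mulN1r.
have h : x / y <= x `^ q * y `^ (- q).
  by rewrite -e le1r_powR // ltW // ltr_pdivlMr // mul1r.
rewrite powRD ?(gt_eqF y0) ?implybT // powRr1 ?(ltW y0) //.
have : x <= x `^ q * (y * y `^ (- q)).
  by rewrite mulrCA mulrC -ler_pdivrMr.
by move=> /le_trans; apply; rewrite lerDr ltW.
Qed.

Lemma powR_Ndiff (y q0 q c : R) : 0 < y -> `|q0 - q| * `|ln y| <= c ->
  y `^ (1 - q) <= expR c * y `^ (1 - q0).
Proof.
move=> y0 H.
have -> : 1 - q = (q0 - q) + (1 - q0) by ring.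
rewrite powRD ?(gt_eqF y0) ?implybT // ler_wpM2r ?powR_ge0 //.
rewrite /powR gt_eqF // ler_expR (le_trans (ler_norm _)) // normrM //.
Qed.

Lemma PK_far z t (c d : R) : cabs z < 1 -> 0 < d -> d <= cabs (polar 1 t - z) ^+ 2 ->
  2 * (1 - cabs z) <= c * d -> PK z t <= c.
Proof.
move=> z1 d0 dD cd; apply: le_trans (PK_le t z1) _.
have D0 : 0 < cabs (polar 1 t - z) ^+ 2 by apply: lt_le_trans dD.
rewrite ler_pdivrMr // (le_trans cd) // ler_wpM2l //.
have : 0 <= c * d by rewrite (le_trans _ cd) // mulr_ge0 // subr_ge0 ltW.
by rewrite pmulr_lge0.
Qed.

(** Where near_ holds, h is compared with k at the level Y; elsewhere the kernel is at most
    c and h <= 1 + k. *)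
Lemma PI_split_bound z h k qt (q0 a b c Y : R) (near_ : pred R) :
  cabs z < 1 -> bm h -> bm k -> 0 < Y ->
  (forall t, 0 <= t <= 2 * pi -> 0 <= h t) ->
  (forall t, 0 <= t <= 2 * pi -> 1 <= qt t) ->
  (forall t, 0 <= t <= 2 * pi -> k t = h t `^ qt t) ->
  0 <= a -> 0 <= b -> 0 <= c ->
  (forall t, 0 <= t <= 2 * pi -> near_ t -> h t <= a * (k t * Y `^ (1 - q0)) + b * Y) ->
  (forall t, 0 <= t <= 2 * pi -> ~~ near_ t -> PK z t <= c) ->
  PI z h <= a * (PI z k * Y `^ (1 - q0)) + b * Y + c * (1 + cmean k).
Proof.
move=> z1 bh bk Y0 h0 q1 kE a0 b0 c0 Hn Hf.
have bPk := bm_PKM z1 bk.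
have bY : bm (fun t => (a * Y `^ (1 - q0)) * (PK z t * k t)) by exact: bmZ.
have bP : bm (fun t => (b * Y) * PK z t) by apply: bmZ; exact: bm_PK.
have bk1 : bm (fun t => 1 + k t) by apply: bmD => //; exact: bm_cst.
have bc : bm (fun t => c * (1 + k t)) by exact: bmZ.
have b12 := bmD bY bP.
have -> : a * (PI z k * Y `^ (1 - q0)) + b * Y + c * (1 + cmean k) =
  cmean (fun t => (a * Y `^ (1 - q0)) * (PK z t * k t) + (b * Y) * PK z t + c * (1 + k t)).
  rewrite (cmeanD b12 bc) (cmeanD bY bP) (cmeanZ _ bPk) (cmeanZ _ (bm_PK z1)) (PK_mass z1).
  rewrite (cmeanZ _ bk1) (cmeanD (bm_cst 1) bk) cmean_cst mulr1 -/(PI z k).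
  by congr (_ + _ + _); rewrite -mulrA [PI z k * _]mulrC.
apply: le_cmean; [exact: bm_PKM|exact: bmD|].
move=> t ht.
have P0 : 0 <= PK z t by rewrite PK_ge0 // ltW.
have k0 : 0 <= k t by rewrite kE // powR_ge0.
have [nt|nt] := boolP (near_ t).
  apply: (@le_trans _ _ (a * Y `^ (1 - q0) * (PK z t * k t) + b * Y * PK z t)).
    apply: le_trans (ler_wpM2l P0 (Hn t ht nt)) _.
    by rewrite le_eqVlt; apply/orP; left; apply/eqP; ring.
  by rewrite lerDl mulr_ge0 // addr_ge0.
apply: (@le_trans _ _ (c * (1 + k t))).
  apply: ler_pM => //; [exact: h0|exact: Hf|].
  by rewrite kE // powR_le_1D ?h0 ?q1.
rewrite lerDr; apply: addr_ge0; last by apply: mulr_ge0 => //; apply: mulr_ge0 => //; exact: ltW.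
by apply: mulr_ge0; apply: mulr_ge0 => //; exact: powR_ge0.
Qed.

(** Jensen's inequality for a variable exponent, up to a constant.  The level Y satisfies Y
    ^ q0 = PI z k + 1.  It is at most a constant over 1 - |z|, so that replacing the
    exponent qt t by q0 near z, where they differ by at most a constant over the logarithm
    of 1 / (1 - |z|), costs a bounded factor. *)
Lemma PI_powR_crude (C Q B : R) : 0 <= C -> 1 <= Q -> 0 <= B ->
  exists2 C', 0 < C' & forall z h qt k (q0 : R),
  cabs z < 1 -> bm h -> bm k ->
  (forall t, 0 <= t <= 2 * pi -> 0 <= h t) ->
  1 <= q0 <= Q -> (forall t, 0 <= t <= 2 * pi -> 1 <= qt t <= Q) ->
  (forall t, 0 <= t <= 2 * pi -> k t = h t `^ qt t) ->
  cmean k <= B ->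
  (forall t, 0 <= t <= 2 * pi -> cabs (polar 1 t - z) ^+ 2 <= 1 - cabs z ->
     `|q0 - qt t| * ln (1 - cabs z)^-1 <= C) ->
  PI z h `^ q0 <= C' * (PI z k + 1).
Proof.
move=> C0 Q1 B0.
have lB : 0 <= ln (2 * B + 1) by rewrite ln_ge0 // lerDr mulr_ge0.
pose al := expR (Q * ln (2 * B + 1) + C).
pose M := al + 1 + 2 * (1 + B).
have M0 : 0 < M by rewrite /M !ltr_pwDr ?addr_ge0 ?mulr_gt0 ?expR_ge0 // ltr_pwDl.
have M1 : 1 <= M.
  have : 0 <= al by exact: expR_ge0.
  by rewrite /M; lra.
exists (M `^ Q); first exact: powR_gt0.
move=> z h qt k q0 z1 bh bk h0 /andP[q01 q0Q] qtb kE kB near_.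
have k0 t : 0 <= t <= 2 * pi -> 0 <= k t by move=> ht; rewrite kE // powR_ge0.
set de := 1 - cabs z in near_ *.
have de0 : 0 < de by rewrite subr_gt0.
have de1 : de <= 1 by rewrite gerBl cabs_ge0.
set T := PI z k.
have T0 : 0 <= T by exact: PI_ge0.
have Tle : T <= 2 * B / de.
  apply: (@le_trans _ _ (2 / de * cmean k)).
    rewrite -cmeanZ //; apply: le_cmean; [exact: bm_PKM|exact: bmZ|].
    by move=> t ht; rewrite ler_wpM2r ?k0 // PK_le_inv.
  by rewrite mulrAC ler_pM2r ?invr_gt0 // ler_pM2l.
have T1 : 0 < T + 1 by rewrite ltr_wpDl.
have q0p : 0 < q0 by apply: lt_le_trans q01.
set Y := (T + 1) `^ q0^-1.
have Y0 : 0 < Y by exact: powR_gt0.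
have Yq : Y `^ q0 = T + 1 by rewrite /Y -powRrM mulVf ?gt_eqF // powRr1 // ltW.
have Y1 : 1 <= Y.
  rewrite -[leLHS](powR1x q0^-1) /Y; apply: ge0_ler_powR; rewrite ?nnegrE ?invr_ge0 ?(ltW q0p) ?(ltW T1) //.
  by rewrite lerDr.
have lnY0 : 0 <= ln Y by rewrite ln_ge0.
have lnY : ln Y <= ln (2 * B + 1) + ln de^-1.
  have YT : Y <= T + 1.
    by rewrite /Y ler1_powR ?lerDr // invf_le1.
  rewrite -lnM ?posrE ?invr_gt0 // ?ltr_wpDl ?mulr_ge0 //.
  rewrite ler_ln ?posrE // ?mulr_gt0 ?invr_gt0 // ?ltr_wpDl ?mulr_ge0 //.
  rewrite (le_trans YT) // mulrDl mul1r lerD //.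
  by rewrite invf_ge1.
have PH : PI z h <= M * Y.
  have := @PI_split_bound z h k qt q0 al 1 2 Y
    (fun t => cabs (polar 1 t - z) ^+ 2 <= de) z1 bh bk Y0 h0.
  have H1 t : 0 <= t <= 2 * pi -> 1 <= qt t by move=> /qtb/andP[].
  move=> /(_ H1 kE (expR_ge0 _) ler01 (ler0n _ _)).
  have Hn t : 0 <= t <= 2 * pi -> cabs (polar 1 t - z) ^+ 2 <= de ->
      h t <= al * (k t * Y `^ (1 - q0)) + 1 * Y.
    move=> ht nt; apply: le_trans (powR_le_absorb (h0 t ht) Y0 (H1 t ht)) _.
    rewrite mul1r addrC lerD2r -kE // mulrCA ler_wpM2l ?k0 //.
    apply: powR_Ndiff => //; rewrite (ger0_norm lnY0).
    have qq : `|q0 - qt t| <= Q.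
      by move: (qtb t ht) => /andP[]; clear - q01 q0Q; move=> ? ?; rewrite ler_norml; apply/andP; split; lra.
    apply: le_trans (ler_wpM2l _ lnY) _ => //; rewrite mulrDr lerD ?near_ //.
    by rewrite ler_wpM2r.
  have Hf t : 0 <= t <= 2 * pi -> ~~ (cabs (polar 1 t - z) ^+ 2 <= de) -> PK z t <= 2.
    by move=> ht; rewrite -ltNge => /ltW far; apply: (@PK_far z t 2 de).
  move=> /(_ Hn Hf) /le_trans; apply.
  have TY : T * Y `^ (1 - q0) <= Y.
    have -> : Y `^ (1 - q0) = Y / (T + 1).
      by rewrite powRD ?(gt_eqF Y0) ?implybT // powRN Yq powRr1 // ltW.
    by rewrite mulrCA ler_piMr ?(ltW Y0) // ler_pdivrMr // mul1r lerDl.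
  have aT : al * (T * Y `^ (1 - q0)) <= al * Y by rewrite ler_wpM2l // expR_ge0.
  have cB : 2 * (1 + cmean k) <= 2 * (1 + B) * Y.
    apply: (@le_trans _ _ (2 * (1 + B))); first by rewrite ler_pM2l // lerD2l.
    by rewrite ler_peMr // mulr_ge0 // addr_ge0.
  have -> : M * Y = al * Y + 1 * Y + 2 * (1 + B) * Y by rewrite /M; ring.
  by apply: lerD => //; apply: lerD.
apply: (@le_trans _ _ ((M * Y) `^ q0)).
  by apply: ge0_ler_powR; rewrite ?nnegrE ?(ltW q0p) ?(PI_ge0 z1 h0) // mulr_ge0 ?(ltW M0) ?(ltW Y0).
rewrite powRM ?(ltW M0) ?(ltW Y0) // Yq ler_wpM2r ?(ltW T1) //.
exact: ler_powR.
Qed.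

(** With almost constant exponents near z, and z close to the circle, Jensen's inequality
    holds up to a small additive error.  The bound K keeps the level Y, now given by Y ^ q0
    = PI z k + eta, in a fixed compact interval, and Young's inequality is an equality at
    the level itself. *)
Lemma PI_powR_sharp (K Q B eta : R) : 0 <= K -> 1 <= Q -> 0 <= B -> 0 < eta < 1 ->
  exists2 om, 0 < om & forall d0, 0 < d0 -> exists2 de0, 0 < de0 &
  forall z h qt k (q0 : R),
  cabs z < 1 -> 1 - cabs z <= de0 -> bm h -> bm k ->
  (forall t, 0 <= t <= 2 * pi -> 0 <= h t) ->
  1 <= q0 <= Q -> (forall t, 0 <= t <= 2 * pi -> 1 <= qt t <= Q) ->
  (forall t, 0 <= t <= 2 * pi -> k t = h t `^ qt t) ->
  cmean k <= B -> PI z k <= K ->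
  (forall t, 0 <= t <= 2 * pi -> cabs (polar 1 t - z) <= d0 -> `|q0 - qt t| <= om) ->
  PI z h `^ q0 <= PI z k + 2 * eta.
Proof.
move=> K0 Q1 B0 /andP[e0 e1].
have Qp : 0 < Q by apply: lt_le_trans Q1.
pose La := ln ((K + 1) / eta).
have Ke : 1 <= (K + 1) / eta by rewrite ler_pdivlMr // mul1r; clear - K0 e1; lra.
have La0 : 0 <= La by rewrite ln_ge0.
pose g := (1 + eta / (K + 1)) `^ Q^-1 - 1.
have K1 : 0 < K + 1 by rewrite ltr_wpDl.
have u1 : 1 < 1 + eta / (K + 1) by rewrite ltrDl divr_gt0.
have g0 : 0 < g.
  rewrite subr_gt0 -[ltLHS](powR1x Q^-1) gt0_ltr_powR ?invr_gt0 ?nnegrE //.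
  by rewrite ltW // (lt_trans _ u1).
have gQ : (1 + g) `^ Q = 1 + eta / (K + 1).
  rewrite /g addrC subrK -powRrM mulVf ?gt_eqF // powRr1 //.
  by rewrite ltW // (lt_trans _ u1).
have lg : 0 < ln (1 + g / 4) by rewrite ln_gt0 // ltrDl divr_gt0.
pose om := Num.min (Num.min 1 (g / 6)) (ln (1 + g / 4) / (La + 1)).
have om0 : 0 < om by rewrite !lt_min ltr01 !divr_gt0 // ltr_wpDl.
have om1 : om <= 1 by rewrite !ge_min lexx.
have omg : om <= g / 6 by rewrite !ge_min lexx orbT.
have oml : om * La <= ln (1 + g / 4).
  have : om <= ln (1 + g / 4) / (La + 1) by rewrite !ge_min lexx !orbT.
  rewrite ler_pdivlMr ?ltr_wpDl // => /(le_trans _); apply.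
  by rewrite ler_pM2l // lerDl.
have th : expR (om * La) <= 1 + g / 4.
  by rewrite -[leRHS]lnK ?ler_expR // posrE ltr_wpDr // divr_ge0 // ltW.
exists om => // d0 d00.
exists (om * eta * d0 ^+ 2 / (2 * (1 + B))).
  by rewrite divr_gt0 ?mulr_gt0 ?exprn_gt0 // ltr_pwDl.
move=> z h qt k q0 z1 zde bh bk h0 /andP[q01 q0Q] qtb kE kB TK near_.
have k0 t : 0 <= t <= 2 * pi -> 0 <= k t by move=> ht; rewrite kE // powR_ge0.
set T := PI z k in TK *.
have T0 : 0 <= T by exact: PI_ge0.
have Te : 0 < T + eta by rewrite ltr_wpDl.
have q0p : 0 < q0 by apply: lt_le_trans q01.
have q0V : 0 < q0^-1 <= 1 by rewrite invr_gt0 q0p /= invf_le1.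
set Y := (T + eta) `^ q0^-1.
have Y0 : 0 < Y by exact: powR_gt0.
have Yq : Y `^ q0 = T + eta by rewrite /Y -powRrM mulVf ?gt_eqF // powRr1 // ltW.
have Ye : eta <= Y.
  have [Te1|Te1] := leP (T + eta) 1.
    by apply: (@le_trans _ _ (T + eta)); rewrite ?lerDr // ger1_powR ?Te //; case/andP: q0V.
  apply: (@le_trans _ _ 1); first exact: ltW.
  by rewrite -[leLHS](powR1x q0^-1) ge0_ler_powR ?nnegrE ?(ltW Te) ?(ltW Te1) // invr_ge0 ltW.
have YK : Y <= K + 1.
  apply: (@le_trans _ _ ((K + 1) `^ q0^-1)).
    apply: ge0_ler_powR; rewrite ?nnegrE ?invr_ge0 ?(ltW q0p) ?(ltW Te) ?(ltW K1) //.
    by rewrite lerD // ltW.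
  by apply: ler1_powR; rewrite ?lerDr //; case/andP: q0V.
have lnY : `|ln Y| <= La.
  rewrite ler_norml -lnV ?posrE ?divr_gt0 // !ler_ln ?posrE ?invr_gt0 ?divr_gt0 //.
  rewrite invf_div; apply/andP; split.
    by rewrite (le_trans _ Ye) // ler_piMr ?(ltW e0) // invf_le1 // lerDr.
  by rewrite (le_trans YK) // ler_peMr ?(ltW K1) // invf_ge1 // ltW.
set a := (q0^-1 + om) * expR (om * La).
set b := 1 - q0^-1 + om.
have ex1 : 1 <= expR (om * La) by rewrite -expR0 ler_expR mulr_ge0 // ltW.
have a0 : 0 <= a by rewrite mulr_ge0 ?expR_ge0 // addr_ge0 ?(ltW om0) // invr_ge0 ltW.
have b0 : 0 <= b by rewrite addr_ge0 ?(ltW om0) // subr_ge0; case/andP: q0V.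
set c := 2 * (1 - cabs z) / d0 ^+ 2.
have d2 : 0 < d0 ^+ 2 by rewrite exprn_gt0.
have c0 : 0 <= c by rewrite mulr_ge0 ?invr_ge0 ?(ltW d2) // mulr_ge0 // subr_ge0 ltW.
have H1 t : 0 <= t <= 2 * pi -> 1 <= qt t by move=> /qtb/andP[].
have PH : PI z h <= (1 + g) * Y.
  have := @PI_split_bound z h k qt q0 a b c Y
    (fun t => cabs (polar 1 t - z) <= d0) z1 bh bk Y0 h0 H1 kE a0 b0 c0.
  have Hn t : 0 <= t <= 2 * pi -> cabs (polar 1 t - z) <= d0 ->
      h t <= a * (k t * Y `^ (1 - q0)) + b * Y.
    move=> ht nt; have qq := near_ t ht nt.
    have qtp : 0 < qt t by apply: lt_le_trans (H1 t ht).
    have qtV : `|(qt t)^-1 - q0^-1| <= om.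
      have -> : (qt t)^-1 - q0^-1 = (q0 - qt t) / (qt t * q0) by field; rewrite !gt_eqF.
      rewrite normrM; apply: (@le_trans _ _ (om * 1)); last by rewrite mulr1.
      have m1 : 1 <= qt t * q0 by rewrite -[leLHS]mulr1 ler_pM // H1.
      apply: ler_pM => //; rewrite ger0_norm ?invr_ge0 ?(le_trans _ m1) //.
      by rewrite invf_le1 // (lt_le_trans _ m1).
    apply: le_trans (powR_young (h0 t ht) Y0 (H1 t ht)) _.
    have hh : (qt t)^-1 <= q0^-1 + om by move: qtV; rewrite ler_norml => /andP[]; clear; lra.
    have hg : 1 - (qt t)^-1 <= b by move: qtV; rewrite ler_norml /b => /andP[]; clear; lra.
    apply: lerD; last by rewrite ler_pM2r.
    rewrite -kE // /a -mulrA; apply: ler_pM => //.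
    + by rewrite invr_ge0 ltW.
    + by rewrite mulr_ge0 ?k0 ?powR_ge0.
    rewrite mulrCA ler_wpM2l ?k0 //; apply: powR_Ndiff => //.
    by apply: ler_pM.
  have Hf t : 0 <= t <= 2 * pi -> ~~ (cabs (polar 1 t - z) <= d0) -> PK z t <= c.
    move=> ht; rewrite -ltNge => /ltW far; apply: (@PK_far z t c (d0 ^+ 2)) => //.
      by rewrite lerXn2r ?nnegrE ?cabs_ge0 // ltW.
    by rewrite /c divfK // gt_eqF.
  move=> /(_ Hn Hf) /le_trans; apply.
  have TY : T * Y `^ (1 - q0) <= Y.
    have -> : Y `^ (1 - q0) = Y / (T + eta).
      by rewrite powRD ?(gt_eqF Y0) ?implybT // powRN Yq powRr1 // ltW.
    by rewrite mulrCA ler_piMr ?(ltW Y0) // ler_pdivrMr // mul1r lerDl ltW.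
  have aT : a * (T * Y `^ (1 - q0)) <= a * Y by rewrite ler_wpM2l.
  have cB : c * (1 + cmean k) <= om * Y.
    have Bp : 0 < 1 + B by rewrite ltr_pwDl.
    apply: (@le_trans _ _ (c * (1 + B))); first by rewrite ler_wpM2l // lerD2l.
    apply: (@le_trans _ _ (om * eta)); last by rewrite ler_pM2l.
    have zd : (1 - cabs z) * (2 * (1 + B)) <= om * eta * d0 ^+ 2.
      by rewrite -ler_pdivlMr // mulr_gt0.
    rewrite /c mulrAC ler_pdivrMr //; apply: le_trans zd.
    by rewrite le_eqVlt; apply/orP; left; apply/eqP; ring.
  have ab : a + b + om <= 1 + g.
    have : (q0^-1 + om) * (expR (om * La) - 1) <= 2 * (g / 4).
      have /andP[_ q0V1] := q0V.
      apply: ler_pM; rewrite ?subr_ge0 ?addr_ge0 ?(ltW om0) ?invr_ge0 ?(ltW q0p) //.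
        by clear - q0V1 om1; lra.
      by clear - th; lra.
    by rewrite /a /b mulrBr mulr1; clear - omg g0; lra.
  apply: (@le_trans _ _ ((a + b + om) * Y)); last by rewrite ler_pM2r.
  have -> : (a + b + om) * Y = a * Y + b * Y + om * Y by ring.
  by apply: lerD => //; apply: lerD.
have g1 : 1 <= 1 + g by rewrite lerDl ltW.
apply: (@le_trans _ _ (((1 + g) * Y) `^ q0)).
  apply: ge0_ler_powR; rewrite ?nnegrE ?(ltW q0p) ?(PI_ge0 z1 h0) //.
  by rewrite mulr_ge0 ?(ltW Y0) // (le_trans _ g1).
rewrite powRM ?(le_trans _ g1) ?(ltW Y0) // Yq.
apply: (@le_trans _ _ ((1 + eta / (K + 1)) * (T + eta))).
  by rewrite -gQ ler_wpM2r ?(ltW Te) // ler_powR.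
have : eta / (K + 1) * (T + eta) <= eta.
  by rewrite mulrAC ler_pdivrMr // ler_pM2l // lerD // ltW.
rewrite mulrDl mul1r; clear - T0 e0; lra.
Qed.

End averaging.

(** * Pointwise domination of the variable power of a holomorphic function *)

Section measurable_variable_power.
Context d (T : measurableType d) (R : realType).

Lemma measurable_fun_powR2 (D : set T) (f g : T -> R) : measurable D ->
  measurable_fun D f -> measurable_fun D g -> (forall x, D x -> g x != 0) ->
  measurable_fun D (fun x => f x `^ g x).
Proof.
move=> mD mf mg g0.
apply: (eq_measurable_fun (fun x => if f x == 0 then 0 else expR (g x * ln (f x)))).
  by move=> x; rewrite inE => /g0 gx; rewrite /powR (negbTE gx).
apply: measurable_fun_if => //.
- by apply: measurable_fun_eqr => //; exact: measurable_cst.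
- apply: (@measurable_funS _ _ _ _ D) => //.
  apply: (measurableT_comp (@measurable_expR R)); apply: measurable_funM => //.
  exact: (measurableT_comp (@measurable_ln R)).
Qed.

End measurable_variable_power.

Section variable_exponent.
Variable R : realType.
Variables (p : R[i] -> R) (pm pM : R).
Hypothesis pm_gt0 : 0 < pm.
Hypothesis p_bounded : forall z, closed_disc z -> pm <= p z <= pM.
Hypothesis p_lh : log_holder p.
Implicit Types (z w : R[i]) (f : R[i] -> R[i]) (r t : R).

(** With half of the exponent the modular of f becomes a squared L^2 norm, for which the
    parallelogram identity holds. *)
Definition W f z := cabs (f z) `^ (p z / 2).

Lemma p_gt0 z : cabs z <= 1 -> 0 < p z.
Proof. by move=> z1; have /andP[h _] := p_bounded z1; apply: lt_le_trans h. Qed.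

Lemma W_ge0 f z : 0 <= W f z.
Proof. exact: powR_ge0. Qed.

Lemma sqr_W f z : W f z ^+ 2 = cabs (f z) `^ p z.
Proof. by rewrite /W -powR_mulrn ?powR_ge0 // -powRrM mulfVK. Qed.

Lemma p_scale kap : 1 <= kap -> exists2 C, 0 <= C & log_scale p kap C.
Proof.
apply: (log_holder_scale (pM := pM) p_lh) => z /p_bounded/andP[h ->].
by rewrite andbT (le_trans _ h) // ltW.
Qed.

Lemma p_uniform e : 0 < e -> exists2 d, 0 < d & forall z w, closed_disc z -> closed_disc w ->
  cabs (z - w) <= d -> `|p z - p w| <= e.
Proof.
move=> e0; have [C C0 HC] := p_scale (lexx 1).
have c0 : 0 < (C + 1) / e by rewrite divr_gt0 // ltr_wpDl.
pose d := expR (- ((C + 1) / e)).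
have d0 : 0 < d by exact: expR_gt0.
exists (Num.sqrt d); first by rewrite sqrtr_gt0.
move=> z w cz cw zw.
have d1 : 0 < d <= 1 by rewrite d0 /= -expR0 ler_expR oppr_le0 ltW.
have := HC z w d cz cw d1; rewrite mul1r => H.
have {}H : `|p z - p w| * ln d^-1 <= C.
  by apply: H; rewrite -(sqr_sqrtr (ltW d0)) lerXn2r ?nnegrE ?cabs_ge0 ?sqrtr_ge0.
rewrite lnV ?posrE // expRK opprK in H.
have : `|p z - p w| * ((C + 1) / e) <= e * ((C + 1) / e).
  by apply: (le_trans H); rewrite mulrCA divff ?gt_eqF // mulr1 lerDl.
by rewrite ler_pM2r.
Qed.

Lemma p_circle_continuous r : 0 <= r <= 1 -> continuous (fun t => p (polar r t)).
Proof.
move=> /andP[r0 r1] t; apply/(@cvgrPdist_le _ _ _ (nbhs t)) => e e0.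
have [d d0 Hd] := p_uniform e0.
have c s : closed_disc (polar r s) by rewrite /closed_disc /= cabs_polar ger0_norm.
have := @polar_continuous R r t.
move=> /(@cvgrPdist_lt _ _ _ (nbhs t)) /(_ d%:C); rewrite ltcR => /(_ d0).
apply: filterS => s; rewrite normc_cabs ltcR => /ltW h.
exact: Hd.
Qed.

Lemma hol_circle_continuous f r : (forall z, cabs z < 1 -> cdiff f z) -> 0 <= r < 1 ->
  continuous (fun t => cabs (f (polar r t))).
Proof.
move=> df /andP[r0 r1] t.
apply: (@continuous_comp _ _ _ (polar r) (fun w => cabs (f w))).
  exact: polar_continuous.
by apply: cdiff_continuous_cabs; apply: df; rewrite cabs_polar ger0_norm.
Qed.

Lemma measurable_circle_power f (g : R -> R) r :
  (forall z, cabs z < 1 -> cdiff f z) -> 0 <= r < 1 -> continuous g -> (forall t, g t != 0) ->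
  measurable_fun (`[0, (2 * pi)%R] : set (measurableTypeR R))
    (fun t => cabs (f (polar r t)) `^ g t).
Proof.
move=> df r01 cg g0.
have S (u : R -> R) : continuous u ->
    measurable_fun (`[0, (2 * pi)%R] : set (measurableTypeR R)) u.
  by move=> cu; apply: measurable_funS (continuous_measurable_fun cu) => //; exact: measurableT.
apply: measurable_fun_powR2 => //; apply: S => //.
exact: hol_circle_continuous.
Qed.

Lemma bm_W f r : (forall z, cabs z < 1 -> cdiff f z) -> 0 <= r < 1 ->
  bm (fun t => W f (polar r t)).
Proof.
move=> df /andP[r0 r1].
have c s : closed_disc (polar r s) by rewrite /closed_disc /= cabs_polar ger0_norm // ltW.
have cp : continuous (fun t => p (polar r t) / 2).
  move=> t; apply: cvgM; last exact: cvg_cst.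
  by apply: p_circle_continuous; rewrite r0 ltW.
apply: bm_powR.
- by move=> t _; exact: cabs_ge0.
- apply: measurable_circle_power => //; first by rewrite r0.
  by move=> t; rewrite gt_eqF // divr_gt0 // p_gt0 //; exact: c.
- by apply: bm_continuous; apply: hol_circle_continuous; rewrite ?r0.
- exists (pM / 2) => t _; have /andP[h1 h2] := p_bounded (c t).
  have h0 : 0 <= p (polar r t) by apply: le_trans h1; exact: ltW.
  apply/andP; split; first by rewrite divr_ge0.
  by apply: ler_wpM2r => //; rewrite invr_ge0.
Qed.

(** The exponent sexp <= 1 is small enough for W f to be a power, with the variable exponent
    qexp >= 1, of |f| ^ sexp. *)
Definition sexp := Num.min 1 (pm / 2).
Definition qexp z := p z / (2 * sexp).

Lemma sexp01 : 0 < sexp <= 1.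
Proof. by rewrite lt_min ltr01 divr_gt0 //= ge_min lexx. Qed.

Lemma sexp_gt0 : 0 < sexp. Proof. by have /andP[] := sexp01. Qed.

Lemma W_qexp f z : W f z = (cabs (f z) `^ sexp) `^ qexp z.
Proof.
rewrite -powRrM /W; congr (_ `^ _); rewrite /qexp; field.
by rewrite gt_eqF // sexp_gt0.
Qed.

Lemma qexp_bounded z : closed_disc z -> 1 <= qexp z <= pM / (2 * sexp).
Proof.
have s0 := sexp_gt0; have s2 : 0 < 2 * sexp by rewrite mulr_gt0.
move=> /p_bounded/andP[h1 h2].
rewrite /qexp ler_pdivlMr // mul1r ler_pM2r ?invr_gt0 // h2 andbT.
have : sexp <= pm / 2 by rewrite ge_min lexx orbT.
lra.
Qed.

Lemma qexp_dist z w : `|qexp z - qexp w| = `|p z - p w| / (2 * sexp).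
Proof.
have s0 := sexp_gt0.
by rewrite /qexp -mulrBl normrM [`|(_)^-1|]ger0_norm // invr_ge0 ltW // mulr_gt0.
Qed.

Lemma qexp_Q : 1 <= pM / (2 * sexp).
Proof.
have /andP[h1 h2] : 1 <= qexp 0 <= pM / (2 * sexp).
  by apply: qexp_bounded; rewrite /closed_disc /= cabs0 ler01.
exact: le_trans h2.
Qed.

(** The dilation of f by r is holomorphic on a neighbourhood of the closed disc. *)
Lemma dilation_majorant f r z : (forall z, cabs z < 1 -> cdiff f z) -> 0 < r < 1 ->
  cabs z < 1 -> cabs (f (r%:C * z)) `^ sexp <=
    PI z (fun t => cabs (f (polar r t)) `^ sexp).
Proof.
move=> df /andP[r0 r1] z1.
have H := @cabs_powR_le_PI R (fun w => f (r%:C * w)) r^-1 sexp.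
have -> : (fun t => cabs (f (polar r t)) `^ sexp) =
   (fun t => cabs (f (r%:C * polar 1 t)) `^ sexp) by apply/funext => t; rewrite -polarE.
apply: H => //; [by rewrite invf_gt1| |exact: sexp01].
move=> w wr; apply: (@cdiff_comp R f (fun w => r%:C * w)).
  by apply: cdiffM; [exact: cdiff_cst|exact: cdiff_id].
apply: df; rewrite cabsM cabs_real gtr0_norm //.
by rewrite -(mulVf (lt0r_neq0 r0)) mulrC ltr_pM2r.
Qed.

Lemma bm_base f r : (forall z, cabs z < 1 -> cdiff f z) -> 0 <= r < 1 ->
  bm (fun t => cabs (f (polar r t)) `^ sexp).
Proof.
move=> df r01; apply: bm_powR_cst; first exact: ltW sexp_gt0.
  by move=> t _; exact: cabs_ge0.
by apply: bm_continuous; exact: hol_circle_continuous.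
Qed.

Lemma cmean_W_le f r B : (forall z, cabs z < 1 -> cdiff f z) -> 0 <= r < 1 ->
  cmean (fun t => W f (polar r t) ^+ 2) <= B -> cmean (fun t => W f (polar r t)) <= 1 + B.
Proof.
move=> df r01 H; have bW := bm_W df r01.
apply: (@le_trans _ _ (cmean (fun t => 1 + W f (polar r t) ^+ 2))); last first.
  by rewrite cmeanD ?cmean_cst ?lerD2l //; [exact: bm_cst|exact: bmX].
apply: le_cmean => //; first by apply: bmD; [exact: bm_cst|exact: bmX].
move=> t _; have := W_ge0 f (polar r t); have := sqr_ge0 (W f (polar r t) - 1).
by rewrite sqrrB expr1n mulr1; lra.
Qed.

(** The analogue of subharmonicity for a variable exponent: Jensen's inequality applied to
    the Poisson majorant of |f| ^ sexp.  The constant depends on f only through the bound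
    for the modular. *)
Lemma W_le_PI_dilated B : 0 <= B -> exists2 C, 0 < C & forall f r z,
  (forall z, cabs z < 1 -> cdiff f z) -> 0 < r < 1 ->
  cmean (fun t => W f (polar r t) ^+ 2) <= B -> cabs z < 1 ->
  W f (r%:C * z) <= C * (PI z (fun t => W f (polar r t)) + 1).
Proof.
move=> B0.
have [C C0 HC] := p_scale (lexx 1).
have s0 := sexp_gt0; have s2 : 0 < 2 * sexp by rewrite mulr_gt0.
have [C' C'0 HC'] := @PI_powR_crude R (C / (2 * sexp)) (pM / (2 * sexp)) (1 + B)
   (divr_ge0 C0 (ltW s2)) qexp_Q (addr_ge0 ler01 B0).
exists C' => // f r z df r01 HB z1.
have /andP[r0 r1] := r01.
have r01' : 0 <= r < 1 by rewrite ltW.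
have cr t : closed_disc (polar r t) by rewrite /closed_disc /= cabs_polar gtr0_norm // ltW.
have crz : closed_disc (r%:C * z).
  by rewrite /closed_disc /= cabsM cabs_real gtr0_norm // mulr_ile1 ?cabs_ge0 ?ltW.
rewrite W_qexp.
apply: (@le_trans _ _ (PI z (fun t => cabs (f (polar r t)) `^ sexp) `^ qexp (r%:C * z))).
  have qz := qexp_bounded crz.
  apply: ge0_ler_powR; rewrite ?nnegrE ?powR_ge0 //.
  - by apply: le_trans ler01 _; case/andP: qz.
  - by apply: PI_ge0 => // t _; exact: powR_ge0.
  - exact: dilation_majorant.
apply: (HC' z _ (fun t => qexp (polar r t))) => //.
- exact: bm_base.
- exact: bm_W.
- by move=> t _; exact: powR_ge0.
- exact: qexp_bounded.
- by move=> t _; exact: qexp_bounded.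
- by move=> t _; exact: W_qexp.
- exact: cmean_W_le.
move=> t _ near_; rewrite qexp_dist mulrAC ler_pM2r ?invr_gt0 //.
apply: HC => //; first by rewrite subr_gt0 z1 gerBl cabs_ge0.
rewrite mul1r; apply: le_trans near_.
rewrite cabs_distrC (polarE r) -mulrBr cabsM cabs_real gtr0_norm // exprMn.
by rewrite ler_piMl ?sqr_ge0 // expr_le1 ?ltW.
Qed.

(** Passing from z to z / r moves the point by at most half of its distance to the circle. *)
Lemma PK_dilate r z t : 0 < r < 1 -> 1 - r <= (1 - cabs z) / 2 ->
  PK ((r^-1)%:C * z) t <= 4 * PK z t /\ cabs ((r^-1)%:C * z) < 1.
Proof.
move=> /andP[r0 r1] rz; set x := _ * z.
have z0 := cabs_ge0 z.
have rV : 1 < r^-1 by rewrite invf_gt1.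
have xE : cabs x = cabs z / r by rewrite cabsM cabs_real gtr0_norm ?invr_gt0 // mulrC.
have zr : cabs z < r by lra.
have x1 : cabs x < 1 by rewrite xE ltr_pdivrMr // mul1r.
have z1 : cabs z < 1 by lra.
split => //.
have zx : cabs z <= cabs x by rewrite xE ler_peMr // ltW.
have xr : 1 - r <= 1 - cabs x.
  have : cabs x * r = cabs z by rewrite xE divfK // gt_eqF.
  have : cabs x * (1 - r) <= 1 - r by rewrite ler_piMl ?subr_ge0 // ltW.
  lra.
have xz : cabs (x - z) <= 1 - r.
  have -> : x - z = (1 - r)%:C * x.
    rewrite rmorphB rmorph1 mulrBl mul1r /x mulrA -rmorphM /= divff ?gt_eqF //.
    by rewrite rmorph1 mul1r.
  rewrite cabsM cabs_real ger0_norm ?subr_ge0 ?(ltW r1) //.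
  by rewrite ler_piMr ?subr_ge0 ?(ltW r1) ?(ltW x1).
have D1 := circle_dist_gt0 t x1; have D2 := circle_dist_gt0 t z1.
have Dz : cabs (polar 1 t - z) <= 2 * cabs (polar 1 t - x).
  have := ler_cabs_triangle x (polar 1 t) z; have := circle_dist_ge x t; lra.
rewrite /PK mulrA ler_pdivlMr ?exprn_gt0 // mulrAC ler_pdivrMr ?exprn_gt0 //.
have -> : 4 * (1 - cabs z ^+ 2) * cabs (polar 1 t - x) ^+ 2 =
  (1 - cabs z ^+ 2) * (2 * cabs (polar 1 t - x)) ^+ 2 by ring.
apply: ler_pM; rewrite ?sqr_ge0 // ?subr_ge0 ?expr_le1 ?cabs_ge0 ?(ltW x1) //.
  by rewrite lerD2l lerN2 lerXn2r ?nnegrE ?cabs_ge0.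
by rewrite lerXn2r ?nnegrE ?mulr_ge0 ?cabs_ge0.
Qed.

Lemma W_le_PI B : 0 <= B -> exists2 C, 0 < C & forall f r z,
  (forall z, cabs z < 1 -> cdiff f z) -> 0 < r < 1 ->
  cmean (fun t => W f (polar r t) ^+ 2) <= B -> 1 - r <= (1 - cabs z) / 2 ->
  W f z <= C * (PI z (fun t => W f (polar r t)) + 1).
Proof.
move=> B0; have [C C0 HC] := W_le_PI_dilated B0.
exists (4 * C); first by rewrite mulr_gt0.
move=> f r z df r01 HB rz; have /andP[r0 r1] := r01.
have [_ x1] := PK_dilate 0 r01 rz.
have z1 : cabs z < 1 by lra.
have := HC f r _ df r01 HB x1.
rewrite mulrA -rmorphM /= divff ?gt_eqF // rmorph1 mul1r => /le_trans; apply.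
set X := PI z _.
have -> : 4 * C * (X + 1) = C * (4 * X + 4) by ring.
rewrite ler_pM2l // lerD //; last by rewrite ler1n.
rewrite /X.
have bW : bm (fun t => W f (polar r t)) by apply: bm_W; rewrite ?r1 ?ltW.
rewrite /PI -cmeanZ; last exact: bm_PKM.
apply: le_cmean; [exact: bm_PKM|by apply: bmZ; exact: bm_PKM|].
move=> t _; rewrite mulrA ler_wpM2r ?W_ge0 //.
by have [] := PK_dilate t r01 rz.
Qed.

End variable_exponent.

(** * Uniform integrability and almost monotone modulars *)

Section uniform_integrability.
Variable R : realType.
Variables (p : R[i] -> R) (pm pM : R).
Hypothesis pm_gt0 : 0 < pm.
Hypothesis p_bounded : forall z, closed_disc z -> pm <= p z <= pM.
Hypothesis p_lh : log_holder p.
Implicit Types (z w : R[i]) (f : R[i] -> R[i]) (r t : R).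

(** The functions v with W f <= C (PI v + 1) on the disc of radius r form convex sets, which
    decrease in r and contain elements of L^2 norm bounded independently of r.  By the
    parallelogram identity, elements of almost minimal norm are close to one another, so
    that one bounded function serves for all r up to an error small in L^2. *)
Lemma W_uniformly_integrable f B : (forall z, cabs z < 1 -> cdiff f z) -> 0 <= B ->
  (forall r, 0 < r < 1 -> cmean (fun t => W p f (polar r t) ^+ 2) <= B) ->
  forall e, 0 < e -> exists M r0 : R, [/\ 0 <= M, 0 < r0 < 1 & forall r, r0 <= r < 1 ->
    exists g, [/\ bm g, cmean (fun t => g t ^+ 2) <= e &
      forall t, 0 <= t <= 2 * pi -> 0 <= g t /\ W p f (polar r t) <= M + g t]].
Proof.
move=> df B0 HB e e0.
have [C C0 HC] := W_le_PI pm_gt0 p_bounded p_lh B0.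
pose V (r : R) (v : R -> R) := [/\ bm v, (forall t, 0 <= t <= 2 * pi -> 0 <= v t) &
  forall z, cabs z <= r -> W p f z <= C * (PI z v + 1)].
have Vle r r' v : r' <= r -> V r v -> V r' v.
  by move=> rr [bv v0 Hv]; split => // z zr; apply: Hv; exact: le_trans rr.
pose S (r : R) : set R := [set x | exists2 v, V r v & x = cmean (fun t => v t ^+ 2)].
have S0 r : lbound (S r) 0.
  by move=> _ [v _ ->]; apply: cmean_ge0 => t _; exact: sqr_ge0.
have SB r : 2^-1 <= r < 1 -> exists2 x, S r x & x <= B.
  move=> /andP[r2 r1]; pose s := (1 + r) / 2.
  have s01 : 0 < s < 1 by rewrite /s; apply/andP; split; lra.
  have /andP[s0 s1] := s01.
  exists (cmean (fun t => W p f (polar s t) ^+ 2)); last exact: HB.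
  exists (fun t => W p f (polar s t)) => //; split.
  - by apply: (bm_W pm_gt0 p_bounded p_lh) => //; rewrite ltW.
  - by move=> t _; exact: W_ge0.
  - by move=> z zr; apply: HC => //; [exact: HB|rewrite /s; lra].
have Sinf r : 2^-1 <= r < 1 -> has_inf (S r).
  by move=> /SB[x Sx _]; split; [exists x|exists 0].
pose D : set R := [set inf (S r) | r in [set r | 2^-1 <= r < 1]].
have Dsup : has_sup D.
  split; first by exists (inf (S 2^-1)), 2^-1 => //=; rewrite lexx invf_lt1 ?ltr1n.
  exists B => _ [r /= hr <-]; have [x Sx xB] := SB r hr.
  by rewrite (le_trans _ xB) //; apply: ge_inf => //; exists 0.
pose e' := e / (8 * (C ^+ 2)).
have e'0 : 0 < e' by rewrite divr_gt0 // mulr_gt0 // exprn_gt0.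
have [_ [r0 /= r0h <-] Dr0] := sup_adherent e'0 Dsup.
have [_ [v0 Vv0 ->] v0e] := inf_adherent e'0 (Sinf r0 r0h).
have le_sup r : 2^-1 <= r < 1 -> inf (S r) <= sup D.
  by move=> hr; apply: ub_le_sup; [exact: Dsup.2|exists r].
have [bv0 v00 Hv0] := Vv0.
have [N HN] := bv0.2.
have N0 : 0 <= N by apply: le_trans (HN 0 _); rewrite ?lexx ?pi20.
have/andP[r02 r01] := r0h.
exists (C * (N + 1)), r0; split.
- by rewrite mulr_ge0 ?addr_ge0 // ltW.
- by rewrite r01 andbT (lt_le_trans _ r02) // invr_gt0.
move=> r /andP[r0r r1].
have rh : 2^-1 <= r < 1 by rewrite r1 (le_trans r02).
have [_ [v Vv ->] ve] := inf_adherent e'0 (Sinf r rh).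
have [bv vp Hv] := Vv.
have rp : 0 < r < 1 by rewrite r1 (lt_le_trans _ (le_trans r02 r0r)) // invr_gt0.
pose mid t := 2^-1 * (v t + v0 t).
have bmid : bm mid by apply: bmZ; exact: bmD.
have Vmid : V r0 mid.
  split => // [t ht|z zr]; first by rewrite mulr_ge0 ?invr_ge0 // addr_ge0 ?vp ?v00.
  have z1 : cabs z < 1 by apply: le_lt_trans zr r01.
  rewrite PI_Z //; last exact: bmD.
  rewrite PI_D //.
  have h1 := Hv0 z zr; have h2 := Hv z (le_trans zr r0r).
  have -> : C * (2^-1 * (PI z v + PI z v0) + 1) =
    2^-1 * (C * (PI z v + 1) + C * (PI z v0 + 1)) by field.
  clear - pm_gt0 p_bounded p_lh h1 h2; lra.
have midge : sup D - e' < cmean (fun t => mid t ^+ 2).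
  apply: lt_le_trans Dr0 _; apply: ge_inf; first by exists 0.
  by exists mid.
have bdiff : bm (fun t => v t - v0 t) by exact: bmB.
have bad : bm (fun t => `|v t - v0 t|) by exact: bm_norm.
have small : cmean (fun t => (v t - v0 t) ^+ 2) <= 8 * e'.
  have -> : cmean (fun t => (v t - v0 t) ^+ 2) =
    cmean (fun t => 2 * v t ^+ 2 + 2 * v0 t ^+ 2 - 4 * mid t ^+ 2).
    by apply: eq_cmean => t _; rewrite /mid; field.
  have b1 : bm (fun t => 2 * v t ^+ 2) by apply: bmZ; exact: bmX.
  have b2 : bm (fun t => 2 * v0 t ^+ 2) by apply: bmZ; exact: bmX.
  have b3 : bm (fun t => 4 * mid t ^+ 2) by apply: bmZ; exact: bmX.
  rewrite (cmeanB (bmD b1 b2) b3) (cmeanD b1 b2) (cmeanZ _ (bmX 2 bv)).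
  rewrite (cmeanZ _ (bmX 2 bv0)) (cmeanZ _ (bmX 2 bmid)).
  have := le_sup r rh; have := le_sup r0 r0h; clear - pm_gt0 p_bounded p_lh ve v0e midge; lra.
have [bP cP] := PI_contraction rp bad.
exists (fun t => C * PI (polar r t) (fun t => `|v t - v0 t|)); split.
- exact: bmZ.
- have -> : cmean (fun t => (C * PI (polar r t) (fun t => `|v t - v0 t|)) ^+ 2) =
    C ^+ 2 * cmean (fun t => PI (polar r t) (fun t => `|v t - v0 t|) ^+ 2).
    by rewrite -(cmeanZ _ (bmX 2 bP)); apply: eq_cmean => t _; rewrite exprMn.
  have C2 : 0 < C ^+ 2 by rewrite exprn_gt0.
  have -> : e = C ^+ 2 * (8 * e') by rewrite /e'; field; rewrite gt_eqF.
  rewrite ler_pM2l // (le_trans cP) //.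
  by under eq_cmean => t _ do rewrite real_normK ?num_real //.
move=> t _.
have z1 : cabs (polar r t) < 1 by rewrite cabs_polar gtr0_norm //; case/andP: rp.
split; first by rewrite mulr_ge0 ?(ltW C0) //; apply: PI_ge0.
have zr : cabs (polar r t) <= r by rewrite cabs_polar gtr0_norm //; case/andP: rp.
apply: le_trans (Hv _ zr) _; rewrite -mulrDr ler_pM2l // addrAC lerD2r.
rewrite -[X in X + _](PI_cst N z1) -PI_D //; last exact: bm_cst.
apply: le_PI => //; first by apply: bmD => //; exact: bm_cst.
move=> s hs; have := HN s hs; rewrite (ger0_norm (v00 s hs)).
have := ler_norm (v s - v0 s); clear - pm_gt0 p_bounded p_lh; lra.
Qed.

Lemma sqr_le_split (x a b th : R) : 0 < th -> 0 <= x -> x <= a + b ->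
  x ^+ 2 <= (1 + th) * a ^+ 2 + (1 + th^-1) * b ^+ 2.
Proof.
move=> th0 x0 xab.
apply: (@le_trans _ _ ((a + b) ^+ 2)).
  by rewrite lerXn2r ?nnegrE // (le_trans x0).
have : 0 <= th * (a - th^-1 * b) ^+ 2 by rewrite mulr_ge0 ?sqr_ge0 // ltW.
have -> : th * (a - th^-1 * b) ^+ 2 = th * a ^+ 2 - 2 * a * b + th^-1 * b ^+ 2.
  by field; rewrite gt_eqF.
rewrite sqrrD mulr2n; lra.
Qed.

(** Close to the circle the exponent is nearly constant on the arc that matters, so that the
    sharp form of Jensen's inequality applies; the bound K makes its error uniform. *)
Lemma W_le_dilated_PI f B K eta : (forall z, cabs z < 1 -> cdiff f z) -> 0 <= B ->
  (forall r, 0 < r < 1 -> cmean (fun t => W p f (polar r t) ^+ 2) <= B) ->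
  0 <= K -> 0 < eta < 1 ->
  exists2 de, 0 < de & forall r s t, 0 < r -> 1 - de <= r -> r < s < 1 ->
    PI (polar (r / s) t) (fun t => W p f (polar s t)) <= K ->
    W p f (polar r t) <= PI (polar (r / s) t) (fun t => W p f (polar s t)) + 2 * eta.
Proof.
move=> df B0 HB K0 eta1.
have s0 := sexp_gt0 pm_gt0; have s2 : 0 < 2 * sexp pm by rewrite mulr_gt0.
have [om om0 Hom] := @PI_powR_sharp R K (pM / (2 * sexp pm)) (1 + B) eta K0
  (qexp_Q pm_gt0 p_bounded) (addr_ge0 ler01 B0) eta1.
have [d0 d00 Hd0] := p_uniform pm_gt0 p_bounded p_lh (mulr_gt0 om0 s2).
have [de0 de00 Hde] := Hom d0 d00.
exists de0 => // r s t r0 rde /andP[rs s1] TK.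
have rr1 : r < 1 by apply: lt_trans s1.
have s0' : 0 < s by apply: lt_trans rs.
have s01 : 0 < s < 1 by rewrite s0'.
have s01' : 0 <= s < 1 by rewrite ltW.
have bWs := bm_W pm_gt0 p_bounded p_lh df s01'.
pose q := r / s; rewrite -/q in TK *.
have q0 : 0 < q by rewrite divr_gt0.
have q1 : q < 1 by rewrite ltr_pdivrMr // mul1r.
have cs u : closed_disc (polar s u) by rewrite /closed_disc /= cabs_polar gtr0_norm // ltW.
have cr u : closed_disc (polar r u) by rewrite /closed_disc /= cabs_polar gtr0_norm // ltW.
have sq u : polar r u = s%:C * polar q u.
  have -> : r = s * q by rewrite /q mulrC divfK // gt_eqF.
  by rewrite (polarE (s * q)) (polarE q) mulrA -rmorphM.
have z1 : cabs (polar q t) < 1 by rewrite cabs_polar gtr0_norm.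
rewrite (@W_qexp R p pm pm_gt0 f (polar r t)).
apply: (@le_trans _ _ (PI (polar q t)
   (fun t => cabs (f (polar s t)) `^ sexp pm) `^ qexp p pm (polar r t))).
  have qz := qexp_bounded pm_gt0 p_bounded (cr t).
  apply: ge0_ler_powR; rewrite ?nnegrE ?powR_ge0 //.
  - by apply: le_trans ler01 _; case/andP: qz.
  - by apply: PI_ge0 => // u _; exact: powR_ge0.
  - by rewrite sq; exact: dilation_majorant.
apply: (Hde (polar q t) _ (fun t => qexp p pm (polar s t))) => //.
- rewrite cabs_polar gtr0_norm //.
  have : r <= q by rewrite /q ler_pdivlMr // ler_piMr // ltW.
  lra.
- exact: bm_base.
- by move=> u _; exact: powR_ge0.
- exact: (qexp_bounded pm_gt0 p_bounded).
- by move=> u _; exact: (qexp_bounded pm_gt0 p_bounded).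
- by move=> u _; exact: W_qexp.
- apply: (cmean_W_le pm_gt0 p_bounded p_lh) => //; exact: HB.
move=> u _ near_; rewrite (@qexp_dist R p pm pm_gt0) ler_pdivrMr //.
apply: Hd0 => //; rewrite sq (polarE s) -mulrBr cabsM cabs_real gtr0_norm //.
by apply: le_trans near_; rewrite cabs_distrC ler_piMl ?cabs_ge0 // ltW.
Qed.

(** Let T be the Poisson integral of W f on the circle of radius s.  Where T > K, uniform
    integrability bounds W f by a small multiple of T plus a function g that is small in
    L^2; elsewhere the sharp comparison gives W f <= T + 2 eta.  As Poisson averaging
    contracts L^2, the modular at r is at most the one at s up to a small error. *)
Lemma modular_almost_nondecreasing f B : (forall z, cabs z < 1 -> cdiff f z) -> 0 <= B ->
  (forall r, 0 < r < 1 -> cmean (fun t => W p f (polar r t) ^+ 2) <= B) ->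
  forall e, 0 < e -> exists2 r0, 0 < r0 < 1 & forall r s, r0 <= r -> r < s < 1 ->
    cmean (fun t => W p f (polar r t) ^+ 2) <= cmean (fun t => W p f (polar s t) ^+ 2) + e.
Proof.
move=> df B0 HB e e0.
have B1 : 0 < B + 1 by rewrite ltr_wpDl.
pose th := Num.min 1 (e / (14 * (B + 1))).
have th0 : 0 < th by rewrite lt_min ltr01 divr_gt0 // mulr_gt0.
have th1 : th <= 1 by rewrite ge_min lexx.
have the : th * (14 * (B + 1)) <= e.
  by rewrite -ler_pdivlMr ?mulr_gt0 // ge_min lexx orbT.
pose tV := 1 + th^-1.
have tV0 : 0 < tV by rewrite /tV ltr_pwDl // invr_ge0 ltW.
have eg0 : 0 < e / (8 * tV) by rewrite divr_gt0 // mulr_gt0.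
have [M [r1 [M0 r1h HM]]] := W_uniformly_integrable df B0 HB eg0.
pose K := (M + 1) / th.
have K0 : 0 < K by rewrite divr_gt0 // ltr_wpDl.
(* K is so large that M <= th * T wherever T > K *)
have MK : M / K <= th by rewrite ler_pdivrMr // /K mulrC divfK ?gt_eqF // lerDl.
pose eta := Num.min (2^-1) (e / (32 * tV)).
have eta0 : 0 < eta by rewrite lt_min invr_gt0 ltr0n /= divr_gt0 // mulr_gt0.
have eta1 : 0 < eta < 1.
  by rewrite eta0 /= gt_min; apply/orP; left; rewrite invf_lt1 ?ltr1n.
have etae : eta * (32 * tV) <= e.
  by rewrite -ler_pdivlMr ?mulr_gt0 // ge_min lexx orbT.
have [de0 de00 Hde] := W_le_dilated_PI df B0 HB (ltW K0) eta1.
pose r0 := Num.max r1 (1 - Num.min (2^-1) de0).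
have/andP[r10 r11] := r1h.
have m0 : 0 < Num.min (2^-1) de0 by rewrite lt_min de00 invr_gt0 ltr0n.
exists r0; first by rewrite lt_max r10 /= gt_max r11 /= ltrBlDr ltrDl.
move=> r s; rewrite ge_max => /andP[r1r rde] /andP[rs s1].
have rr1 : r < 1 by apply: lt_trans s1.
have r0' : 0 < r by apply: lt_le_trans r1r.
have s0' : 0 < s by apply: lt_trans rs.
have s01 : 0 < s < 1 by rewrite s0'.
have s01' : 0 <= s < 1 by rewrite ltW.
have rh : r1 <= r < 1 by rewrite r1r.
have [g [bg ge gH]] := HM r rh.
pose q := r / s.
have q0 : 0 < q by rewrite divr_gt0.
have q1 : q < 1 by rewrite ltr_pdivrMr // mul1r.
have qh : 0 < q < 1 by rewrite q0.
have bWs := bm_W pm_gt0 p_bounded p_lh df s01'.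
have r01' : 0 <= r < 1 by rewrite ltW.
have bWr := bm_W pm_gt0 p_bounded p_lh df r01'.
have [bT cT] := PI_contraction qh bWs.
set T := fun t => PI (polar q t) (fun t => W p f (polar s t)) in bT cT.
have T0 t : 0 <= T t.
  apply: PI_ge0; first by rewrite cabs_polar gtr0_norm.
  by move=> u _; exact: W_ge0.
have main t : 0 <= t <= 2 * pi ->
    W p f (polar r t) <= (1 + th) * T t + (2 * eta + g t).
  move=> ht; have [g0 gM] := gH t ht.
  have [TK|TK] := leP (T t) K; last first.
    have : M <= th * T t.
      apply: (@le_trans _ _ (M / K * T t)); last by rewrite ler_wpM2r.
      by rewrite mulrAC ler_pdivlMr // ler_wpM2l // ltW.
    have := T0 t; clear - pm_gt0 p_bounded p_lh g0 gM eta0; lra.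
  have W1 : W p f (polar r t) <= T t + 2 * eta.
    apply: Hde => //; last by rewrite rs.
    by apply: le_trans rde; rewrite lerD2l lerN2 ge_min lexx orbT.
  have := T0 t; have : 0 <= th * T t by rewrite mulr_ge0 // ltW.
  clear - pm_gt0 p_bounded p_lh W1 g0; lra.
have bT2 : bm (fun t => T t ^+ 2) by exact: bmX.
have bh : bm (fun t => 2 * eta + g t) by apply: bmD => //; exact: bm_cst.
have bh2 : bm (fun t => (2 * eta + g t) ^+ 2) by exact: bmX.
set I := cmean (fun t => W p f (polar s t) ^+ 2).
have IB : I <= B by exact: HB.
have I0 : 0 <= I by apply: cmean_ge0 => t _; exact: sqr_ge0.
have bg2 := bmX 2 bg.
have c2 : cmean (fun t => (2 * eta + g t) ^+ 2) <= 8 * eta + 2 * (e / (8 * tV)).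
  apply: (@le_trans _ _ (cmean (fun t => 8 * eta + 2 * g t ^+ 2))).
    apply: le_cmean => //; first by apply: bmD; [exact: bm_cst|exact: bmZ].
    move=> t _.
    have : 0 <= (2 * eta - g t) ^+ 2 by exact: sqr_ge0.
    have : eta ^+ 2 <= eta by rewrite expr2 ler_piMl ?(ltW eta0) //; case/andP: eta1 => _ /ltW.
    rewrite sqrrB sqrrD !mulr2n exprMn; clear - pm_gt0 p_bounded p_lh; lra.
  rewrite cmeanD ?cmean_cst ?cmeanZ ?lerD2l ?ler_pM2l //; first exact: bm_cst.
  exact: bmZ.
apply: (@le_trans _ _ (cmean (fun t => ((1 + th) * (1 + th) ^+ 2) * T t ^+ 2
    + tV * (2 * eta + g t) ^+ 2))).
  apply: le_cmean; [exact: bmX|by apply: bmD; exact: bmZ|].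
  move=> t ht; apply: le_trans (sqr_le_split th0 (W_ge0 _ _ _) (main t ht)) _.
  by rewrite exprMn mulrA.
rewrite cmeanD; [|exact: bmZ|exact: bmZ].
rewrite !cmeanZ //.
have h1 : (1 + th) * (1 + th) ^+ 2 <= 1 + 7 * th.
  have h2 : th ^+ 2 <= th by rewrite expr2 ler_piMl // ltW.
  have h3 : th ^+ 3 <= th ^+ 2 by rewrite exprS ler_piMl // sqr_ge0.
  have -> : (1 + th) * (1 + th) ^+ 2 = 1 + 3 * th + 3 * th ^+ 2 + th ^+ 3 by ring.
  clear - pm_gt0 p_bounded p_lh h2 h3; lra.
have k0 : 0 <= (1 + th) * (1 + th) ^+ 2 by rewrite mulr_ge0 ?sqr_ge0 // addr_ge0 // ltW.
have A1 : (1 + th) * (1 + th) ^+ 2 * cmean (fun t => T t ^+ 2) <= (1 + 7 * th) * I.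
  by apply: ler_pM => //; apply: cmean_ge0 => t _; exact: sqr_ge0.
have A2 : 7 * th * I <= e / 2.
  apply: (@le_trans _ _ (7 * th * (B + 1))); last by clear - pm_gt0 p_bounded p_lh the; lra.
  by rewrite ler_wpM2l ?mulr_ge0 ?(ltW th0) // (le_trans IB) // lerDl.
have A3 : tV * cmean (fun t => (2 * eta + g t) ^+ 2) <= e / 2.
  apply: le_trans (ler_wpM2l (ltW tV0) c2) _.
  have -> : tV * (8 * eta + 2 * (e / (8 * tV))) = (eta * (32 * tV)) / 4 + e / 4.
    by field; rewrite gt_eqF.
  clear - pm_gt0 p_bounded p_lh etae; lra.
rewrite mulrDl mul1r in A1; clear - pm_gt0 p_bounded p_lh A1 A2 A3; lra.
Qed.

End uniform_integrability.

(** * Existence of the limit of the circle norms *)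

Section circle_norms.
Variable R : realType.
Variables (p : R[i] -> R) (pm pM : R).
Hypothesis pm_gt0 : 0 < pm.
Hypothesis p_bounded : forall z, closed_disc z -> pm <= p z <= pM.
Hypothesis p_lh : log_holder p.
Implicit Types (z w : R[i]) (f : R[i] -> R[i]) (r t l : R).

Lemma powRV (x q : R) : 0 <= x -> x^-1 `^ q = (x `^ q)^-1.
Proof. by move=> x0; rewrite -powR_inv1 // -powRrM mulN1r powRN. Qed.

Definition modular f l r := cmean (fun t => (cabs (f (polar r t)) / l) `^ p (polar r t)).

Lemma cabs_div f l z : 0 < l -> cabs (f z) / l = cabs ((l^-1)%:C * f z).
Proof. by move=> l0; rewrite cabsM cabs_real gtr0_norm ?invr_gt0 // mulrC. Qed.

Lemma cdiff_scaled f l z : cdiff f z -> cdiff (fun w => (l^-1)%:C * f w) z.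
Proof. by move=> df; apply: cdiffM => //; exact: cdiff_cst. Qed.

Lemma modularE f l r : 0 < l ->
  modular f l r = cmean (fun t => W p (fun z => (l^-1)%:C * f z) (polar r t) ^+ 2).
Proof.
by move=> l0; apply: eq_cmean => t _; rewrite sqr_W -(cabs_div f) .
Qed.

Lemma closed_disc_polar r t : 0 <= r < 1 -> closed_disc (polar r t).
Proof. by move=> /andP[r0 r1]; rewrite /closed_disc /= cabs_polar ger0_norm // ltW. Qed.

Lemma bm_modular f l r : (forall z, cabs z < 1 -> cdiff f z) -> 0 < l -> 0 <= r < 1 ->
  bm (fun t => (cabs (f (polar r t)) / l) `^ p (polar r t)).
Proof.
move=> df l0 r01.
have df' z : cabs z < 1 -> cdiff (fun w => (l^-1)%:C * f w) z.
  by move=> /df; exact: cdiff_scaled.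
have := bmX 2 (bm_W pm_gt0 p_bounded p_lh df' r01).
by under eq_fun do rewrite sqr_W -(cabs_div f) //.
Qed.

Lemma modular_ge0 f l r : 0 <= modular f l r.
Proof. by apply: cmean_ge0 => t _; exact: powR_ge0. Qed.

Lemma circle_integralE F : bm F -> (((2 * pi)^-1)%:E *
  \int[@lebesgue_measure R]_(t in `[0%R, (2 * pi)%R]) (F t)%:E)%E = (cmean F)%:E.
Proof.
move=> bF; rewrite /cmean /seg_integral /Rintegral EFinM fineK //.
apply: integrable_fin_num => //=; exact: bm_integrable.
Qed.

Lemma circle_norm_le f l r : (forall z, cabs z < 1 -> cdiff f z) -> 0 <= r < 1 ->
  0 < l -> modular f l r < 1 -> (circle_norm p r f <= l%:E)%E.
Proof.
move=> df r01 l0 Hl; apply: ereal_inf_lbound; exists l => //; split => //.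
by rewrite circle_integralE ?lte_fin //; exact: bm_modular.
Qed.

Lemma circle_norm_ge0 f r : (0 <= circle_norm p r f)%E.
Proof. by apply: le_ereal_inf_tmp => _ [l [l0 _] <-]; rewrite lee_fin ltW. Qed.

Lemma powR_rescale (x l l' : R) z : closed_disc z -> 0 <= x -> 0 < l <= l' ->
  (x / l') `^ p z <= (l / l') `^ pm * (x / l) `^ p z.
Proof.
move=> cz x0 /andP[l0 ll]; have l'0 : 0 < l' by apply: lt_le_trans ll.
have -> : x / l' = l / l' * (x / l) by field; rewrite !gt_eqF.
rewrite powRM ?divr_ge0 ?(ltW l0) ?(ltW l'0) // ler_wpM2r ?powR_ge0 //.
have /andP[h _] := p_bounded cz.
by apply: ger_powR => //; rewrite divr_gt0 //= ler_pdivrMr // mul1r.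
Qed.

Lemma modular_rescale f l l' r : (forall z, cabs z < 1 -> cdiff f z) -> 0 <= r < 1 ->
  0 < l <= l' -> modular f l' r <= (l / l') `^ pm * modular f l r.
Proof.
move=> df r01 ll; have/andP[l0 ll'] := ll.
have bl := bm_modular df l0 r01.
rewrite /modular -cmeanZ //; apply: le_cmean => //; last first.
  by move=> t _; apply: powR_rescale; rewrite ?cabs_ge0 //; exact: closed_disc_polar.
- exact: bmZ.
- by apply: bm_modular => //; apply: lt_le_trans ll'.
Qed.

Lemma modular_decreasing f l l' r : (forall z, cabs z < 1 -> cdiff f z) -> 0 <= r < 1 ->
  0 < l <= l' -> modular f l' r <= modular f l r.
Proof.
move=> df r01 ll; have/andP[l0 ll'] := ll.
have l'0 : 0 < l' by apply: lt_le_trans ll'.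
apply: le_trans (modular_rescale df r01 ll) _.
rewrite ler_piMl ?modular_ge0 // -(powR1x pm).
apply: ge0_ler_powR; rewrite ?nnegrE ?(ltW pm_gt0) ?divr_ge0 ?(ltW l0) ?(ltW l'0) //.
by rewrite ler_pdivrMr // mul1r.
Qed.

Lemma modular_lt1 f l r : (forall z, cabs z < 1 -> cdiff f z) -> 0 <= r < 1 ->
  (circle_norm p r f < l%:E)%E -> 0 < l /\ modular f l r < 1.
Proof.
move=> df r01 /ereal_inf_lt[_ [l' [l'0 Hl'] <-]]; rewrite lte_fin => l'l.
split; first exact: lt_trans l'l.
have : 0 < l' <= l by rewrite l'0 ltW.
move=> /(modular_decreasing df r01)/le_lt_trans; apply.
by move: Hl'; rewrite circle_integralE ?lte_fin //; exact: bm_modular.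
Qed.

Lemma modular_bound f l l' r : (forall z, cabs z < 1 -> cdiff f z) -> 0 <= r < 1 ->
  0 < l -> 0 < l' -> modular f l r <= (1 + l' / l) `^ pM * modular f l' r.
Proof.
move=> df r01 l0 l'0.
have bl := bm_modular df l0 r01; have bl' := bm_modular df l'0 r01.
rewrite /modular -cmeanZ //; apply: le_cmean => //; first exact: bmZ.
move=> t _; have cz := closed_disc_polar t r01; have/andP[p1 p2] := p_bounded cz.
have d0 : 0 <= l' / l by rewrite divr_ge0 // ltW.
have -> : cabs (f (polar r t)) / l = l' / l * (cabs (f (polar r t)) / l').
  by field; rewrite !gt_eqF.
rewrite powRM // ?divr_ge0 ?cabs_ge0 ?(ltW l'0) // ler_wpM2r ?powR_ge0 //.
apply: (@le_trans _ _ ((1 + l' / l) `^ p (polar r t))).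
  apply: ge0_ler_powR; rewrite ?nnegrE ?addr_ge0 ?lerDr //.
  by rewrite (le_trans _ p1) // ltW.
by apply: ler_powR => //; rewrite lerDl.
Qed.

(** The modular of f / l is below 1 on the larger circle, hence almost below 1 on the
    smaller one.  Enlarging l by e absorbs the error. *)
Lemma circle_norm_almost_nondecreasing f S l e :
  (forall z, cabs z < 1 -> cdiff f z) ->
  (forall r, 0 < r < 1 -> (circle_norm p r f < S%:E)%E) -> 0 < l -> 0 < e ->
  exists2 r0, 0 < r0 < 1 & forall r s, r0 <= r -> r < s < 1 ->
    (circle_norm p s f < l%:E)%E -> (circle_norm p r f <= (l + e)%:E)%E.
Proof.
move=> df HS l0 e0.
have S0 : 0 < S.
  have h : 0 < (2^-1 : R) < 1 by rewrite invr_gt0 ltr0n invf_lt1 ?ltr1n.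
  by rewrite -lte_fin (le_lt_trans _ (HS _ h)) // circle_norm_ge0.
pose B := (1 + S / l) `^ pM.
have B0 : 0 <= B by exact: powR_ge0.
have df' z : cabs z < 1 -> cdiff (fun w => (l^-1)%:C * f w) z.
  by move=> /df; exact: cdiff_scaled.
have HB r : 0 < r < 1 ->
    cmean (fun t => W p (fun z => (l^-1)%:C * f z) (polar r t) ^+ 2) <= B.
  move=> r01; rewrite -modularE //.
  have r01' : 0 <= r < 1 by case/andP: r01 => /ltW -> ->.
  have [_ /ltW h] := modular_lt1 df r01' (HS r r01).
  by rewrite (le_trans (modular_bound df r01' l0 S0)) // ler_piMr.
pose c := ((l + e) / l) `^ pm.
have le0 : 0 < l + e by rewrite addr_gt0.
have c1 : 1 < c.
  rewrite /c -[ltLHS](powR1x pm); apply: gt0_ltr_powR; rewrite ?nnegrE ?divr_ge0 ?(ltW l0) ?(ltW le0) //.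
  by rewrite ltr_pdivlMr // mul1r ltrDl.
have c10 : 0 < c - 1 by rewrite subr_gt0.
have [r0 r01 Hr] := modular_almost_nondecreasing pm_gt0 p_bounded p_lh df' B0 HB c10.
exists r0 => // r s r0r /andP[rs s1] Ns.
have/andP[r00 _] := r01.
have rp : 0 < r by apply: lt_le_trans r0r.
have rh : 0 <= r < 1 by rewrite (ltW rp) (lt_trans rs).
have sh : 0 <= s < 1 by rewrite s1 (ltW (lt_trans rp rs)).
have [_ As] := modular_lt1 df sh Ns.
apply: (circle_norm_le df rh (addr_gt0 l0 e0)).
apply: le_lt_trans (modular_rescale df rh _) _.
  by apply/andP; split; [exact: l0|rewrite lerDl ltW].
have Ar : modular f l r < c.
  have rs1 : r < s < 1 by rewrite rs.
  have := Hr r s r0r rs1; rewrite -(modularE f r l0) -(modularE f s l0) => h.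
  by apply: le_lt_trans h _; rewrite -ltrBrDr subKr.
have -> : (l / (l + e)) `^ pm = c^-1.
  by rewrite /c -[l / (l + e)]invf_div powRV // divr_ge0 ?(ltW le0) ?(ltW l0).
by rewrite mulrC ltr_pdivrMr ?mul1r // (lt_trans ltr01).
Qed.

(** The limit is the inferior limit: values close to it recur on arbitrarily large circles. *)
Lemma circle_norm_cvg f : hardy p f ->
  exists2 L : R, 0 <= L & circle_norm p r f @[r --> (1%R : R)^'-] --> L%:E.
Proof.
move=> [hf supf].
have df z : cabs z < 1 -> cdiff f z by move=> z1; apply: derivable_cdiff; exact: hf.
set A := ereal_sup _ in supf.
have NA r : 0 <= r < 1 -> (circle_norm p r f <= A)%E.
  by move=> r01; apply: ereal_sup_ubound; exists r.
have A0 : (0 <= A)%E.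
  by rewrite (le_trans (circle_norm_ge0 f 0)) // NA // lexx ltr01.
have Afin : A \is a fin_num by rewrite ge0_fin_numE.
pose S := fine A + 1.
have HS r : 0 <= r < 1 -> (circle_norm p r f < S%:E)%E.
  by move=> /NA/le_lt_trans; apply; rewrite -(fineK Afin) lte_fin ltrDl.
have HS' r : 0 < r < 1 -> (circle_norm p r f < S%:E)%E.
  by case/andP => /ltW r0 r1; apply: HS; rewrite r0.
have Nfin r : 0 <= r < 1 -> circle_norm p r f \is a fin_num.
  move=> r01; rewrite ge0_fin_numE ?circle_norm_ge0 //.
  by rewrite (lt_trans (HS r r01)) // ltry.
pose E : set R := [set l | 0 < l /\ forall r, r < 1 ->
  exists2 s, r < s < 1 & (circle_norm p s f < l%:E)%E].
have S0 : 0 < S by rewrite ltr_wpDl // fine_ge0.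
have ES : E S.
  split => // r r1; exists ((1 + Num.max 0 r) / 2).
    have : r <= Num.max 0 r by rewrite le_max lexx orbT.
    have : Num.max 0 r < 1 by rewrite gt_max ltr01.
    by move=> ? ?; apply/andP; split; lra.
  apply: HS'; have : 0 <= Num.max 0 r by rewrite le_max lexx.
  have : Num.max 0 r < 1 by rewrite gt_max ltr01.
  by move=> ? ?; apply/andP; split; lra.
have Einf : has_inf E by split; [exists S|exists 0 => l [/ltW]].
pose L := inf E.
have L0 : 0 <= L by apply: lb_le_inf; [exists S|move=> l [/ltW]].
exists L => //.
apply/fine_cvgP; split.
  near=> r; apply: Nfin.
  by apply/andP; split; near: r; [exact: nbhs_left_ge|exact: nbhs_left_lt].
apply/cvgrPdist_le => e e0.
have e20 : 0 < e / 2 by rewrite divr_gt0.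
have [l [l0 El] lL] := inf_adherent e20 Einf; rewrite -/L in lL.
have [r0 /andP[r00 r01] Hr] := circle_norm_almost_nondecreasing df HS' l0 e20.
have upper r : r0 <= r -> r < 1 -> fine (circle_norm p r f) <= L + e.
  move=> rr r1; have rh : 0 <= r < 1 by rewrite r1 (ltW (lt_le_trans r00 rr)).
  have [s /andP[rs s1] Ns] := El r r1.
  have := Hr r s rr; rewrite rs s1 => /(_ isT Ns).
  rewrite -[X in (X <= _)%E](fineK (Nfin r rh)) lee_fin; clear - pm_gt0 p_bounded p_lh lL; lra.
have [r1 r11 lower] : exists2 r1 : R, r1 < 1 &
    forall r, r1 < r -> 0 <= r < 1 -> L - e <= fine (circle_norm p r f).
  have [Le|Le] := leP (L - e) 0.
    exists 0 => // r _ rh; apply: le_trans Le _.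
    by rewrite fine_ge0 // circle_norm_ge0.
  have nE : ~ E (L - e).
    by move=> HE; have := ge_inf Einf.2 HE; rewrite -/L; clear - pm_gt0 p_bounded p_lh e0; lra.
  apply: contrapT => H; apply: nE; split => // r rlt1.
  apply: contrapT => H'; apply: H; exists r => // s rs sh.
  rewrite leNgt; apply/negP => Hs; apply: H'; exists s; first by rewrite rs; case/andP: sh.
  by rewrite -(fineK (Nfin s sh)) lte_fin.
near=> r.
have rlt1 : r < 1 by near: r; exact: nbhs_left_lt.
have rge : r0 <= r by near: r; exact: nbhs_left_ge.
have rgt : r1 < r by near: r; exact: nbhs_left_gt.
have rh : 0 <= r < 1 by rewrite rlt1 (ltW (lt_le_trans r00 rge)).
have := upper r rge rlt1; have := lower r rgt rh.
by clear - pm_gt0 p_bounded p_lh; move=> ? ?; rewrite /= ler_distl; apply/andP; split; lra.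
Unshelve. all: by end_near.
Qed.

End circle_norms.

(** * Arcs where Poisson integrals are large *)

Section arcs.
Variable R : realType.
Implicit Types (z w : R[i]) (k : R -> R) (r s t : R).

Lemma bm_sum (I : Type) (l : seq I) (F : I -> R -> R) : (forall i, bm (F i)) ->
  bm (fun t => \sum_(i <- l) F i t).
Proof.
move=> bF; elim: l => [|i l IH].
  by under eq_fun do rewrite big_nil; exact: bm_cst.
by under eq_fun do rewrite big_cons; exact: bmD.
Qed.

Lemma cmean_sum (I : Type) (l : seq I) (F : I -> R -> R) : (forall i, bm (F i)) ->
  cmean (fun t => \sum_(i <- l) F i t) = \sum_(i <- l) cmean (F i).
Proof.
move=> bF; elim: l => [|i l IH].
  by rewrite big_nil; under eq_cmean => t _ do rewrite big_nil; rewrite cmean_cst.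
rewrite big_cons -IH -cmeanD //; last exact: bm_sum.
by apply: eq_cmean => t _; rewrite big_cons.
Qed.

Definition near_arc z s : set (measurableTypeR R) := [set t | cabs (polar 1 t - z) < s].

Lemma bm_arc z s : bm (\1_(near_arc z s)).
Proof.
apply: bm_indic.
have c : continuous (fun t => cabs (polar 1 t - z)).
  have : continuous (fun t => cabs (0 + polar 1 t - z)).
    apply: (@continuous_on_circle R (fun w => cabs (w - z)) 0 1) => t.
    exact: (cdiff_continuous_cabs (cdiffB (cdiff_id _) (cdiff_cst z _))).
  by under eq_fun do rewrite add0r.
have m := continuous_measurable_fun c.
rewrite /near_arc -[X in measurable X]setTI.
have -> : [set t | cabs (polar 1 t - z) < s] = (fun t => cabs (polar 1 t - z)) @^-1` `]-oo, s[.
  by apply/seteqP; split => t /=; rewrite in_itv.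
by apply: m => //; exact: measurable_itv.
Qed.

Lemma indic_ge0 (T : Type) (A : set T) x : 0 <= \1_A x :> R.
Proof. by rewrite indicE ler0n. Qed.

(** For s < 1, on the arc the Poisson kernel of the point at distance s from the circle on
    the same radius as z is at least 1 / (4 s), and its mean is 1. *)
Lemma arc_mean z s : cabs z < 1 -> 1 - cabs z <= s -> cmean (\1_(near_arc z s)) <= 4 * s.
Proof.
move=> z1 zs; have z0 := cabs_ge0 z.
have s0 : 0 < s by lra.
have [s1|s1] := leP 1 s.
  apply: (@le_trans _ _ 1); last by lra.
  rewrite -[leRHS](@cmean_cst R); apply: le_cmean; [exact: bm_arc|exact: bm_cst|].
  by move=> t _; rewrite indicE lern1 leq_b1.
have [tau [ztau _ _]] := polar_arg z.
pose y := polar (1 - s) tau.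
have y1 : cabs y < 1 by rewrite cabs_polar ger0_norm; lra.
have yz : cabs (z - y) <= s.
  have -> : z - y = polar (cabs z - (1 - s)) tau.
    by rewrite {1}ztau /y; apply/eqP; rewrite eq_complex /=; apply/andP; split; apply/eqP; ring.
  by rewrite cabs_polar ger0_norm; lra.
rewrite -[leRHS]mulr1 -[X in _ * X](PK_mass y1) -cmeanZ; last exact: bm_PK.
apply: le_cmean; [exact: bm_arc|by apply: bmZ; exact: bm_PK|].
move=> t _; rewrite indicE; have [|_] := boolP (t \in _); last first.
  by rewrite mulr_ge0 ?PK_ge0 ?(ltW y1) //; lra.
rewrite inE /near_arc /= => ts.
have ty0 := circle_dist_gt0 t y1.
have ty : cabs (polar 1 t - y) <= 2 * s.
  by apply: le_trans (ler_cabs_triangle z _ _) _; rewrite cabs_distrC in yz *; lra.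
rewrite /PK mulrA ler_pdivlMr ?exprn_gt0 // mul1r.
have -> : cabs y = 1 - s by rewrite cabs_polar ger0_norm; lra.
apply: (@le_trans _ _ ((2 * s) ^+ 2)); first by rewrite lerXn2r ?nnegrE ?(ltW ty0) //; lra.
have : 0 <= s * s * (1 - s) by rewrite !mulr_ge0 //; clear - s0 s1; lra.
have -> : 4 * s * (1 - (1 - s) ^+ 2) = (2 * s) ^+ 2 + 4 * (s * s * (1 - s)) by ring.
lra.
Qed.

(** Dyadic decomposition of the circle according to the distance to z. *)
Lemma PK_le_arcs z t J : cabs z < 1 -> cabs (polar 1 t - z) < 2 ^+ J * (1 - cabs z) ->
  PK z t <= \sum_(j < J) 8 / (4 ^+ j.+1 * (1 - cabs z)) * \1_(near_arc z (2 ^+ j.+1 * (1 - cabs z))) t.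
Proof.
move=> z1; set d := 1 - cabs z; have d0 : 0 < d by rewrite subr_gt0.
have k0 j : 0 < 4 ^+ j * d by rewrite mulr_gt0 // exprn_gt0.
elim: J => [|J IH].
  by rewrite expr0 mul1r ltNge circle_dist_ge.
rewrite big_ord_recr /= => DJ; have [D|D] := ltP (cabs (polar 1 t - z)) (2 ^+ J * d).
  apply: le_trans (IH D) _; rewrite lerDl mulr_ge0 ?indic_ge0 //.
  by rewrite divr_ge0 // ltW.
apply: ler_wpDl.
  by apply: sumr_ge0 => j _; rewrite mulr_ge0 ?indic_ge0 // divr_ge0 // ltW.
rewrite indicE mem_set // mulr1; apply: le_trans (PK_le t z1) _.
rewrite -/d ler_pdivrMr ?exprn_gt0 ?circle_dist_gt0 //.
rewrite mulrAC ler_pdivlMr //.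
have : (2 ^+ J * d) ^+ 2 <= cabs (polar 1 t - z) ^+ 2.
  by rewrite lerXn2r ?nnegrE ?cabs_ge0 // mulr_ge0 ?exprn_ge0 // ltW.
have -> : 4 ^+ J.+1 = 4 * (2 ^+ J) ^+ 2 :> R by rewrite exprS exprAC; congr (_ * _ ^+ _); ring.
have -> : 2 * d * (4 * (2 ^+ J) ^+ 2 * d) = 8 * (2 ^+ J * d) ^+ 2 by ring.
by rewrite ler_pM2l.
Qed.

(** Otherwise the dyadic bounds for the kernel, whose coefficients form a geometric series,
    would sum up to at most lam. *)
Lemma PI_large_arc z k lam : cabs z < 1 -> bm k -> (forall t, 0 <= t <= 2 * pi -> 0 <= k t) ->
  0 <= lam -> lam < PI z k ->
  exists2 s, 1 - cabs z <= s & lam * s / 8 < cmean (fun t => \1_(near_arc z s) t * k t).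
Proof.
move=> z1 bk k0 lam0 lamPI; set d := 1 - cabs z; have d0 : 0 < d by rewrite subr_gt0.
apply: contrapT => H.
have small s : d <= s -> cmean (fun t => \1_(near_arc z s) t * k t) <= lam * s / 8.
  by move=> ds; rewrite leNgt; apply/negP => ?; apply: H; exists s.
have [J HJ] : exists J, forall t, cabs (polar 1 t - z) < 2 ^+ J * d.
  have [J HJ] : exists J, 2 / d < 2 ^+ J.
    exists (Num.bound (2 / d)); apply: (@lt_trans _ _ (Num.bound (2 / d))%:R).
      by apply: archi_boundP; rewrite divr_ge0 // ltW.
    by rewrite -natrX ltr_nat ltn_expl.
  exists J => t; rewrite ltr_pdivrMr // in HJ; apply: le_lt_trans HJ.
  have := ler_cabsD (polar 1 t) (- z).
  by rewrite cabs_polar1 -(sub0r z) cabs_distrC subr0; move: z1; lra.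
pose F j t := 8 / (4 ^+ j.+1 * d) * (\1_(near_arc z (2 ^+ j.+1 * d)) t * k t).
have bA j : bm (fun t => \1_(near_arc z (2 ^+ j.+1 * d)) t * k t).
  by apply: bmM => //; exact: bm_arc.
have bF j : bm (F j) by apply: bmZ.
move: lamPI; rewrite ltNge => /negP; apply.
apply: (@le_trans _ _ (cmean (fun t => \sum_(j < J) F j t))).
  apply: le_cmean; [by apply: bmM => //; exact: bm_PK|exact: (bm_sum _ (fun j : 'I_J => bF j))|].
  move=> t ht; apply: le_trans (ler_wpM2r (k0 t ht) (PK_le_arcs z1 (HJ t))) _.
  by rewrite mulr_suml; apply: ler_sum => j _; rewrite /F mulrA.
rewrite (cmean_sum _ (fun j : 'I_J => bF j)).
apply: (@le_trans _ _ (\sum_(j < J) lam * (1 / 2 ^+ j - 1 / 2 ^+ j.+1))).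
  apply: ler_sum => j _; rewrite cmeanZ //.
  have j0 : 0 < 4 ^+ j.+1 * d by rewrite mulr_gt0 // exprn_gt0.
  apply: (@le_trans _ _ (8 / (4 ^+ j.+1 * d) * (lam * (2 ^+ j.+1 * d) / 8))).
    rewrite ler_wpM2l ?divr_ge0 ?(ltW j0) // small //.
    by rewrite ler_peMl ?(ltW d0) // exprn_ege1 // ler1n.
  rewrite le_eqVlt; apply/orP; left; apply/eqP.
  have -> : 4 ^+ j.+1 = (2 * 2 ^+ j) ^+ 2 :> R by rewrite -exprS exprAC; congr (_ ^+ _); ring.
  have u0 : 0 < 2 ^+ j :> R by rewrite exprn_gt0.
  by rewrite ![2 ^+ j.+1]exprS; field; rewrite !gt_eqF.
rewrite -mulr_sumr ler_piMr //.
have : forall n, \sum_(j < n) (1 / 2 ^+ j - 1 / 2 ^+ j.+1) = 1 - 1 / 2 ^+ n :> R.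
  elim=> [|n IH]; first by rewrite big_ord0 expr0 divr1 subrr.
  by rewrite big_ord_recr /= IH; ring.
by move=> ->; rewrite gerBl divr_ge0 // exprn_ge0.
Qed.

End arcs.

(** * Carleson squares and discs *)

Section plane_measurability.
Variable R : realType.
Implicit Types (z w : R[i]) (D : set R[i]) (u : R[i] -> R).

Lemma measurable_open_plane D : open D -> measurable (D : set (borelC R)).
Proof. by move=> oD; apply: sub_gen_smallest. Qed.

Lemma open_disc : open (@disc R).
Proof.
have -> : @disc R = [set w | cabs (w - 0) < 1] by apply/seteqP; split => w /=; rewrite subr0.
exact: open_cball.
Qed.

Lemma open_superlevel D u (c : R) : open D -> (forall z, D z -> {for z, continuous u}) ->
  open (D `&` [set z | c < u z]).
Proof.
move=> oD cu; rewrite openE => z [Dz /= cz].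
apply: filterI; first exact: open_nbhs_nbhs.
have /ccontinuousP/(_ (u z - c)) := cu z Dz; rewrite subr_gt0 => /(_ cz)[d d0 Hd].
apply: (@filterS _ _ _ [set w | cabs (w - z) < d]); last first.
  by apply: open_nbhs_nbhs; split; [exact: open_cball|rewrite /= subrr cabs0].
by move=> w /= /Hd; rewrite ltr_norml => /andP[h _]; rewrite -subr_gt0; lra.
Qed.

Lemma measurable_continuous_on D u : open D -> (forall z, D z -> {for z, continuous u}) ->
  measurable_fun (D : set (borelC R)) (u : borelC R -> measurableTypeR R).
Proof.
move=> oD cu; apply: (measurability _ (RGenOInfty.measurableE R)) => _ [_ [x ->] <-].
apply: measurable_open_plane.
have -> : D `&` u @^-1` `]x, +oo[ = D `&` [set z | x < u z].
  by apply/seteqP; split => z [Dz /=]; rewrite in_itv /= andbT.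
exact: open_superlevel.
Qed.

Lemma measurable_superlevel u (c : R) : continuous u ->
  measurable ([set z | c < u z] : set (borelC R)).
Proof.
move=> cu; apply: measurable_open_plane; rewrite -[X in open X]setTI.
by apply: open_superlevel; [exact: openT|move=> z _; exact: cu].
Qed.

Lemma measurable_suplevel u (c : R) : continuous u ->
  measurable ([set z | c <= u z] : set (borelC R)).
Proof.
move=> cu; have -> : [set z | c <= u z] = ~` [set z | - c < - u z].
  by apply/seteqP; split => z /=; rewrite ltrN2 leNgt => /negP.
apply: measurableC; apply: measurable_superlevel => z.
by apply: continuousN; exact: cu.
Qed.

End plane_measurability.

Section carleson_squares.
Variable R : realType.
Implicit Types (z w : R[i]) (h th s : R).

Lemma norm_lt_cos (x y : R) : `|x| <= pi -> 0 <= y <= pi -> (cos y < cos x) = (`|x| < y).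
Proof. by move=> xpi ypi; rewrite -(cos_norm x) ltr_cos // in_itv /= ?normr_ge0. Qed.

Lemma rotate_polar z th : z * polar 1 (- th) * polar 1 th = z.
Proof. by rewrite -mulrA -polar1D addNr polar0 mulr1. Qed.

(** Membership in a square is decided by comparing the cosines of the angles. *)
Lemma carleson_squareP h th z : 0 < h <= 1 -> carleson_square h th z <->
  1 - h <= cabs z < 1 /\ (z = 0 \/ cabs z * cos (h / 2) < complex.Re (z * polar 1 (- th))).
Proof.
move=> /andP[h0 h1]; have pi2 := pi_ge2 R.
have hpi : 0 <= h / 2 <= pi by apply/andP; split; lra.
split=> [[Hz [t [tth zt]]]|[Hz [z0|zcos]]]; split => //.
- have [z0|z0] := eqVneq z 0; [by left|right].
  rewrite {2}zt polarM mulr1 /= ltr_pM2l ?cabs_gt0 //.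
  have tn : `|t - th| < h / 2.
    by rewrite ltr_norml; case/andP: tth => ? ?; apply/andP; split; lra.
  by rewrite norm_lt_cos // (le_trans (ltW tn)) //; case/andP: hpi.
- by exists th; rewrite z0 cabs0 /polar !mul0r; split => //; apply/andP; split; lra.
have [t [zt tpi Ret]] := polar_arg (z * polar 1 (- th)).
have cz : cabs (z * polar 1 (- th)) = cabs z by rewrite cabsM cabs_polar1 mulr1.
rewrite cz in zt Ret.
exists (t + th); split; last by rewrite -{1}(rotate_polar z th) zt polarM mulr1.
move: zcos; rewrite -Ret mulrC => zcos.
have z0 : 0 < cabs z.
  rewrite lt_neqAle cabs_ge0 andbT eq_sym; apply/negP => /eqP c0.
  by move: zcos; rewrite c0 !mulr0 ltxx.
move: zcos; rewrite ltr_pM2r // norm_lt_cos // ltr_norml => /andP[? ?].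
by apply/andP; split; lra.
Qed.

Lemma measurable_carleson_square h th : 0 < h <= 1 ->
  measurable (carleson_square h th : set (borelC R)).
Proof.
move=> h01.
have -> : carleson_square h th = [set z | 1 - h <= cabs z] `&` @disc R `&`
    (~` [set z | 0 < cabs z] `|` [set z | 0 <
       complex.Re (z * polar 1 (- th)) - cabs z * cos (h / 2)]).
  apply/seteqP; split => z.
    move=> /(carleson_squareP th z h01)[/andP[? ?]] H; split => //=.
    case: H => [->|H]; first by left; rewrite cabs0 ltxx.
    by right; rewrite subr_gt0.
  move=> /= [[z1 z2] H]; apply/(carleson_squareP th z h01); split; first by rewrite z1.
  case: H => [/negP|]; last by rewrite subr_gt0; right.
  by rewrite cabs_gt0 negbK => /eqP; left.
apply: measurableI; last apply: measurableU.
- apply: measurableI; last by apply: measurable_open_plane; exact: open_disc.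
  by apply: measurable_suplevel; exact: cabs_continuous.
- by apply: measurableC; apply: measurable_superlevel; exact: cabs_continuous.
apply: measurable_superlevel => z.
have cR := cdiff_continuous_Re (cdiffM (cdiff_id z) (cdiff_cst (polar 1 (- th)) z)).
apply: (cvgB cR).
by apply: cvgM; [exact: cabs_continuous|exact: cvg_cst].
Qed.

Lemma ge_half_sin (x : R) : 0 <= x <= 2^-1 -> x / 2 <= sin x.
Proof.
move=> /andP[x0 x1]; have := ler_sinB x; rewrite (ger0_norm x0) ler_distl => /andP[h _].
apply: le_trans h; rewrite lerBrDr -lerBrDl.
have -> : x - x / 2 = x * 2^-1 by field.
rewrite exprS ler_wpM2l // (@le_trans _ _ (2^-1 ^+ 2)) //.
  by rewrite lerXn2r ?nnegrE.
by rewrite expr2 ler_piMr // invf_le1 ?ler1n.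
Qed.

(** If the angle between w and z were at least 12 s, the law of cosines would give |w - z| ^
    2 >= 18 s ^ 2. *)
Lemma disc_sub_carleson_square z s : cabs z < 1 -> 1 - cabs z <= s -> 24 * s <= 1 ->
  exists th, forall w, cabs w < 1 -> cabs (w - z) < 3 * s -> carleson_square (24 * s) th w.
Proof.
move=> z1 zs s1; have s0 : 0 < s by move: z1 zs; lra.
have [th [zth _ _]] := polar_arg z; exists th => w w1 wz.
apply/carleson_squareP; first by rewrite s1 mulr_gt0.
have wge : 1 - 4 * s <= cabs w.
  have := ler_cabsB z w; rewrite cabs_distrC => h; lra.
split; first by rewrite w1 andbT; lra.
right; rewrite ltNge; apply/negP => Hre.
have cos_le : cos (24 * s / 2) <= 1 - 18 * s ^+ 2.
  have -> : 24 * s / 2 = (6 * s) *+ 2 by rewrite mulr2n; field.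
  have : 3 * s <= sin (6 * s).
    have -> : 3 * s = 6 * s / 2 by field.
    by apply: ge_half_sin; apply/andP; split; lra.
  have s3 : 0 <= 3 * s by rewrite mulr_ge0 // ltW.
  rewrite -(@ler_pXn2r _ 2) ?nnegrE ?(le_trans s3) // => [h|]; last first.
    by apply: (@le_trans _ _ (6 * s / 2)); [by clear - s0; lra|apply: ge_half_sin; clear - s0 s1; apply/andP; split; lra].
  by rewrite cos_mulr2n mulr2n cos2sin2; move: h; rewrite exprMn; clear; lra.
set x := w * polar 1 (- th) in Hre.
have cx : cabs x = cabs w by rewrite /x cabsM cabs_polar1 mulr1.
have xz : cabs (x - (cabs z)%:C) < 3 * s.
  have -> : x - (cabs z)%:C = (w - z) * polar 1 (- th).
    by rewrite mulrBl -/x; congr (_ - _); rewrite {2}zth polarM mulr1 addrN polar0.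
  by rewrite cabsM cabs_polar1 mulr1.
have : cabs (x - (cabs z)%:C) ^+ 2 < (3 * s) ^+ 2.
  by rewrite ltrXn2r ?nnegrE ?cabs_ge0 // mulr_ge0 // ltW.
have z0 := cabs_ge0 z.
have -> : cabs (x - (cabs z)%:C) ^+ 2 =
    (cabs w - cabs z) ^+ 2 + 2 * cabs z * (cabs w - complex.Re x).
  rewrite sqr_cabs ReB ImB /= subr0.
  have : cabs w ^+ 2 = complex.Re x ^+ 2 + complex.Im x ^+ 2 by rewrite -cx sqr_cabs.
  move=> h; have -> : complex.Im x ^+ 2 = cabs w ^+ 2 - complex.Re x ^+ 2 by rewrite h; ring.
  ring.
apply/negP; rewrite -leNgt.
have w0 : 0 <= cabs w by exact: cabs_ge0.
have A : cabs w * (18 * s ^+ 2) <= cabs w - complex.Re x.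
  rewrite lerBrDr -lerBrDl; apply: le_trans Hre _.
  rewrite -[X in X - _]mulr1 -mulrBr; exact: ler_wpM2l.
have B : 1 <= 2 * cabs z * cabs w.
  have : (2 * (1 - s)) * (1 - 4 * s) <= (2 * cabs z) * cabs w by apply: ler_pM => //; clear - zs wge s1 s0; lra.
  have : 0 <= s ^+ 2 by exact: sqr_ge0.
  have -> : (2 * (1 - s)) * (1 - 4 * s) = 2 - 10 * s + 8 * s ^+ 2 by ring.
  clear - s1; move=> ? ?; lra.
have : 2 * cabs z * (cabs w * (18 * s ^+ 2)) <= 2 * cabs z * (cabs w - complex.Re x).
  by rewrite ler_wpM2l // mulr_ge0.
have : 1 * (18 * s ^+ 2) <= (2 * cabs z * cabs w) * (18 * s ^+ 2).
  by rewrite ler_wpM2r // mulr_ge0 // sqr_ge0.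
have := sqr_ge0 (cabs w - cabs z); have := sqr_ge0 s.
rewrite mulrA exprMn; clear; lra.
Qed.

End carleson_squares.

Section carleson_measures.
Variables (R : realType) (mu : {finite_measure set (borelC R) -> \bar R}).
Variables (a C : R).
Hypothesis a_ge1 : 1 <= a.
Hypothesis mu_carleson : forall h th : R, 0 < h <= 1 ->
  (mu (carleson_square h th) < (C * h `^ a)%R%:E)%E.
Implicit Types (z w : R[i]) (s : R).

Definition disc_ball z s : set (borelC R) := [set w | cabs w < 1 /\ cabs (w - z) < s].

Lemma measurable_disc_ball z s : measurable (disc_ball z s).
Proof.
have -> : disc_ball z s = (@disc R : set (borelC R)) `&` [set w | cabs (w - z) < s] by [].
apply: measurableI; apply: measurable_open_plane; [exact: open_disc|exact: open_cball].
Qed.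

(** Small balls lie in Carleson squares of comparable size; for large ones the finiteness of
    mu suffices. *)
Lemma carleson_disc_ball : exists2 K, 0 <= K & forall z s, cabs z < 1 -> 1 - cabs z <= s ->
  (mu (disc_ball z (3 * s)) <= (K * s `^ a)%:E)%E.
Proof.
have mufin : mu setT \is a fin_num by exact: fin_num_measure.
pose m := fine (mu setT); have m0 : 0 <= m by rewrite fine_ge0.
have a0 : 0 <= a by apply: le_trans a_ge1.
have C0 : 0 <= C.
  have h : 0 < (1 : R) <= 1 by rewrite ltr01 lexx.
  have := mu_carleson 0 h; rewrite powR1x mulr1 => /(le_lt_trans (measure_ge0 _ _)).
  by rewrite lte_fin => /ltW.
exists ((C + m) * 24 `^ a); first by rewrite mulr_ge0 ?powR_ge0 ?addr_ge0.
move=> z s z1 zs; have s0 : 0 < s by move: z1 zs; lra.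
rewrite -mulrA -powRM ?(ltW s0) // [(C + m) * _]mulrDl EFinD.
have [s1|s1] := leP (24 * s) 1.
  have [th Hth] := disc_sub_carleson_square z1 zs s1.
  have h01 : 0 < 24 * s <= 1 by rewrite s1 mulr_gt0.
  apply: (@le_trans _ _ (mu (carleson_square (24 * s) th))).
    apply: le_measure; rewrite ?inE; first exact: measurable_disc_ball.
      exact: measurable_carleson_square.
    by move=> w [w1 wz]; exact: Hth.
  apply: (le_trans (ltW (mu_carleson th h01))).
  by rewrite leeDl // lee_fin mulr_ge0 // powR_ge0.
apply: (@le_trans _ _ (mu setT)).
  by apply: le_measure; rewrite ?inE //; exact: measurable_disc_ball.
rewrite -(fineK mufin) -/m; apply: (@le_trans _ _ (m * (24 * s) `^ a)%:E).
  rewrite lee_fin ler_peMr // -[leLHS](powR1x a).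
  by apply: ge0_ler_powR; rewrite ?nnegrE ?(ltW s1) // mulr_ge0 // ltW.
by rewrite leeDr // lee_fin mulr_ge0 // powR_ge0.
Qed.

End carleson_measures.

(** * Coverings of level sets of Poisson integrals *)

Section coverings.
Variable R : realType.
Implicit Types (z w : R[i]) (E : set R[i]) (D : seq (R[i] * R)).

Definition has_net E (e : R) := exists l : seq R[i], (forall w, w \in l -> E w) /\
  forall z, E z -> exists2 w, w \in l & cabs (z - w) <= e.

Lemma has_netU E F e : has_net E e -> has_net F e -> has_net (E `|` F) e.
Proof.
move=> [l [lE El]] [l' [lF Fl]]; exists (l ++ l'); split.
  by move=> w; rewrite mem_cat => /orP[/lE|/lF]; [left|right].
move=> z [/El|/Fl] [w wl zw]; exists w => //; rewrite mem_cat wl ?orbT //.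
Qed.

(** The square is halved in both directions until its side is e, when any point of E serves. *)
Lemma square_net n E (x y e : R) : 0 < e ->
  (forall z, E z -> x <= complex.Re z < x + 2 ^+ n * e /\ y <= complex.Im z < y + 2 ^+ n * e) ->
  has_net E (2 * e).
Proof.
move=> e0; elim: n => [|n IH] in E x y * => HE.
  have [[z0 Ez0]|nE] := pselect (exists z0, E z0); last first.
    by exists [::]; split => // z Ez; case: nE; exists z.
  exists [:: z0]; split => [w|z Ez]; first by rewrite inE => /eqP ->.
  exists z0; first by rewrite inE.
  have [/andP[? ?] /andP[? ?]] := HE z Ez; have [/andP[? ?] /andP[? ?]] := HE z0 Ez0.
  apply: le_trans (ler_cabs_ReIm _) _; rewrite ReB ImB mulrDl mul1r.
  rewrite expr0 mul1r in HE *.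
  by apply: lerD; rewrite ler_norml; apply/andP; split; lra.
set h := 2 ^+ n * e in IH; have h2 : 2 ^+ n.+1 * e = h + h by rewrite exprS /h; ring.
rewrite h2 in HE.
have -> : E = (E `&` [set z | complex.Re z < x + h] `&` [set z | complex.Im z < y + h]) `|`
    (E `&` [set z | complex.Re z < x + h] `&` [set z | y + h <= complex.Im z]) `|`
   ((E `&` [set z | x + h <= complex.Re z] `&` [set z | complex.Im z < y + h]) `|`
    (E `&` [set z | x + h <= complex.Re z] `&` [set z | y + h <= complex.Im z])).
  apply/seteqP; split => z /=; last by case=> [[[[]]|[[]]]|[[[]]|[[]]]].
  move=> Ez; have [A|A] := ltP (complex.Re z) (x + h); [left|right].
    by have [B|B] := ltP (complex.Im z) (y + h); [left|right].
  by have [B|B] := ltP (complex.Im z) (y + h); [left|right].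
apply: has_netU; apply: has_netU.
- apply: (IH _ x y) => z [[/HE[/andP[? ?] /andP[? ?]] /= ?] ?].
  by split; apply/andP; split.
- apply: (IH _ x (y + h)) => z [[/HE[/andP[? ?] /andP[? ?]] /= ?] ?].
  by split; apply/andP; split => //; lra.
- apply: (IH _ (x + h) y) => z [[/HE[/andP[? ?] /andP[? ?]] /= ?] ?].
  by split; apply/andP; split => //; lra.
apply: (IH _ (x + h) (y + h)) => z [[/HE[/andP[? ?] /andP[? ?]] /= ?] ?].
by split; apply/andP; split => //; lra.
Qed.

Lemma disc_net E (e : R) : E `<=` @disc R -> 0 < e -> has_net E e.
Proof.
move=> Ed e0.
have [n Hn] : exists n, 4 / e < 2 ^+ n.
  exists (Num.bound (4 / e)); apply: (@lt_trans _ _ (Num.bound (4 / e))%:R).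
    by apply: archi_boundP; rewrite divr_ge0 // ltW.
  by rewrite -natrX ltr_nat ltn_expl.
have e2 : 0 < e / 2 by rewrite divr_gt0.
have -> : e = 2 * (e / 2) by field.
have big : 2 < 2 ^+ n * (e / 2) by move: Hn; rewrite ltr_pdivrMr // => h; lra.
apply: (@square_net n _ (-1) (-1)) => // z /Ed; rewrite /disc /= => z1.
have := ler_Re_cabs z; have := ler_Im_cabs z; rewrite !ler_norml.
by move=> /andP[? ?] /andP[? ?]; split; apply/andP; split; lra.
Qed.

Definition far (b c : R[i] * R) := b.2 + c.2 <= cabs (b.1 - c.1).

Lemma largest_radius D b : exists2 c, c \in b :: D & forall d, d \in b :: D -> d.2 <= c.2.
Proof.
elim: D b => [|b' D IH] b.
  by exists b => [|d]; rewrite inE // => /eqP ->.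
have [c cD Hc] := IH b'.
have [cb|bc] := leP c.2 b.2.
  exists b; first by rewrite inE eqxx.
  by move=> d; rewrite inE => /orP[/eqP -> //|/Hc/le_trans]; apply.
exists c; first by rewrite inE cD orbT.
by move=> d; rewrite inE => /orP[/eqP ->|/Hc //]; exact: ltW.
Qed.

(** The greedy selection of Vitali: always take a largest remaining disc. *)
Lemma finite_vitali D : (forall b, b \in D -> 0 < b.2) -> exists D', [/\
  {subset D' <= D}, pairwise far D' & forall b, b \in D ->
    exists2 c, c \in D' & b.2 <= c.2 /\ cabs (b.1 - c.1) < b.2 + c.2].
Proof.
elim: (size D).+1 {-2}D (ltnSn (size D)) => // n IH {}D Dn Dpos.
case: D => [|b0 D] in Dn Dpos *; first by exists [::].
have [b bD Hb] := largest_radius D b0.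
move: (b0 :: D) bD Hb Dn Dpos => {b0} {}D bD Hb Dn Dpos.
pose F : pred (R[i] * R) := far b.
have [D' [D'D D'far HD']] : exists D', [/\ {subset D' <= seq.filter F D}, pairwise far D' &
    forall c, c \in seq.filter F D ->
    exists2 d, d \in D' & c.2 <= d.2 /\ cabs (c.1 - d.1) < c.2 + d.2].
  apply: IH => [|c]; last by rewrite mem_filter => /andP[_ /Dpos].
  apply: (@leq_trans (size D)); last by rewrite -ltnS.
  rewrite size_filter -(count_predC F D) -addn1 leq_add2l -has_count; apply/hasP; exists b => //=.
  by rewrite /F /far subrr cabs0 -ltNge addr_gt0 // Dpos.
exists (b :: D'); split => [c||c cD].
- by rewrite inE => /orP[/eqP -> //|/D'D]; rewrite mem_filter => /andP[].
- rewrite /= D'far andbT; apply/allP => c /D'D; rewrite mem_filter; by case/andP.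
have [bc|bc] := boolP (F c).
  have [d dD' Hd] : exists2 d, d \in D' & c.2 <= d.2 /\ cabs (c.1 - d.1) < c.2 + d.2.
    by apply: HD'; rewrite mem_filter bc.
  by exists d => //; rewrite inE dD' orbT.
exists b; first by rewrite inE eqxx.
by split; [exact: Hb|rewrite cabs_distrC [ltRHS]addrC ltNge].
Qed.

(** By the triangle inequality, discs whose centres are at least the sum of the radii apart
    cut out disjoint arcs. *)
Lemma far_arcs D t : pairwise far D -> \sum_(b <- D) \1_(near_arc b.1 b.2) t <= 1 :> R.
Proof.
elim: D => [|b D IH] /=; first by rewrite big_nil.
move=> /andP[/allP bD /IH IHD]; rewrite big_cons indicE.
have [|_] := boolP (t \in _); last by rewrite add0r.
rewrite inE /near_arc /= => tb; rewrite big1_seq ?addr0 // => c /andP[_ /bD].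
rewrite /far => bc; rewrite indicE memNset //= => tc.
move: bc; apply/negP; rewrite -ltNge.
by apply: le_lt_trans (ler_cabs_triangle (polar 1 t) _ _) _; rewrite addrC cabs_distrC addrC ltrD.
Qed.

End coverings.

Section level_sets.
Variables (R : realType) (mu : {finite_measure set (borelC R) -> \bar R}) (a K : R).
Hypothesis a_ge1 : 1 <= a.
Hypothesis K_ge0 : 0 <= K.
Hypothesis mu_disc_ball : forall z s, cabs z < 1 -> 1 - cabs z <= s ->
  (mu (disc_ball z (3 * s)) <= (K * s `^ a)%:E)%E.
Implicit Types (z w : R[i]) (k : R -> R) (D : seq (R[i] * R)).

Let a_gt0 : 0 < a. Proof. exact: lt_le_trans a_ge1. Qed.

Lemma powR_superadditive (x y : R) : 0 <= x -> 0 <= y -> x `^ a + y `^ a <= (x + y) `^ a.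
Proof.
move=> x0 y0; have aV : 0 < a^-1 <= 1 by rewrite invr_gt0 a_gt0 invf_le1.
have := powR_subadditive (powR_ge0 x a) (powR_ge0 y a) aV.
rewrite -!powRrM divff ?gt_eqF // !powRr1 // => h.
have s0 : 0 <= x `^ a + y `^ a by rewrite addr_ge0 ?powR_ge0.
rewrite -[leLHS]powRr1 // -[X in _ `^ X](@mulVf _ a) ?gt_eqF // powRrM.
by apply: ge0_ler_powR; rewrite ?nnegrE ?powR_ge0 ?addr_ge0 // ltW.
Qed.

Lemma powR_sum (I : Type) (l : seq I) (x : I -> R) : (forall i, 0 <= x i) ->
  \sum_(i <- l) x i `^ a <= (\sum_(i <- l) x i) `^ a.
Proof.
move=> x0; elim: l => [|i l IH]; first by rewrite !big_nil powR_ge0.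
rewrite !big_cons; apply: le_trans (powR_superadditive (x0 i) _).
  by rewrite lerD2l.
by apply: sumr_ge0.
Qed.

(** Since a >= 1, powers are superadditive: the bounds for the balls add up to at most the
    power of the total radius. *)
Lemma disc_balls_cover D : (forall b, b \in D -> cabs b.1 < 1 /\ 1 - cabs b.1 <= b.2) ->
  exists U : set (borelC R), [/\ measurable U,
    forall b, b \in D -> disc_ball b.1 (3 * b.2) `<=` U &
    (mu U <= (K * (\sum_(b <- D) b.2) `^ a)%:E)%E].
Proof.
elim: D => [|b D IH] HD.
  by exists set0; split => //; rewrite measure0 lee_fin mulr_ge0 ?powR_ge0.
have [|U [mU DU muU]] := IH.
  by move=> c cD; apply: HD; rewrite inE cD orbT.
have [b1 bs] : cabs b.1 < 1 /\ 1 - cabs b.1 <= b.2 by apply: HD; rewrite inE eqxx.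
have mh := measurable_disc_ball b.1 (3 * b.2).
exists (disc_ball b.1 (3 * b.2) `|` U); split.
- exact: measurableU.
- move=> c; rewrite inE => /orP[/eqP ->|/DU cU]; first exact: subsetUl.
  exact: subset_trans cU (@subsetUr _ _ _).
apply: (le_trans (measureU2 _ _ _)) => //.
apply: (le_trans (leeD (mu_disc_ball b1 bs) muU)).
rewrite -EFinD lee_fin -mulrDr ler_wpM2l // big_cons.
apply: powR_superadditive; first by move: b1 bs; lra.
rewrite big_seq; apply: sumr_ge0 => c cD.
have [] : cabs c.1 < 1 /\ 1 - cabs c.1 <= c.2 by apply: HD; rewrite inE cD orbT.
by move=> c1 cs; apply: le_trans cs; rewrite subr_ge0 ltW.
Qed.

Lemma bm_pos k (c : R) : bm k -> bm (fun t => Num.max (k t - c) 0).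
Proof.
move=> bk; have b1 : bm (fun t => k t - c) by apply: bmB => //; exact: bm_cst.
have -> : (fun t => Num.max (k t - c) 0) = (fun t => 2^-1 * (k t - c + `|k t - c|)).
  by apply/funext => t; rewrite maxr_absE addr0 subr0 mulrC.
by apply: bmZ; apply: bmD => //; exact: bm_norm.
Qed.

(** Truncating k at lam / 64 loses at most half of the mass on an arc where the mean is
    large. *)
Lemma PI_large_arc_pos z k (lam : R) : cabs z < 1 -> bm k ->
  (forall t, 0 <= t <= 2 * pi -> 0 <= k t) -> 0 <= lam -> lam < PI z k ->
  exists2 s, 1 - cabs z <= s &
    lam * s / 16 <= cmean (fun t => \1_(near_arc z s) t * Num.max (k t - lam / 64) 0).
Proof.
move=> z1 bk k0 lam0 /(PI_large_arc z1 bk k0 lam0)[s zs Hs]; exists s => //.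
have bA := bm_arc z s.
have bp : bm (fun t => \1_(near_arc z s) t * Num.max (k t - lam / 64) 0).
  by apply: bmM => //; exact: bm_pos.
have : cmean (fun t => \1_(near_arc z s) t * k t) <=
    cmean (fun t => \1_(near_arc z s) t * Num.max (k t - lam / 64) 0 + lam / 64 * \1_(near_arc z s) t).
  apply: le_cmean; [exact: bmM|by apply: bmD => //; exact: bmZ|].
  move=> t _; rewrite [lam / 64 * _]mulrC -mulrDr ler_wpM2l ?indic_ge0 //.
  by rewrite -lerBlDr le_max lexx.
rewrite cmeanD ?cmeanZ //; last exact: bmZ.
have : lam / 64 * cmean (\1_(near_arc z s)) <= lam / 64 * (4 * s).
  by rewrite ler_wpM2l ?divr_ge0 //; exact: arc_mean.
have -> : lam / 64 * (4 * s) = lam * s / 16 by field.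
lra.
Qed.

(** Each point of the level set owns an arc on which the truncation of k has mass at least
    lam s / 16.  The Vitali selection makes the arcs disjoint, which bounds the total radius
    by the mean of the truncation.  A finite net of centres suffices because the radii are
    at least 1 - r. *)
Lemma poisson_level_cover k (lam r : R) : bm k -> (forall t, 0 <= t <= 2 * pi -> 0 <= k t) ->
  0 < lam -> r < 1 -> exists U : set (borelC R), [/\ measurable U,
    forall z, cabs z <= r -> lam < PI z k -> U z &
    (mu U <= (K * (16 / lam * cmean (fun t => Num.max (k t - lam / 64) 0)) `^ a)%:E)%E].
Proof.
move=> bk k0 lam0 r1.
set q := fun t => Num.max (k t - lam / 64) 0.
have bq : bm q by exact: bm_pos.
pose E : set R[i] := [set z | cabs z <= r /\ lam < PI z k].
have E1 z : E z -> cabs z < 1 by case=> zr _; exact: le_lt_trans r1.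
have [sg Hsg] : {sg : R[i] -> R & forall z, E z -> 1 - cabs z <= sg z /\
    lam * sg z / 16 <= cmean (fun t => \1_(near_arc z (sg z)) t * q t)}.
  apply: (@choice _ _ (fun z s => E z -> 1 - cabs z <= s /\
    lam * s / 16 <= cmean (fun t => \1_(near_arc z s) t * q t))) => z.
  have [Ez|nE] := pselect (E z); last by exists 0.
  have [s s1 s2] := PI_large_arc_pos (E1 z Ez) bk k0 (ltW lam0) Ez.2.
  by exists s.
have r0 : 0 < 1 - r by rewrite subr_gt0.
have [l [lE El]] : has_net E ((1 - r) / 2).
  by apply: disc_net; [exact: E1|rewrite divr_gt0].
have Epos z : E z -> 0 < sg z.
  by move=> Ez; have [h _] := Hsg z Ez; apply: lt_le_trans h; rewrite subr_gt0 E1.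
pose D0 := [seq (z, sg z) | z <- l].
have D0P b : b \in D0 -> E b.1 /\ b.2 = sg b.1.
  by move=> /mapP[z /lE Ez ->].
have [D [DD0 Dfar HD]] : exists D', [/\ {subset D' <= D0}, pairwise (@far R) D' &
    forall b, b \in D0 -> exists2 c, c \in D' & b.2 <= c.2 /\ cabs (b.1 - c.1) < b.2 + c.2].
  by apply: finite_vitali => b /D0P[Eb ->]; exact: Epos.
have DP b : b \in D -> E b.1 /\ b.2 = sg b.1 by move=> /DD0/D0P.
have [U [mU DU muU]] : exists U : set (borelC R), [/\ measurable U,
    forall b, b \in D -> disc_ball b.1 (3 * b.2) `<=` U &
    (mu U <= (K * (\sum_(b <- D) b.2) `^ a)%:E)%E].
  by apply: disc_balls_cover => b /DP[Eb ->]; split; [exact: E1|case: (Hsg _ Eb)].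
exists U; split => //.
  move=> z zr zlam; have Ez : E z by [].
  have [w wl zw] := El z Ez; have [c cD [wc1 wc2]] := HD (w, sg w) (map_f _ wl).
  apply: (DU c cD); split; first exact: E1.
  have [w1 _] := Hsg w (lE w wl).
  have rw : 1 - r <= 1 - cabs w by rewrite lerD2l lerN2; case: (lE w wl).
  apply: le_lt_trans (ler_cabs_triangle w _ _) _.
  move: wc1 wc2; rewrite /= => wc1 wc2; lra.
apply: (le_trans muU); rewrite lee_fin ler_wpM2l //.
have D0' b : b \in D -> 0 <= b.2 by move=> /DP[Eb ->]; exact: ltW (Epos _ Eb).
have q0 t : 0 <= q t by rewrite /q le_max lexx orbT.
have sumD : \sum_(b <- D) lam * b.2 / 16 <= cmean q.
  apply: (@le_trans _ _ (\sum_(b <- D) cmean (fun t => \1_(near_arc b.1 b.2) t * q t))).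
    rewrite big_seq [leRHS]big_seq; apply: ler_sum => b /DP[Eb ->].
    by case: (Hsg _ Eb).
  have bb (b : R[i] * R) : bm (fun t => \1_(near_arc b.1 b.2) t * q t).
    by apply: bmM => //; exact: bm_arc.
  rewrite -(cmean_sum D bb); apply: le_cmean => //; first exact: (bm_sum D bb).
  by move=> t _; rewrite -mulr_suml ler_piMl // far_arcs.
apply: ge0_ler_powR; rewrite ?nnegrE ?(ltW a_gt0) //.
- by rewrite big_seq; apply: sumr_ge0.
- by rewrite mulr_ge0 ?divr_ge0 ?(ltW lam0) //; apply: cmean_ge0.
have l16 : 0 < 16 / lam by rewrite divr_gt0.
have -> : \sum_(b <- D) b.2 = 16 / lam * \sum_(b <- D) lam * b.2 / 16.
  by rewrite mulr_sumr; apply: eq_bigr => b _; field; rewrite gt_eqF.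
by rewrite ler_pM2l.
Qed.

End level_sets.

(** * The Poisson embedding for Carleson measures *)

Lemma integral_le_layers d (T : measurableType d) (R : realType)
    (mu : {measure set T -> \bar R}) (E : set T) (g : T -> R) J (x : nat -> R) (U : nat -> set T) :
  measurable E -> measurable_fun E g -> (forall z, E z -> 0 <= g z) ->
  (forall j, 0 <= x j) -> (forall j, measurable (U j)) ->
  (forall z, E z -> g z <= \sum_(j < J) x j * \1_(U j) z) ->
  (\int[mu]_(z in E) (g z)%:E <= \sum_(j < J) (x j)%:E * mu (U j))%E.
Proof.
move=> mE mg g0 x0 mU pw.
have mi j : measurable_fun E (EFin \o \1_(U j) : T -> \bar R).
  by apply/measurable_EFinP; exact: measurable_indic.
have mI j : measurable_fun E (fun z => (x j)%:E * (\1_(U j) z)%:E)%E.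
  under eq_fun do rewrite -EFinM; apply/measurable_EFinP.
  by apply: measurable_funM => //; exact: measurable_indic.
apply: (@le_trans _ _ (\int[mu]_(z in E) (\sum_(j < J) (x j)%:E * (\1_(U j) z)%:E))%E).
  apply: ge0_le_integral => //.
  - exact/measurable_EFinP.
  - exact: emeasurable_sum.
  - by move=> z zE; under eq_bigr do rewrite -EFinM; rewrite sumEFin lee_fin pw.
rewrite ge0_integral_sum //; last by move=> j z _; rewrite mule_ge0 ?lee_fin ?indic_ge0.
apply: lee_sum => j _; rewrite ge0_integralZl_EFin //; last exact: mi.
rewrite integral_indic //; apply: lee_wpmul2l; first by rewrite lee_fin.
by apply: le_measure; rewrite ?inE //; exact: measurableI.
Qed.

Lemma powR_le (R : realType) (a x y : R) : 0 <= a -> 0 <= x -> x <= y -> x `^ a <= y `^ a.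
Proof. by move=> a0 x0 xy; apply: ge0_ler_powR => //; rewrite nnegrE (le_trans x0). Qed.

Section embedding.
Variables (R : realType) (mu : {finite_measure set (borelC R) -> \bar R}) (a K : R).
Hypothesis a_ge1 : 1 <= a.
Hypothesis K_ge0 : 0 <= K.
Hypothesis mu_disc_ball : forall z s, cabs z < 1 -> 1 - cabs z <= s ->
  (mu (disc_ball z (3 * s)) <= (K * s `^ a)%:E)%E.
Implicit Types (z w : R[i]) (k : R -> R).

Let a_ge0 : 0 <= a. Proof. exact: le_trans a_ge1. Qed.

(** The largest level below v alone suffices. *)
Lemma level_majorant (v : R) J : 2^-1 < v -> v <= 2 ^+ J / 2 ->
  (v ^+ 2) `^ a <= \sum_(j < J) (4 ^+ j) `^ a * (2 ^+ j / 2 < v)%R%:R.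
Proof.
move=> v2; elim: J => [|J IH]; first by rewrite expr0 div1r leNgt v2.
move=> vJ; rewrite big_ord_recr /=; have [/IH|Jv] := leP v (2 ^+ J / 2).
  by rewrite mulr0 addr0.
rewrite mulr1; apply: ler_wpDl.
  by apply: sumr_ge0 => j _; rewrite mulr_ge0 ?powR_ge0.
have v0 : 0 < v by apply: lt_trans v2; rewrite invr_gt0.
apply: ge0_ler_powR; rewrite ?nnegrE ?sqr_ge0 ?exprn_ge0 //.
have -> : 4 ^+ J = (2 ^+ J) ^+ 2 :> R by rewrite exprAC; congr (_ ^+ _); ring.
rewrite lerXn2r ?nnegrE ?(ltW v0) ?exprn_ge0 //.
by move: vJ; rewrite exprS mulrAC divff // mul1r.
Qed.

(** Only the levels 2 ^ j * c < x contribute, and the powers 2 ^ j of these form a geometric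
    sum. *)
Lemma level_sum (x c : R) J : 0 <= x -> 0 < c ->
  \sum_(j < J) 2 ^+ j * Num.max (x - 2 ^+ j * c) 0 <= 2 / c * x ^+ 2.
Proof.
move=> x0 c0; elim: J => [|J IH].
  by rewrite big_ord0 mulr_ge0 ?sqr_ge0 // divr_ge0 // ltW.
have [Jx|Jx] := leP x (2 ^+ J * c).
  rewrite big_ord_recr /=; have -> : Num.max (x - 2 ^+ J * c) 0 = 0.
    by apply/max_idPr; rewrite subr_le0.
  by rewrite mulr0 addr0.
apply: (@le_trans _ _ (\sum_(j < J.+1) 2 ^+ j * x)).
  apply: ler_sum => j _; rewrite ler_wpM2l ?exprn_ge0 // ge_max x0 andbT.
  by rewrite gerBl mulr_ge0 ?exprn_ge0 // ltW.
rewrite -mulr_suml expr2 mulrA ler_wpM2r //.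
have -> : \sum_(j < J.+1) 2 ^+ j = 2 ^+ J.+1 - 1 :> R.
  by have := subrX1 (2 : R) J.+1; rewrite (_ : (2 : R) - 1 = 1) ?mul1r //; ring.
rewrite mulrAC ler_pdivlMr // exprS mulrBl; nra.
Qed.

Lemma level_term (c u m : R) : 0 < u -> 0 <= m ->
  (c ^+ 2) `^ a * (u ^+ 2) `^ a * (K * (16 / (u / 2) * m) `^ a) =
  K * (c ^+ 2 * (32 * (u * m))) `^ a.
Proof.
move=> u0 m0; have y0 : 0 <= 16 / (u / 2) * m.
  by rewrite mulr_ge0 // divr_ge0 // divr_ge0 // ltW.
have c2 := sqr_ge0 c; have u2 := sqr_ge0 u.
rewrite mulrCA -(powRM a c2 u2) -(powRM a (mulr_ge0 c2 u2) y0).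
by congr (_ * _ `^ _); field; rewrite gt_eqF.
Qed.

Lemma PI_le_mean z k (r : R) : bm k -> (forall t, 0 <= t <= 2 * pi -> 0 <= k t) ->
  r < 1 -> cabs z <= r -> PI z k <= 2 / (1 - r) * cmean k.
Proof.
move=> bk k0 r1 zr; have z1 : cabs z < 1 by apply: le_lt_trans r1.
rewrite -cmeanZ //; apply: le_cmean; [by apply: bmM => //; exact: bm_PK|exact: bmZ|].
move=> t ht; rewrite ler_wpM2r ?k0 //; apply: le_trans (PK_le_inv t z1) _.
by rewrite ler_pM2l // lef_pV2 ?posrE ?subr_gt0 // lerD2l lerN2.
Qed.

(** The layer-cake decomposition of the integral at the levels 2^j / 2.  The truncated weak-type
    bounds for all levels add up to a multiple of the mean of the square of k. *)
Lemma poisson_embedding k (r c : R) (w : borelC R -> R) : bm k ->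
  (forall t, 0 <= t <= 2 * pi -> 1 <= k t) -> r < 1 -> 0 <= c ->
  measurable_fun (@disc R : set (borelC R)) w ->
  (forall z, cabs z <= r -> 0 <= w z <= c * PI z k) ->
  (\int[mu]_(z in [set z | (cabs z <= r)%R]) ((w z ^+ 2) `^ a)%:E <=
    (K * (2 ^+ 13 * c ^+ 2 * cmean (fun t => k t ^+ 2)) `^ a)%R%:E)%E.
Proof.
move=> bk k1 r1 c0 mw Hw.
have k0 t : 0 <= t <= 2 * pi -> 0 <= k t by move=> /k1; apply: le_trans.
set E : set (borelC R) := [set z | cabs z <= r].
have mE : measurable E.
  have -> : E = ~` [set z | r < cabs z].
    by apply/seteqP; split => z; rewrite /E /= leNgt => /negP.
  by apply: measurableC; apply: measurable_superlevel; exact: cabs_continuous.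
have ED : E `<=` (@disc R : set (borelC R)) by move=> z zr; exact: le_lt_trans r1.
pose m j := cmean (fun t => Num.max (k t - 2 ^+ j / 2 / 64) 0).
have [U HU] : {U : nat -> set (borelC R) & forall j, [/\ measurable (U j),
    forall z, cabs z <= r -> 2 ^+ j / 2 < PI z k -> U j z &
    (mu (U j) <= (K * (16 / (2 ^+ j / 2) * m j) `^ a)%:E)%E]}.
  apply: (@choice _ _ (fun j (V : set (borelC R)) => [/\ measurable V,
    forall z, cabs z <= r -> 2 ^+ j / 2 < PI z k -> V z &
    (mu V <= (K * (16 / (2 ^+ j / 2) * m j) `^ a)%:E)%E])) => j.
  have l0 : 0 < 2 ^+ j / 2 :> R by rewrite divr_gt0 // exprn_gt0.
  exact: (poisson_level_cover a_ge1 K_ge0 mu_disc_ball bk k0 l0 r1).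
have [J HJ] : exists J, 2 / (1 - r) * cmean k * 2 < 2 ^+ J.
  have V0 : 0 <= 2 / (1 - r) * cmean k * 2.
    have d0 : 0 <= 2 / (1 - r) by rewrite divr_ge0 // subr_ge0 ltW.
    by apply: mulr_ge0 => //; apply: mulr_ge0 => //; exact: cmean_ge0.
  exists (Num.bound (2 / (1 - r) * cmean k * 2)).
  apply: (lt_trans (archi_boundP V0)).
  by rewrite -natrX ltr_nat ltn_expl.
pose x j : R := (c ^+ 2) `^ a * (4 ^+ j) `^ a.
have x0 j : 0 <= x j by rewrite mulr_ge0 ?powR_ge0.
have pw z : E z -> (w z ^+ 2) `^ a <= \sum_(j < J) x j * \1_(U j) z.
  move=> zr; have /andP[w0 wc] := Hw z zr.
  have z1 : cabs z < 1 by exact: ED.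
  have v1 : 1 <= PI z k.
    by rewrite -(PI_cst 1 z1); apply: le_PI => //; exact: bm_cst.
  apply: (@le_trans _ _ ((c ^+ 2) `^ a * (PI z k ^+ 2) `^ a)).
    rewrite -powRM ?sqr_ge0 // -exprMn.
    apply: ge0_ler_powR; rewrite ?nnegrE ?sqr_ge0 //.
    by rewrite lerXn2r ?nnegrE // (le_trans w0).
  have vJ : PI z k <= 2 ^+ J / 2.
    rewrite ler_pdivlMr //; apply: le_trans (ltW HJ).
    by rewrite ler_pM2r //; exact: PI_le_mean.
  have v2 : 2^-1 < PI z k by apply: lt_le_trans v1; rewrite invf_lt1 // ltr1n.
  apply: (@le_trans _ _ ((c ^+ 2) `^ a *
      \sum_(j < J) (4 ^+ j) `^ a * (2 ^+ j / 2 < PI z k)%R%:R)).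
    by rewrite ler_wpM2l ?powR_ge0 // level_majorant.
  rewrite mulr_sumr; apply: ler_sum => j _; rewrite mulrA ler_wpM2l ?(x0 j) //.
  have [h|h] := boolP (2 ^+ j / 2 < PI z k); last by rewrite indic_ge0.
  by rewrite indicE mem_set //; case: (HU j) => _ + _; apply.
have mwE : measurable_fun E w by apply: measurable_funS mw => //; apply: measurable_open_plane; exact: open_disc.
have mg : measurable_fun E (fun z => (w z ^+ 2) `^ a).
  by apply: (measurableT_comp (measurable_powR a)); exact: measurable_funX.
have mU j : measurable (U j) by case: (HU j).
apply: (le_trans (integral_le_layers mu mE mg (fun z _ => powR_ge0 _ _) x0 mU pw)).
apply: (@le_trans _ _ (\sum_(j < J) (K * (c ^+ 2 * (32 * (2 ^+ j * m j))) `^ a)%:E)%E).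
  apply: lee_sum => j _; have [_ _ muU] := HU j.
  apply: (@le_trans _ _ ((x j)%:E * (K * (16 / (2 ^+ j / 2) * m j) `^ a)%:E)%E).
    by apply: lee_wpmul2l; rewrite ?lee_fin.
  have m0 : 0 <= m j by apply: cmean_ge0 => t _; rewrite le_max lexx orbT.
  have u0 : 0 < 2 ^+ j :> R by rewrite exprn_gt0.
  rewrite -EFinM lee_fin /x; have -> : 4 ^+ j = (2 ^+ j) ^+ 2 :> R.
    by rewrite exprAC; congr (_ ^+ _); ring.
  by rewrite level_term.
rewrite sumEFin lee_fin -mulr_sumr ler_wpM2l //.
have m0 j : 0 <= m j by apply: cmean_ge0 => t _; rewrite le_max lexx orbT.
apply: le_trans (powR_sum a_ge1 _ _) _.
  by move=> j; rewrite mulr_ge0 ?sqr_ge0 // mulr_ge0 // mulr_ge0 // exprn_ge0.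
have bq j : bm (fun t => 2 ^+ j * Num.max (k t - 2 ^+ j / 2 / 64) 0).
  by apply: bmZ; exact: bm_pos.
have key : \sum_(j < J) 2 ^+ j * m j <= 256 * cmean (fun t => k t ^+ 2).
  have -> : \sum_(j < J) 2 ^+ j * m j =
      \sum_(j < J) cmean (fun t => 2 ^+ j * Num.max (k t - 2 ^+ j / 2 / 64) 0).
    by apply: eq_bigr => j _; rewrite (cmeanZ _ (bm_pos _ bk)).
  rewrite -(cmean_sum _ (fun j : 'I_J => bq j)) -cmeanZ; last exact: bmX.
  apply: le_cmean; [exact: (bm_sum _ (fun j : 'I_J => bq j))|by apply: bmZ; exact: bmX|].
  move=> t ht; have c128 : 0 < 128^-1 :> R by rewrite invr_gt0.
  have := @level_sum (k t) (128^-1) J (k0 t ht) c128.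
  have -> : 2 / 128^-1 = 256 :> R by rewrite invrK; ring.
  apply: le_trans; apply: ler_sum => j _.
  by have -> : 2 ^+ j / 2 / 64 = 2 ^+ j * 128^-1 :> R by field.
apply: (powR_le a_ge0).
  apply: sumr_ge0 => j _; apply: mulr_ge0; first exact: sqr_ge0.
  by apply: mulr_ge0 => //; apply: mulr_ge0; [exact: exprn_ge0|exact: m0].
rewrite -mulr_sumr -mulr_sumr.
have -> : 2 ^+ 13 * c ^+ 2 * cmean (fun t => k t ^+ 2) =
  c ^+ 2 * (32 * (256 * cmean (fun t => k t ^+ 2))) by ring.
by apply: ler_wpM2l; [exact: sqr_ge0|apply: ler_wpM2l].
Qed.

End embedding.

(** * Sufficiency of the Carleson condition *)

Section sufficiency.
Variable R : realType.
Variables (p : R[i] -> R) (pm pM : R).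
Hypothesis pm_gt0 : 0 < pm.
Hypothesis p_bounded : forall z, closed_disc z -> pm <= p z <= pM.
Hypothesis p_lh : log_holder p.
Variables (mu : {finite_measure set (borelC R) -> \bar R}) (a : R).
Hypothesis a_ge1 : 1 <= a.
Implicit Types (z w : R[i]) (f g : R[i] -> R[i]) (r s t l : R).

Let a_gt0 : 0 < a. Proof. exact: lt_le_trans a_ge1. Qed.

Lemma p_disc_continuous z : cabs z < 1 -> {for z, continuous p}.
Proof.
move=> z1; apply/ccontinuousP => e e0.
have e20 : 0 < e / 2 by rewrite divr_gt0.
have [d d0 Hd] := p_uniform pm_gt0 p_bounded p_lh e20.
have m0 : 0 < Num.min d (1 - cabs z) by rewrite lt_min d0 subr_gt0.
exists (Num.min d (1 - cabs z)) => // w; rewrite lt_min => /andP[wd w1].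
apply: (@le_lt_trans _ _ (e / 2)); last by move: e0; lra.
apply: Hd; rewrite ?(ltW wd) // /closed_disc /=; last exact: ltW.
have := ler_cabsB w z; move: w1; lra.
Qed.

Lemma measurable_disc_power g (b : R) : (forall z, cabs z < 1 -> cdiff g z) -> 0 < b ->
  measurable_fun (@disc R : set (borelC R)) (fun z : borelC R => cabs (g z) `^ (b * p z)).
Proof.
move=> dg b0.
apply: measurable_fun_powR2.
- by apply: measurable_open_plane; exact: open_disc.
- apply: measurable_continuous_on; first exact: open_disc.
  by move=> z z1; apply: cdiff_continuous_cabs; exact: dg.
- apply: measurable_funM; first exact: measurable_cst.
  apply: measurable_continuous_on; first exact: open_disc.
  by move=> z z1; exact: p_disc_continuous.
move=> z z1; have z1' : closed_disc z by exact: ltW z1.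
have /andP[h _] := p_bounded z1'.
by rewrite gt_eqF // mulr_gt0 // (lt_le_trans pm_gt0).
Qed.

(** Monotone convergence along the discs of radius 1 - 1 / (n + 1). *)
Lemma power_disc_integral_le g (bound : \bar R) :
  measurable_fun (@disc R : set (borelC R)) (fun z : borelC R => cabs (g z) `^ (a * p z)) ->
  (forall r, r < 1 ->
    (\int[mu]_(z in [set z | (cabs z <= r)%R]) (cabs (g z) `^ (a * p z))%:E <= bound)%E) ->
  (\int[mu]_(z in (@disc R : set (borelC R))) (cabs (g z) `^ (a * p z))%:E <= bound)%E.
Proof.
move=> mg Hb.
pose F (n : nat) : set (borelC R) := [set z | cabs z <= 1 - (n.+1%:R)^-1].
have F1 n : 1 - (n.+1%:R)^-1 < 1 :> R by rewrite gtrBl invr_gt0 ltr0n.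
have mF n : measurable (F n).
  have -> : F n = ~` [set z | 1 - (n.+1%:R)^-1 < cabs z].
    by apply/seteqP; split => z; rewrite /F /= leNgt => /negP.
  by apply: measurableC; apply: measurable_superlevel; exact: cabs_continuous.
have -> : (@disc R : set (borelC R)) = \bigcup_n F n.
  apply/seteqP; split => [z z1|z [n _ zn]]; last exact: le_lt_trans zn (F1 n).
  have d0 : 0 < 1 - cabs z by rewrite subr_gt0.
  exists (Num.bound (1 - cabs z)^-1) => //; rewrite /F /= lerBrDr -lerBrDl.
  rewrite -[leRHS]invrK lef_pV2 ?posrE ?invr_gt0 ?ltr0n //.
  have := archi_boundP (ltW (_ : 0 < (1 - cabs z)^-1)); rewrite invr_gt0 => /(_ d0)/ltW/le_trans.
  by apply; rewrite ler_nat.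
have FD n : F n `<=` (@disc R : set (borelC R)) by move=> z zn; exact: le_lt_trans zn (F1 n).
have ndF : {homo F : n m / (n <= m)%N >-> (n <= m)%O}.
  move=> n m nm; apply/subsetPset => z; rewrite /F /= => /le_trans; apply.
  by rewrite lerD2l lerN2 lef_pV2 ?posrE ?ltr0n // ler_nat.
have mgF n : measurable_fun (F n) (fun z : borelC R => (cabs (g z) `^ (a * p z))%:E).
  apply/measurable_EFinP; apply: measurable_funS mg => //.
  by apply: measurable_open_plane; exact: open_disc.
have cvgF := ge0_nondecreasing_set_cvg_integral (mu := mu) ndF mF mgF
  (fun n z _ => powR_ge0 (cabs (g z)) (a * p z)).
rewrite -(cvg_lim _ cvgF) //; apply: lime_le; first by apply/cvg_ex; eexists; exact: cvgF.
by apply: nearW => n; exact: Hb.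
Qed.

Variable C : R.
Hypothesis mu_carleson : forall h th : R, 0 < h <= 1 ->
  (mu (carleson_square h th) < (C * h `^ a)%R%:E)%E.

(** W g is at most a constant times the Poisson integral of W g + 1 on a circle where the
    modular is at most 1, and the embedding applies to this Poisson integral. *)
Lemma power_integral_bound : exists2 K, 0 <= K & forall g,
  (forall z, cabs z < 1 -> cdiff g z) ->
  (forall r, r < 1 -> exists2 s, r < s < 1 & cmean (fun t => W p g (polar s t) ^+ 2) <= 1) ->
  (\int[mu]_(z in (@disc R : set (borelC R))) (cabs (g z) `^ (a * p z))%:E <= K%:E)%E.
Proof.
have [K K0 HK] := carleson_disc_ball a_ge1 mu_carleson.
have [c c0 Hc] := W_le_PI pm_gt0 p_bounded p_lh (@ler01 R).
exists (K * (2 ^+ 13 * c ^+ 2 * 4) `^ a); first by rewrite mulr_ge0 ?powR_ge0.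
move=> g dg Hg; have mga := measurable_disc_power dg a_gt0.
apply: power_disc_integral_le => // r r1.
have m1 : Num.max 2^-1 ((1 + r) / 2) < 1.
  by rewrite gt_max invf_lt1 ?ltr1n //=; move: r1; lra.
have [s /andP[rs s1] Ws] := Hg _ m1.
move: rs; rewrite gt_max => /andP[s2 rs].
have s0 : 0 < s by apply: lt_trans s2; rewrite invr_gt0.
have s01 : 0 < s < 1 by rewrite s0.
have bW : bm (fun t => W p g (polar s t)).
  by apply: (bm_W pm_gt0 p_bounded p_lh) => //; rewrite ltW.
pose k t := W p g (polar s t) + 1.
have bk : bm k by apply: bmD => //; exact: bm_cst.
have k1 t : 0 <= t <= 2 * pi -> 1 <= k t by move=> _; rewrite lerDr W_ge0.
have ck : cmean (fun t => k t ^+ 2) <= 4.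
  apply: (@le_trans _ _ (cmean (fun t => 2 * W p g (polar s t) ^+ 2 + 2))).
    apply: le_cmean; [exact: bmX|by apply: bmD; [apply: bmZ; exact: bmX|exact: bm_cst]|].
    move=> t _; have := sqr_ge0 (W p g (polar s t) - 1).
    by rewrite /k sqrrB sqrrD !mulr2n expr1n mulr1; lra.
  rewrite cmeanD ?cmeanZ ?cmean_cst; [|exact: bmX|apply: bmZ; exact: bmX|exact: bm_cst].
  by move: Ws; lra.
have mW : measurable_fun (@disc R : set (borelC R)) (W p g : borelC R -> R).
  have := measurable_disc_power dg (_ : 0 < 2^-1); rewrite invr_gt0 => /(_ (ltr0n _ 2)).
  by apply: eq_measurable_fun => z _; rewrite /W mulrC.
have Wk z : cabs z <= r -> 0 <= W p g z <= c * PI z k.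
  move=> zr; rewrite W_ge0 /=; have z1 : cabs z < 1 by apply: le_lt_trans r1.
  rewrite /k PI_D ?PI_cst //; last exact: bm_cst.
  by apply: Hc => //; move: rs zr; lra.
have := poisson_embedding a_ge1 K0 HK bk k1 r1 (ltW c0) mW Wk.
under eq_integral => z _ do rewrite sqr_W -powRrM mulrC.
move=> /le_trans; apply; rewrite lee_fin; apply: ler_wpM2l => //.
have c2 : 0 <= 2 ^+ 13 * c ^+ 2 by apply: mulr_ge0; [exact: exprn_ge0|exact: sqr_ge0].
apply: powR_le; [exact: ltW|apply: mulr_ge0 => //|exact: ler_wpM2l].
by apply: cmean_ge0 => t _; exact: sqr_ge0.
Qed.

Lemma hardy_norm_lim f (L : R) : circle_norm p r f @[r --> (1%R : R)^'-] --> L%:E ->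
  hardy_norm p f = L%:E.
Proof. by move=> cvL; exact: cvg_lim. Qed.

(** For l above the limit of the circle norms, f / l has modular at most 1 on circles
    arbitrarily close to the boundary.  The factor M makes the resulting bound K for the
    integral smaller than 1. *)
Theorem carleson_sufficient : exists C' : R, forall f, hardy p f ->
  (lebesgue_norm mu (fun z => (a * p z)%R) f <= C'%:E * hardy_norm p f)%E.
Proof.
have [K K0 HK] := power_integral_bound.
have ap0 : 0 < a * pm by rewrite mulr_gt0.
pose M := (K + 2) `^ (a * pm)^-1.
have M1 : 1 <= M.
  by rewrite -[leLHS](powR1x (a * pm)^-1); apply: powR_le => //;
    [rewrite invr_ge0 ltW|move: K0; lra].
have M0 : 0 < M by apply: lt_le_trans M1.
have MK : M `^ (a * pm) = K + 2 by rewrite -powRrM mulVf ?gt_eqF // powRr1 // addr_ge0.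
exists M => f hf; have [L L0 cvL] := circle_norm_cvg pm_gt0 p_bounded p_lh hf.
rewrite (hardy_norm_lim cvL) -EFinM.
have df z : cabs z < 1 -> cdiff f z by move=> z1; apply: derivable_cdiff; exact: hf.1.
have main l : L < l -> (lebesgue_norm mu (fun z => (a * p z)%R) f <= (M * l)%:E)%E.
  move=> Ll; have l0 : 0 < l by apply: le_lt_trans Ll.
  have Ml0 : 0 < M * l by rewrite mulr_gt0.
  apply: ereal_inf_lbound; exists (M * l) => //; split => //.
  have dg (l' : R) z : cabs z < 1 -> cdiff (fun w => (l'^-1)%:C * f w) z.
    by move=> /df; exact: cdiff_scaled.
  have mg l' := measurable_disc_power (dg l') a_gt0.
  have IK : (\int[mu]_(z in (@disc R : set (borelC R)))
      (cabs ((l^-1)%:C * f z) `^ (a * p z))%:E <= K%:E)%E.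
    apply: (HK (fun w => (l^-1)%:C * f w)); first exact: dg.
    move=> r r1.
    have [finN cvN] := (fine_cvgP _ _).1 cvL.
    have : \forall s \near (1 : R)^'-, [/\ r < s, 0 <= s, s < 1 & (circle_norm p s f < l%:E)%E].
      near=> s; split.
      - by near: s; exact: nbhs_left_gt.
      - by near: s; exact: nbhs_left_ge.
      - by near: s; exact: nbhs_left_lt.
      - rewrite -(@fineK _ (circle_norm p s f)); last by near: s.
        rewrite lte_fin; near: s; exact: (cvgr_lt _ cvN).
    move=> /filter_ex[s [rs s0 s1 Ns]]; exists s; first by rewrite rs.
    have s01 : 0 <= s < 1 by rewrite s0.
    have [_ /ltW] := modular_lt1 pm_gt0 p_bounded p_lh df s01 Ns.
    by rewrite modularE.
  have K2 : 0 <= (K + 2)^-1 by rewrite invr_ge0 addr_ge0.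
  apply: (@le_lt_trans _ _ ((K + 2)^-1%:E * K%:E)%E); last first.
    by rewrite -EFinM lte_fin mulrC ltr_pdivrMr ?mul1r ?ltrDl // ltr_wpDl.
  apply: le_trans (lee_wpmul2l _ IK); last by rewrite lee_fin.
  have mD : measurable (@disc R : set (borelC R)).
    by apply: measurable_open_plane; exact: open_disc.
  rewrite -(ge0_integralZl_EFin mu mD _ _ K2);
    [|by move=> z _; rewrite lee_fin powR_ge0|by apply/measurable_EFinP; exact: mg].
  apply: ge0_le_integral => //.
  - by move=> z _; rewrite lee_fin powR_ge0.
  - apply/measurable_EFinP; apply: eq_measurable_fun (mg (M * l)) => z _.
    by rewrite (cabs_div f).
  - under eq_fun do rewrite -EFinM; apply/measurable_EFinP.
    by apply: measurable_funM; [exact: measurable_cst|exact: mg].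
  move=> z z1; rewrite -EFinM lee_fin -(cabs_div f) //.
  have cz : closed_disc z by exact: ltW z1.
  have /andP[pz _] := p_bounded cz.
  have c0 : 0 <= cabs (f z) / l by rewrite divr_ge0 ?cabs_ge0 // ltW.
  have -> : cabs (f z) / (M * l) = M^-1 * (cabs (f z) / l) by field; rewrite !gt_eqF.
  have MV0 : 0 <= M^-1 by rewrite invr_ge0 ltW.
  rewrite (powRM _ MV0 c0) ler_wpM2r ?powR_ge0 //.
  rewrite -MK -(powRV (a * pm) (ltW M0)).
  by apply: ger_powR; [rewrite invr_gt0 M0 invf_le1|rewrite ler_pM2l].
apply/lee_addgt0Pr => e e0; rewrite -EFinD.
have -> : M * L + e = M * (L + e / M) by field; rewrite gt_eqF.
by apply: main; rewrite ltrDl divr_gt0.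
Unshelve. all: by end_near.
Qed.

End sufficiency.

(** * Test functions concentrated near a boundary point *)

Section test_functions.
Variable R : realType.
Variables (p : R[i] -> R) (pm pM : R).
Hypothesis pm_gt0 : 0 < pm.
Hypothesis p_bounded : forall z, closed_disc z -> pm <= p z <= pM.
Hypothesis p_lh : log_holder p.
Variables (C : R) (n : nat).
Hypothesis p_scaleC : log_scale p (24 ^+ 2) C.
Hypothesis n_large : 2 <= n%:R * pm.
Variables (h : R) (w : R[i]).
Hypothesis h01 : 0 < h <= 1.
Hypothesis cabs_w : cabs w = 1 - h.
Implicit Types (z : R[i]) (r t : R).

Let h_gt0 : 0 < h. Proof. by case/andP: h01. Qed.
Let h_le1 : h <= 1. Proof. by case/andP: h01. Qed.

Let closed_w : closed_disc w.
Proof. by rewrite /closed_disc /= cabs_w lerBlDr lerDl ltW. Qed.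

Let pw_gt0 : 0 < p w. Proof. by have /andP[h1 _] := p_bounded closed_w; apply: lt_le_trans h1. Qed.

Definition denominator z := 1 - (w^*)%C * z.

(** The normalisation gives |f| ^ p the size 1 / h near w. *)
Definition test_function z : R[i] :=
  (h `^ (n%:R - (p w)^-1))%:C * (denominator z)^-1 ^+ n.

Local Notation D z := (cabs (denominator z)).

Lemma denominator_ge z : cabs z <= 1 -> h <= D z.
Proof.
move=> z1; apply: le_trans (ler_cabsB _ _); rewrite cabs1 cabsM cabs_conj cabs_w.
have : (1 - h) * cabs z <= 1 - h by rewrite ler_piMr // subr_ge0.
lra.
Qed.

Lemma denominator_gt0 z : cabs z <= 1 -> 0 < D z.
Proof. by move=> /denominator_ge; apply: lt_le_trans. Qed.

Lemma mul_conj (v : R[i]) : v * (v^*)%C = (cabs v ^+ 2)%:C.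
Proof.
rewrite sqr_cabs; case: v => x y; apply/eqP; rewrite eq_complex /=.
by apply/andP; split; apply/eqP; ring.
Qed.

Lemma dist_le_denominator z : cabs z <= 1 -> cabs (z - w) <= 3 * D z.
Proof.
move=> z1; have -> : z - w = (1 - cabs w ^+ 2)%:C * z + (- w) * denominator z.
  rewrite /denominator rmorphB /= -mul_conj rmorph1; ring.
apply: le_trans (ler_cabsD _ _) _; rewrite !cabsM cabs_real cabs_w.
have -> : cabs (- w) = 1 - h by rewrite -(sub0r w) cabs_distrC subr0.
have Dh := denominator_ge z1; have D0 := denominator_gt0 z1.
have e : 1 - (1 - h) ^+ 2 = 2 * h - h * h by ring.
have hh : 0 <= h * h by rewrite mulr_ge0 // ltW.
have h2 : h * h <= h by rewrite ler_piMr // ltW.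
have -> : `|1 - (1 - h) ^+ 2| = 1 - (1 - h) ^+ 2 by rewrite ger0_norm // e; lra.
have : (1 - (1 - h) ^+ 2) * cabs z <= 2 * h.
  by apply: (@le_trans _ _ (2 * h * 1)); [apply: ler_pM => //; rewrite ?cabs_ge0 // e; lra|rewrite mulr1].
have : (1 - h) * D z <= D z by rewrite ler_piMl ?(ltW D0) // gerBl ltW.
lra.
Qed.

Lemma cdiff_test z : cabs z < 1 -> cdiff test_function z.
Proof.
move=> z1; apply: cdiffM; first exact: cdiff_cst.
have d1 : cdiff (fun z => (denominator z)^-1) z.
  apply: cdiffV; first by rewrite -cabs_gt0 denominator_gt0 // ltW.
  by apply: cdiffB; [exact: cdiff_cst|apply: cdiffM; [exact: cdiff_cst|exact: cdiff_id]].
elim: n => [|m IH]; first by under eq_fun do rewrite expr0; exact: cdiff_cst.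
by under eq_fun do rewrite exprS; exact: cdiffM.
Qed.

Lemma cabs_test z : cabs z <= 1 ->
  cabs (test_function z) = h `^ (- (p w)^-1) * (h / D z) ^+ n.
Proof.
move=> z1; rewrite cabsM cabsX cabsV cabs_real ger0_norm ?powR_ge0 //.
rewrite exprMn exprVn mulrA; congr (_ * _).
rewrite addrC powRD ?powR_mulrn ?(ltW h_gt0) //.
by apply/implyP => _; rewrite gt_eqF.
Qed.

Lemma powR_expE (y : R) : h `^ y = expR (- y * ln h^-1).
Proof. by rewrite lnV ?posrE // mulrNN /powR gt_eqF. Qed.

Lemma ln_invh_ge0 : 0 <= ln h^-1.
Proof. by rewrite lnV ?posrE // oppr_ge0 ln_le0. Qed.

Lemma scale_exponent z : closed_disc z -> cabs (z - w) ^+ 2 <= 24 ^+ 2 * h ->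
  (p w)^-1 * `|p z - p w| * ln h^-1 <= C / pm.
Proof.
move=> cz /(p_scaleC cz closed_w h01) H; rewrite -mulrA mulrC.
have L0 := ln_invh_ge0.
apply: ler_pM => //; first by rewrite mulr_ge0.
  by rewrite invr_ge0 ltW.
by rewrite lef_pV2 ?posrE //; case/andP: (p_bounded closed_w).
Qed.

(** Where the test function is larger than one, z lies within a multiple of the square root of h
    from w, and there the exponent may be replaced by its value at w. *)
Lemma test_power_le z : cabs z <= 1 ->
  cabs (test_function z) `^ p z <= 1 + expR (C / pm) * (h / D z ^+ 2).
Proof.
move=> z1; have D0 := denominator_gt0 z1; have Dh := denominator_ge z1.
have cz : closed_disc z by [].
have /andP[pz _] := p_bounded cz; have /andP[pw _] := p_bounded closed_w.
set b := cabs _; have bE : b = h `^ (- (p w)^-1) * (h / D z) ^+ n by exact: cabs_test.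
have b0 : 0 <= b by exact: cabs_ge0.
have E0 := expR_gt0 (C / pm).
have y0 : 0 <= h / D z ^+ 2 by rewrite divr_ge0 ?sqr_ge0 // ltW.
have x0 : 0 < h / D z by rewrite divr_gt0.
have x1 : h / D z <= 1 by rewrite ler_pdivrMr // mul1r.
have [b1|b1] := leP b 1.
  apply: (@le_trans _ _ 1); last by rewrite lerDl mulr_ge0 // ltW.
  by rewrite -(powR1x (p z)); apply: powR_le => //; apply: le_trans pz; exact: ltW.
have bpw : b `^ p w <= h / D z ^+ 2.
  rewrite bE powRM ?powR_ge0 ?exprn_ge0 ?(ltW x0) //.
  rewrite -powRrM mulNr mulVf ?gt_eqF // powR_inv1 ?(ltW h_gt0) //.
  rewrite -powR_mulrn ?(ltW x0) // -powRrM.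
  have -> : h / D z ^+ 2 = h^-1 * (h / D z) ^+ 2 by field; rewrite !gt_eqF.
  rewrite ler_pM2l ?invr_gt0 // -powR_mulrn ?(ltW x0) //.
  apply: ger_powR; first by rewrite x0.
  by apply: le_trans n_large _; rewrite ler_wpM2l.
have near_w : cabs (z - w) ^+ 2 <= 24 ^+ 2 * h.
  have D2 : D z ^+ 2 <= h.
    rewrite -[leRHS]mulr1 -ler_pdivrMl // mulrC -[leRHS]invr1 -invf_div lef_pV2 ?posrE ?divr_gt0 ?exprn_gt0 //.
    apply: le_trans bpw; rewrite -(powR1x (p w)); apply: powR_le => //; first exact: ltW.
    exact: ltW.
  apply: (@le_trans _ _ ((3 * D z) ^+ 2)).
    by rewrite lerXn2r ?nnegrE ?cabs_ge0 ?dist_le_denominator // mulr_ge0 // ltW.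
  rewrite exprMn; apply: ler_pM => //; rewrite ?sqr_ge0 //.
  by rewrite lerXn2r ?nnegrE // ler_nat.
have -> : p z = p w + (p z - p w) by ring.
rewrite powRD; last by apply/implyP => _; rewrite gt_eqF // (lt_trans ltr01).
apply: (@le_trans _ _ (h / D z ^+ 2 * expR (C / pm))); last by rewrite mulrC lerDr.
apply: ler_pM; rewrite ?powR_ge0 //.
apply: (@le_trans _ _ (b `^ `|p z - p w|)); first by apply: ler_powR; [exact: ltW|exact: ler_norm].
apply: (@le_trans _ _ ((h `^ (- (p w)^-1)) `^ `|p z - p w|)).
  by apply: powR_le => //; rewrite bE ler_piMr ?powR_ge0 // exprn_ile1 // ltW.
rewrite -powRrM powR_expE ler_expR [- (p w)^-1 * _]mulNr opprK.
exact: scale_exponent.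
Qed.

(** The bound on the denominator places z within a multiple of h from w, so that h ^ (- p z
    / p w) is comparable to 1 / h. *)
Lemma test_power_ge z (a lam : R) : cabs z <= 1 -> 0 <= a -> 1 <= lam -> D z <= 8 * h ->
  ((8 ^- n) / lam) `^ (a * pM) * expR (- (a * (C / pm))) / h `^ a <=
  (cabs (test_function z) / lam) `^ (a * p z).
Proof.
move=> z1 a0 lam1 Dz; have D0 := denominator_gt0 z1; have Dh := denominator_ge z1.
have cz : closed_disc z by [].
have /andP[pz pzM] := p_bounded cz.
have lam0 : 0 < lam by apply: lt_le_trans lam1.
have u0 : 0 < 8 ^- n / lam by rewrite divr_gt0 // invr_gt0 exprn_gt0.
have u1 : 8 ^- n / lam <= 1.
  rewrite ler_pdivrMr // mul1r; apply: le_trans lam1.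
  by rewrite invf_le1 ?exprn_gt0 // exprn_ege1 // ler1n.
have near_w : cabs (z - w) ^+ 2 <= 24 ^+ 2 * h.
  apply: (@le_trans _ _ ((24 * h) ^+ 2)).
    rewrite lerXn2r ?nnegrE ?cabs_ge0 ?mulr_ge0 ?(ltW h_gt0) //.
    by apply: le_trans (dist_le_denominator z1) _; move: Dz; lra.
  by rewrite exprMn ler_wpM2l ?sqr_ge0 // expr2 ler_piMr // ltW.
apply: (@le_trans _ _ ((8 ^- n / lam * h `^ (- (p w)^-1)) `^ (a * p z))); last first.
  apply: powR_le; [by rewrite mulr_ge0 // (le_trans _ pz) // ltW|by rewrite mulr_ge0 ?powR_ge0 // ltW|].
  rewrite (cabs_test z1) mulrC mulrA ler_pM2r ?invr_gt0 // ler_wpM2l ?powR_ge0 //.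
  rewrite -exprVn lerXn2r ?nnegrE ?invr_ge0 ?divr_ge0 ?(ltW h_gt0) ?(ltW D0) //.
  by rewrite ler_pdivlMr // mulrC ler_pdivrMr // mulrC.
rewrite (powRM _ (ltW u0) (powR_ge0 _ _)) -mulrA; apply: ler_pM.
- exact: powR_ge0.
- by rewrite divr_ge0 ?powR_ge0 // ltW // expR_gt0.
- by apply: ger_powR; rewrite ?u0 // ler_wpM2l.
rewrite -powRrM -powRN !powR_expE -expRD ler_expR.
have H := scale_exponent cz near_w; have L0 := ln_invh_ge0.
have : (p w)^-1 * - (p z - p w) * ln h^-1 <= C / pm.
  apply: le_trans H; rewrite ler_wpM2r // ler_wpM2l ?invr_ge0 ?(ltW pw_gt0) //.
  by rewrite -normrN ler_norm.
have -> : (p w)^-1 * - (p z - p w) * ln h^-1 = ln h^-1 - (p w)^-1 * p z * ln h^-1.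
  by field; rewrite gt_eqF.
move=> /(ler_wpM2l a0).
have -> : a * (ln h^-1 - (p w)^-1 * p z * ln h^-1) =
  a * ln h^-1 - - (- (p w)^-1 * (a * p z)) * ln h^-1 by ring.
rewrite opprK; lra.
Qed.

Lemma denominator_polar r t : D (polar r t) = cabs (polar 1 t - r%:C * w).
Proof.
have -> : polar 1 t - r%:C * w = polar 1 t * ((denominator (polar r t))^*)%C.
  rewrite /denominator; case: w => x y; apply/eqP; rewrite eq_complex /=.
  have e : cos t ^+ 2 = 1 - sin t ^+ 2 by exact: cos2sin2.
  by apply/andP; split; apply/eqP; ring: e.
by rewrite cabsM cabs_polar1 mul1r cabs_conj.
Qed.

(** The quotient of h by the squared denominator is at most the Poisson kernel at r w, whose
    mean is 1. *)
Lemma test_circle_le r : 0 <= r < 1 -> modular p test_function 1 r <= 1 + expR (C / pm).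
Proof.
move=> r01; have /andP[r0 r1] := r01.
have bm1 := bm_modular pm_gt0 p_bounded p_lh cdiff_test ltr01 r01.
have crw : cabs (r%:C * w) <= 1 - h.
  by rewrite cabsM cabs_real ger0_norm // cabs_w ler_piMl ?subr_ge0 // ltW.
have rw1 : cabs (r%:C * w) < 1 by apply: le_lt_trans crw _; rewrite gtrBl.
have bE : bm (fun t => expR (C / pm) * PK (r%:C * w) t) by apply: bmZ; exact: bm_PK.
apply: (@le_trans _ _ (cmean (fun t => 1 + expR (C / pm) * PK (r%:C * w) t))); last first.
  by rewrite (cmeanD (bm_cst 1) bE) cmean_cst (cmeanZ _ (bm_PK rw1)) (PK_mass rw1) mulr1.
apply: le_cmean => //; first by apply: bmD => //; exact: bm_cst.
move=> t _; rewrite divr1.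
have zr : cabs (polar r t) <= 1 by rewrite cabs_polar ger0_norm // ltW.
apply: le_trans (test_power_le zr) _; rewrite lerD2l ler_pM2l ?expR_gt0 //.
rewrite denominator_polar ler_pM2r ?invr_gt0 ?exprn_gt0 ?circle_dist_gt0 //.
have c0 := cabs_ge0 (r%:C * w).
have : cabs (r%:C * w) ^+ 2 <= cabs (r%:C * w) by rewrite expr2 ler_piMl // ltW.
lra.
Qed.

End test_functions.

(** * Necessity of the Carleson condition *)

Section necessity.
Variable R : realType.
Variables (p : R[i] -> R) (pm pM : R).
Hypothesis pm_gt0 : 0 < pm.
Hypothesis p_bounded : forall z, closed_disc z -> pm <= p z <= pM.
Hypothesis p_lh : log_holder p.
Variables (mu : {finite_measure set (borelC R) -> \bar R}) (a : R).
Hypothesis a_ge1 : 1 <= a.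
Implicit Types (z w : R[i]) (f : R[i] -> R[i]) (r t l h th : R).

Let a_gt0 : 0 < a. Proof. exact: lt_le_trans a_ge1. Qed.

Lemma carleson_square_denominator h th z : 0 < h <= 1 -> carleson_square h th z ->
  cabs (denominator (polar (1 - h) th) z) <= 8 * h.
Proof.
move=> /andP[h0 h1] [/andP[zh z1] [t [/andP[t1 t2] zt]]].
set s := (1 - h) * cabs z; set u := t - th.
have -> : denominator (polar (1 - h) th) z = (1 - s)%:C + s%:C * (polar 1 0 - polar 1 u).
  rewrite /denominator {1}zt /u.
  have -> : (polar (1 - h) th)^*%C = polar (1 - h) (- th).
    by apply/eqP; rewrite eq_complex /= cosN sinN mulrN !eqxx.
  rewrite polarM -/s polar0 (polarE s) addrC -[_ + t]addrC rmorphB rmorph1 /=; ring.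
apply: le_trans (ler_cabsD _ _) _; rewrite cabsM !cabs_real.
have s0 : 0 <= s by rewrite mulr_ge0 ?cabs_ge0 // subr_ge0.
have s1 : (1 - h) * (1 - h) <= s by rewrite ler_wpM2l // subr_ge0.
have hh : 0 <= h * h by rewrite mulr_ge0 // ltW.
have e : (1 - h) * (1 - h) = 1 - 2 * h + h * h by ring.
have s2 : s <= 1.
  rewrite -[leRHS]mulr1; apply: ler_pM; rewrite ?cabs_ge0 ?subr_ge0 ?(ltW z1) //.
  by rewrite gerBl ltW.
have P : cabs (polar 1 0 - polar 1 u) <= (4 + 3 * `|1 : R|) * (h / 2).
  rewrite cabs_distrC; apply: polar_lipschitz.
  - by apply/andP; split; lra.
  - by rewrite subrr normr0; lra.
  - by rewrite subr0 ler_norml /u; apply/andP; split; lra.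
rewrite (ger0_norm s0) ger0_norm ?subr_ge0 //; rewrite normr1 in P.
have : s * cabs (polar 1 0 - polar 1 u) <= cabs (polar 1 0 - polar 1 u).
  by rewrite ler_piMl ?cabs_ge0.
lra.
Qed.

(** The circle norms of the test functions are bounded by a K that does not depend on h,
    whereas the power a p of their modulus is at least a multiple of h ^ (- a) on the
    square. *)
Lemma carleson_necessary (C0 : R) : (forall f, hardy p f ->
    (lebesgue_norm mu (fun z => (a * p z)%R) f <= C0%:E * hardy_norm p f)%E) ->
  exists C' : R, forall h th, 0 < h <= 1 ->
    (mu (carleson_square h th) < (C' * h `^ a)%R%:E)%E.
Proof.
move=> emb.
have [C _ HC] : exists2 C, 0 <= C & log_scale p (24 ^+ 2) C.
  by apply: (p_scale pm_gt0 p_bounded p_lh); rewrite exprn_ege1 // ler1n.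
pose n := Num.bound (2 / pm).
have n_large : 2 <= n%:R * pm.
  by rewrite -ler_pdivrMr // ltW // archi_boundP // divr_ge0 // ltW.
pose B := 1 + expR (C / pm).
have B0 : 0 < B by rewrite addr_gt0 // expR_gt0.
pose K := (B + 1) `^ pm^-1.
have B1 : 0 <= B + 1 by rewrite addr_ge0 // ltW.
have K1 : 1 <= K.
  by rewrite -[leLHS](powR1x pm^-1); apply: powR_le; rewrite ?invr_ge0 ?(ltW pm_gt0) // lerDr ltW.
have K0 : 0 < K by apply: lt_le_trans K1.
have KB : K `^ pm = B + 1 by rewrite -powRrM mulVf ?gt_eqF // powRr1.
pose lam := `|C0| * K + 1.
have lam1 : 1 <= lam by rewrite lerDr mulr_ge0 // ltW.
have lam0 : 0 < lam by apply: lt_le_trans lam1.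
pose m := (8 ^- n / lam) `^ (a * pM) * expR (- (a * (C / pm))).
have m0 : 0 < m.
  by rewrite mulr_gt0 ?expR_gt0 // powR_gt0 // divr_gt0 // invr_gt0 exprn_gt0.
exists m^-1 => h th h01; have /andP[h0 h1] := h01.
pose w := polar (1 - h) th.
have cw : cabs w = 1 - h by rewrite cabs_polar ger0_norm // subr_ge0.
pose f := test_function p n h w.
have df z : cabs z < 1 -> cdiff f z by exact: cdiff_test.
have Nf r : 0 <= r < 1 -> (circle_norm p r f <= K%:E)%E.
  move=> r01; apply: (circle_norm_le pm_gt0 p_bounded p_lh df r01 K0).
  have hK : 0 < (1 : R) <= K by rewrite ltr01.
  apply: le_lt_trans (modular_rescale pm_gt0 p_bounded p_lh df r01 hK) _.
  have Ar : modular p f 1 r <= B by exact: (test_circle_le pm_gt0 p_bounded p_lh HC n_large h01 cw r01).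
  rewrite div1r (powRV pm (ltW K0)) KB mulrC ltr_pdivrMr; last by apply: addr_gt0.
  by rewrite mul1r; apply: le_lt_trans Ar _; rewrite ltrDl.
have hf : hardy p f.
  split; first by move=> z z1; apply: cdiff_derivable; exact: df.
  apply: (@le_lt_trans _ _ K%:E); last exact: ltry.
  by apply: ge_ereal_sup => _ [r r01 <-]; exact: Nf.
have [L L0 cvL] := circle_norm_cvg pm_gt0 p_bounded p_lh hf.
have LK : L <= K.
  rewrite leNgt; apply/negP => KL.
  have [_ cvN] := (fine_cvgP _ _).1 cvL.
  have : \forall s \near (1 : R)^'-, [/\ 0 <= s, s < 1 & K < fine (circle_norm p s f)].
    near=> s; split.
    - by near: s; exact: nbhs_left_ge.
    - by near: s; exact: nbhs_left_lt.
    - by near: s; exact: (cvgr_gt _ cvN).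
  move=> /filter_ex[s [s0 s1]]; apply/negP; rewrite -leNgt.
  have s01 : 0 <= s < 1 by rewrite s0.
  have := Nf s s01; have := circle_norm_ge0 p f s.
  by case: (circle_norm p s f) => [x| |] //=; rewrite lee_fin.
have := emb f hf; rewrite (hardy_norm_lim cvL) -EFinM.
have C0L : C0 * L < lam.
  apply: (@le_lt_trans _ _ (`|C0| * K)); last by rewrite ltrDl.
  by apply: le_trans (ler_wpM2r L0 (ler_norm C0)) _; exact: ler_wpM2l.
move=> /le_lt_trans/(_ (_ : _ < lam%:E)%E); rewrite lte_fin => /(_ C0L).
move=> /ereal_inf_lt[_ [l [l0 Il] <-]]; rewrite lte_fin => ll.
set S := carleson_square h th.
have mS : measurable (S : set (borelC R)) by exact: measurable_carleson_square.
have mD : measurable (@disc R : set (borelC R)).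
  by apply: measurable_open_plane; exact: open_disc.
have SD : S `<=` @disc R by move=> z [/andP[]].
have mf : measurable_fun (@disc R : set (borelC R))
    (fun z : borelC R => ((cabs (f z) / l) `^ (a * p z))%:E).
  apply/measurable_EFinP.
  have dl z : cabs z < 1 -> cdiff (fun w => (l^-1)%:C * f w) z by move=> /df; exact: cdiff_scaled.
  apply: eq_measurable_fun (measurable_disc_power pm_gt0 p_bounded p_lh dl a_gt0) => z _.
  by rewrite (cabs_div f).
have ha : 0 < h `^ a by exact: powR_gt0.
have lower : ((m / h `^ a)%:E * mu S < 1)%E.
  apply: le_lt_trans Il; rewrite -(integral_cst mu mS).
  apply: (@le_trans _ _ (\int[mu]_(z in (S : set (borelC R))) ((cabs (f z) / l) `^ (a * p z))%:E)%E).
    apply: ge0_le_integral => //.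
    - by move=> z _; rewrite lee_fin divr_ge0 // ltW.
    - exact: measurable_funS mf.
    move=> z Sz; have z1 : cabs z <= 1 by apply: ltW; exact: SD.
    rewrite lee_fin.
    have Dz : cabs (denominator w z) <= 8 * h by exact: carleson_square_denominator.
    have H := @test_power_ge R p pm pM pm_gt0 p_bounded C n HC h w h01 cw z a lam z1 (ltW a_gt0) lam1 Dz.
    apply: le_trans H _.
    have /andP[pz _] := p_bounded (z1 : closed_disc z).
    apply: powR_le; first by rewrite mulr_ge0 ?(ltW a_gt0) // (le_trans _ pz) // ltW.
      by rewrite divr_ge0 ?cabs_ge0 // ltW.
    by rewrite ler_wpM2l ?cabs_ge0 // lef_pV2 ?posrE // ltW.
  apply: ge0_subset_integral => //.
  by move=> z _; rewrite lee_fin powR_ge0.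
have muS : mu S \is a fin_num by exact: fin_num_measure.
move: lower; rewrite -(fineK muS) -EFinM !lte_fin => lower.
by rewrite mulrC ltr_pdivlMr // mulrC -ltr_pdivlMl // mulrC -[ltRHS]invf_div -[ltRHS]mul1r ltr_pdivlMr ?divr_gt0 // mulrC.
Unshelve. all: by end_near.
Qed.

End necessity.

Lemma exponent_bounds (R : realType) (p : R[i] -> R) : (0 < p_minus p)%E ->
  (forall z, closed_disc z -> (p_minus p <= (p z)%:E)%E /\ ((p z)%:E <= p_plus p)%E) ->
  (p_plus p < +oo)%E ->
  exists pm pM : R, 0 < pm /\ forall z, closed_disc z -> pm <= p z <= pM.
Proof.
move=> pm0 pb pM1.
have c0 : closed_disc (0 : R[i]) by rewrite /closed_disc /= cabs0.
have [h1 h2] := pb 0 c0.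
have f1 : p_minus p \is a fin_num.
  by rewrite ge0_fin_numE ?(ltW pm0) // (le_lt_trans h1) // ltry.
have f2 : p_plus p \is a fin_num.
  by rewrite ge0_fin_numE // (le_trans _ h2) // (le_trans _ h1) // ltW.
exists (fine (p_minus p)), (fine (p_plus p)); split.
  by rewrite fine_gt0 // pm0 /= -ge0_fin_numE // ltW.
by move=> z /pb[]; rewrite -{1}(fineK f1) -{1}(fineK f2) !lee_fin => -> ->.
Qed.

Theorem theorem3p4 (R : realType) (p : R[i] -> R) (a : R)
    (mu : {finite_measure set (borelC R) -> \bar R})
    (p_minus_gt0 : (0 < p_minus p)%E)
    (p_bounds : forall z, closed_disc z ->
      (p_minus p <= (p z)%:E)%E /\ ((p z)%:E <= p_plus p)%E)
    (p_plus_lty : (p_plus p < +oo)%E)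
    (a_ge1 : 1 <= a)
    (p_lhbc : log_holder_bounded_conjugate p)
    (mu_disc : mu (~` @disc R) = 0%E) :
  (exists C : R, forall f, hardy p f ->
     (lebesgue_norm mu (fun z => (a * p z)%R) f <= C%:E * hardy_norm p f)%E)
  <->
  (exists C' : R, forall h theta0 : R, (0 < h <= 1)%R ->
     (mu (carleson_square h theta0) < (C' * h `^ a)%R%:E)%E).
Proof.
have [pm [pM [pm0 pb]]] := exponent_bounds p_minus_gt0 p_bounds p_plus_lty.
have lh := p_lhbc.1.
split=> [[C HC]|[C' HC']].
  exact: (carleson_necessary pm0 pb lh a_ge1 HC).
exact: (carleson_sufficient pm0 pb lh a_ge1 HC').
Qed.
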